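(* Let $A$ be a unitary $*$-algebra (over a field $F$ of characteristic zero) with quadratic codimension growth. Then $A$ generates a minimal variety if and only if $A$ is $T_*$-equivalent to some algebra $B\in\widetilde{\mathcal I}$, where $$\widetilde{\mathcal{I}} = \{C_{3,i_1}^{gr},\ C_{3,i_2},\ C_{3,i_3}^{gr},\ U_{3,*},\ U_{3,*}^{gri},\ N_{3,*},\ N_{3,*}^{gri},\ \mathcal{G}_{2,\psi}^{gr},\ \mathcal{G}_{2,\tau},\ \mathcal{G}_{2,\tau}^{gr},\ \mathcal{G}_{2,\tau}^{gri},\ \mathcal{G}_{2,\gamma}^{gr},\ \mathcal{G}_{2,\gamma}^{gri},\ W_{\eta_1}^{gri},\ W_{\eta_2}^{gr},\ W_{\eta_3}^{gri}\}.$$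
   Context: Throughout, $F$ is a field of characteristic zero and algebras are associative over $F$. A superalgebra is an algebra $A=A_0\oplus A_1$ with $A_iA_j\subseteq A_{i+j}$ (indices mod 2); we also write $A=(A_0,A_1)$. The trivial grading is $(A,0)$. A superinvolution on $A$ is a linear map $*:A\to A$ with $A_i^*\subseteq A_i$, $(a^* )^*=a$ and $(ab)^*=(-1)^{|a||b|}b^*a^*$ for all homogeneous $a,b$ (of degrees $|a|,|b|$). A $*$-algebra is a superalgebra with a superinvolution; it is unitary if it has a unit. Put $A_i^{+}=\{a\in A_i: a^*=a\}$, $A_i^-=\{a\in A_i:a^*=-a\}$. Let $\mathcal F$ be the free associative algebra on the disjoint sets $X_i^\varepsilon=\{x_{1,i}^\varepsilon,x_{2,i}^\varepsilon,\dots\}$, $i\in\{0,1\}$, $\varepsilon\in\{+,-\}$, where variables in $X_i^\varepsilon$ have degree $i$ and are symmetric ($\varepsilon=+$) or skew ($\varepsilon=-$). A polynomial $f\in\mathcal F$ is a $*$-identity of $A$ if it vanishes under all substitutions sending each $x_{j,i}^\varepsilon$ into $A_i^\varepsilon$; $\mathrm{Id}^*(A)$ is the set of all $*$-identities. The variety $\mathrm{var}^*(A)$ generated by $A$ is the class of all $*$-algebras $B$ with $\mathrm{Id}^*(A)\subseteq\mathrm{Id}^*(B)$. $A$ and $B$ are $T_*$-equivalent if $\mathrm{Id}^*(A)=\mathrm{Id}^*(B)$. $P_n^*$ is the span of all $w_{\sigma(1)}\cdots w_{\sigma(n)}$ with $\sigma\in S_n$ and $w_j\in\{x_{j,0}^+,x_{j,0}^-,x_{j,1}^+,x_{j,1}^-\}$,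 and $c_n^*(A)=\dim_F P_n^*/(P_n^*\cap \mathrm{Id}^*(A))$; for a variety $\mathcal V=\mathrm{var}^*(A)$ put $c_n^*(\mathcal V)=c_n^*(A)$. We write $c_n^*\approx\alpha n^k$ if $\lim_{n\to\infty} c_n^*/(\alpha n^k)=1$. $A$ has quadratic codimension growth if $c_n^*(A)\approx\alpha n^2$ for some $\alpha\neq0$. A variety $\mathcal V$ is minimal of polynomial growth $n^k$ if $c_n^*(\mathcal V)\approx\alpha n^k$ for some $\alpha\ne0$, and every proper subvariety $\mathcal W\subsetneq\mathcal V$ satisfies $c_n^*(\mathcal W)\approx\beta n^t$ for some $t<k$ and $\beta\neq0$, where proper subvarieties with $c_n^*(\mathcal W)=0$ for all large $n$ (nilpotent ones) are also allowed. The algebras (with $e_{ij}$ matrix units): (1) $C_3=\{a(e_{11}+e_{22}+e_{33})+b(e_{12}+e_{23})+ce_{13}\}$, $a,b,c\in F$. Maps: $i_1:(a,b,c)\mapsto(a,b,-c)$, $i_2:(a,b,c)\mapsto(a,-b,c)$, $i_3:(a,b,c)\mapsto(a,-b,-c)$. $C_{3,i_2}$: trivial grading, superinvolution $i_2$. $C_{3,i_1}^{gr}$, $C_{3,i_3}^{gr}$: grading $(F(e_{11}+e_{22}+e_{33})+Fe_{13},\,F(e_{12}+e_{23}))$ with superinvolution $i_1$, resp. $i_3$. (2) Inside the $6\times6$ upper triangular matrices, with $I_6$ the identity and $E=e_{23}+e_{45}$: $N_3=\mathrm{span}\{I_6,E,e_{12}-e_{56},e_{13},e_{46}\}$, $U_3=\mathrm{span}\{I_6,E,e_{12}+e_{56},e_{13},e_{46}\}$.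 The reflection superinvolution is $e_{ij}\mapsto e_{7-j,7-i}$. $N_{3,*},U_{3,*}$: trivial grading and reflection superinvolution. $N_{3,*}^{gri},U_{3,*}^{gri}$: reflection superinvolution and the elementary grading induced by $(g_1,\dots,g_6)=(0,1,1,0,0,1)$, i.e. $e_{ij}$ has degree $g_i+g_j \bmod 2$. (3) $\mathcal G_2=\langle 1,e_1,e_2\mid e_ie_j=-e_je_i,\ i,j=1,2\rangle$ (basis $1,e_1,e_2,e_1e_2$). Gradings: $\mathcal G_2$ trivial; $\mathcal G_2^{gr}=(F1+Fe_1e_2,\,Fe_1+Fe_2)$; $\mathcal G_2^{gri}=(F1+Fe_1,\,Fe_2+Fe_1e_2)$. Superinvolutions determined by $\psi(e_i)=e_i$, $\tau(e_i)=-e_i$, $\gamma(e_i)=(-1)^ie_i$ ($i=1,2$). For $\star\in\{\psi,\tau,\gamma\}$, $\mathcal G_{2,\star}$, $\mathcal G_{2,\star}^{gr}$, $\mathcal G_{2,\star}^{gri}$ denote these superalgebras with superinvolution $\star$. (4) $W=\{a(e_{11}+e_{22}+e_{33}+e_{44})+b(e_{12}+e_{34})+c(e_{13}+e_{24})+de_{14}\}$, $a,b,c,d\in F$. Maps: $\eta_1:(a,b,c,d)\mapsto(a,-b,c,-d)$, $\eta_2:(a,b,c,d)\mapsto(a,-b,c,d)$, $\eta_3:(a,b,c,d)\mapsto(a,-b,-c,d)$. $W_{\eta_2}^{gr}$: grading $(F(e_{11}+\cdots+e_{44})+Fe_{14},\,F(e_{12}+e_{34})+F(e_{13}+e_{24}))$,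 superinvolution $\eta_2$. $W_{\eta_1}^{gri}$, $W_{\eta_3}^{gri}$: grading $(F(e_{11}+\cdots+e_{44})+F(e_{12}+e_{34}),\,F(e_{13}+e_{24})+Fe_{14})$, superinvolution $\eta_1$, resp. $\eta_3$. *)

(* Defs.v *)
From HB Require Import structures.
From mathcomp Require Import all_boot all_order all_algebra all_fingroup finmap.
From mathcomp Require Import boolp classical_sets reals topology normedtype sequences.
From mathcomp Require Import ring.
(* The notations of multinomials' monalg clash with those of MathComp-Analysis. *)
From mathcomp.multinomials Require monalg.
Export -(notations) monalg.

Set Implicit Arguments.
Unset Strict Implicit.
Unset Printing Implicit Defensive.

Import Order.TTheory GRing.Theory Num.Theory.
Import numFieldNormedType.Exports.

Local Open Scope classical_set_scope.
Local Open Scope ring_scope.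

(* Algebras need not be unitary nor finite dimensional, hence a structure
   over [lmodType] rather than over [algType] or [vectType].
   [homog A i] is the component $A_i$; degrees are booleans, added by [(+)]. *)
Record starAlg (F : fieldType) := StarAlg {
  car :> lmodType F;
  amul : car -> car -> car;
  homog : bool -> car -> Prop;
  star : car -> car;
  amulA : associative amul;
  amul_linl : forall b, linear (amul^~ b);
  amul_linr : forall a, linear (amul a);
  homog0 : forall i, homog i 0;
  homog_lin : forall i (k : F) a b,
    homog i a -> homog i b -> homog i (k *: a + b);
  homog_sum : forall a, exists a0 a1,
    [/\ homog false a0, homog true a1 & a = a0 + a1];
  homog_direct : forall a, homog false a -> homog true a -> a = 0;
  homogM : forall i j a b,
    homog i a -> homog j b -> homog (i (+) j) (amul a b);
  star_lin : linear star;
  star_homog : forall i a, homog i a -> homog i (star a);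
  starK : involutive star;
  starM : forall i j a b, homog i a -> homog j b ->
    star (amul a b) = (-1) ^+ (i && j) *: amul (star b) (star a)
}.

Definition unitary F (A : starAlg F) : Prop :=
  exists e : A, forall a : A, amul e a = a /\ amul a e = a.

(* $A_i^+$ is [sympart A i false] and $A_i^-$ is [sympart A i true]. *)
Definition sympart F (A : starAlg F) (i skew : bool) (a : A) : Prop :=
  homog i a /\ star a = (-1) ^+ skew *: a.

(* The variable [(j, (i, s))] is $x_{j,i}^+$ if [s = false], $x_{j,i}^-$ if
   [s = true]. *)
Definition svar : choiceType := (nat * (bool * bool))%type.

Definition freeAlg (F : fieldType) := malg (fmonom svar) F.

Definition fvar F (x : svar) : freeAlg F := mkmalgU (fmu x) 1.

Definition substitution F (A : starAlg F) (s : svar -> A) : Prop :=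
  forall x : svar, sympart x.2.1 x.2.2 (s x).

(* The value on the empty word is irrelevant: see [star_id]. *)
Definition weval F (A : starAlg F) (s : svar -> A) (w : seq svar) : A :=
  if w is x :: w' then foldl (fun a y => amul a (s y)) (s x) w' else 0.

Definition peval F (A : starAlg F) (s : svar -> A) (f : freeAlg F) : A :=
  \sum_(w <- msupp f) mcoeff w f *: weval s w.

(* As algebras need not have a unit, identities are elements of the free
   algebra without unit, i.e. polynomials with zero constant term. *)
Definition star_id F (A : starAlg F) : set (freeAlg F) :=
  [set f | mcoeff (one : fmonom svar) f = 0 /\ forall s : svar -> A, substitution s -> peval s f = 0].

Definition variety F (A B : starAlg F) : Prop :=
  star_id A `<=` star_id B.

Definition proper_subvariety F (V W : starAlg F -> Prop) : Prop :=
  (forall B, W B -> V B) /\ (exists B, V B /\ ~ W B).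

Definition T_equiv F (A B : starAlg F) : Prop := star_id A = star_id B.

(* [(sigma, t)] encodes $w_{\sigma(1)}\cdots w_{\sigma(n)}$, where [t j] is the
   type of $w_j$. *)
Definition mlmon n : finType := ('S_n * {ffun 'I_n -> bool * bool})%type.

Definition mlmonomial (F : fieldType) n (p : mlmon n) : freeAlg F :=
  \prod_(i < n) fvar F (val (p.1 i), p.2 (p.1 i)).

(* $P_n^*$ is the range of [mlpoly], which is injective ([mlpoly_inj]). *)
Definition mlpoly (F : fieldType) n (c : {ffun mlmon n -> F^o}) : freeAlg F :=
  \sum_p c p *: mlmonomial F p.

Section FreeAlgebra.
Variable F : fieldType.
Implicit Types (f g : freeAlg F).

Lemma peval_lin (A : starAlg F) (s : svar -> A) : linear (peval s).
Proof.
move=> k f g; rewrite /peval.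
set d := (msupp (k *: f + g) `|` (msupp f `|` msupp g))%fset.
have E h : (msupp h `<=` d)%fset ->
    \sum_(w <- msupp h) mcoeff w h *: weval s w =
    \sum_(w <- d) mcoeff w h *: weval s w.
  move=> hd; apply: big_fset_incl => // w _ hw.
  by rewrite mcoeff_outdom // scale0r.
rewrite (E (k *: f + g)) ?fsubsetUl //.
rewrite (E f) ?(E g); last 2 first.
- by rewrite fsubsetU // fsubsetUr orbT.
- by rewrite fsubsetU // fsubsetUl orbT.
rewrite scaler_sumr -big_split /=; apply: eq_bigr => w _.
by rewrite mcoeffD mcoeffZ scalerDl scalerA.
Qed.

Lemma star_id_lin (A : starAlg F) k f g :
  star_id A f -> star_id A g -> star_id A (k *: f + g).
Proof.
move=> [f0 fI] [g0 gI]; split.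
  by rewrite mcoeffD mcoeffZ f0 g0 mulr0 addr0.
by move=> s hs; rewrite peval_lin fI // gI // scaler0 addr0.
Qed.

Lemma star_id0 (A : starAlg F) : star_id A 0.
Proof.
split; first by rewrite mcoeff0.
by move=> s _; rewrite /peval big1 // => w _; rewrite mcoeff0 scale0r.
Qed.

Definition mlword n (p : mlmon n) : fmonom svar :=
  FMonom [seq (val (p.1 i), p.2 (p.1 i)) : svar | i <- enum 'I_n].

Lemma mlmonomialE n (p : mlmon n) :
  mlmonomial F p =
  mkmalgU (mlword p) 1.
Proof.
rewrite /mlmonomial /mlword (_ : enum 'I_n = index_enum _); last by rewrite enumT [index_enum _]unlock.
elim: (index_enum _) => [|i r IH] /=.
  rewrite big_nil; congr mkmalgU; apply/val_inj; exact: fm1.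
rewrite big_cons IH /fvar malgM_def fgmulUU mulr1; congr mkmalgU.
by apply/val_inj; rewrite /= fmM fmU.
Qed.

Lemma mlword_inj n : injective (@mlword n).
Proof.
move=> [s t] [s' t'] [] /= /eq_in_map E.
have E1 i : s i = s' i.
  by have [/val_inj] := E i (mem_enum _ _).
have Es : s = s' by apply/permP.
subst s'; congr pair; apply/ffunP => j.
by have [] := E ((s^-1)%g j) (mem_enum _ _); rewrite permKV.
Qed.

Lemma mlpoly_lin n : linear (@mlpoly F n).
Proof.
move=> k c d; rewrite /mlpoly scaler_sumr -big_split /=.
by apply: eq_bigr => p _; rewrite !ffunE scalerDl scalerA.
Qed.

Lemma mcoeff_mlpoly n (c : {ffun mlmon n -> F^o}) p :
  mcoeff (mlword p) (mlpoly c) = c p.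
Proof.
rewrite /mlpoly raddf_sum /= (bigD1 p) //= big1 ?addr0; last first.
  move=> q qp; rewrite mcoeffZ mlmonomialE mcoeffU.
  case: eqP => [/mlword_inj e|_]; last by rewrite mulr0.
  by rewrite e eqxx in qp.
by rewrite mcoeffZ mlmonomialE mcoeffU eqxx mulr1.
Qed.

Lemma mlpoly_inj n : injective (@mlpoly F n).
Proof.
by move=> c d E; apply/ffunP => p; rewrite -!mcoeff_mlpoly E.
Qed.

Lemma lin_pred_vspace (V : vectType F) (P : V -> Prop) :
  P 0 -> (forall k u v, P u -> P v -> P (k *: u + v)) ->
  exists U : {vspace V}, forall v, v \in U <-> P v.
Proof.
move=> P0 PL.
pose Q d := `[< exists U : {vspace V}, \dim U = d /\ forall v, v \in U -> P v >].
have exQ : exists d, Q d.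
  exists 0%N; apply/asboolP; exists 0%VS; split; first exact: dimv0.
  by move=> v; rewrite memv0 => /eqP ->.
have bQ d : Q d -> (d <= \dim {: V})%N.
  by move=> /asboolP [U [<- _]]; rewrite dimvS ?subvf.
case: (ex_maxnP exQ bQ) => d /asboolP [U [dU PU]] dmax.
exists U => v; split=> [/PU //|Pv].
have /dmax : Q (\dim (U + <[v]>)%VS).
  apply/asboolP; exists (U + <[v]>)%VS; split=> // w.
  case/memv_addP => u uU [_ /vlineP [k ->] ->].
  by rewrite addrC; apply: PL => //; apply: PU.
rewrite -dU => le; have /eqP -> : U == (U + <[v]>)%VS.
  by rewrite eqEdim addvSl.
by rewrite (subvP (addvSr _ _)) ?memv_line.
Qed.

Lemma ml_id_ex (A : starAlg F) n : exists U : {vspace {ffun mlmon n -> F^o}},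
  forall c, c \in U <-> star_id A (mlpoly c).
Proof.
apply: (@lin_pred_vspace {ffun mlmon n -> F^o} (star_id A \o @mlpoly F n)).
- rewrite /= (_ : mlpoly 0 = 0); first exact: star_id0.
  by rewrite /mlpoly big1 // => p _; rewrite ffunE scale0r.
- move=> k u v Pu Pv; have E := mlpoly_lin k u v.
  have G := star_id_lin k Pu Pv.
  rewrite -E in G.
  exact G.
Qed.

End FreeAlgebra.

(* Coordinates of $P_n^*\cap\mathrm{Id}^*(A)$. *)
Definition ml_id F (A : starAlg F) n : {vspace {ffun mlmon n -> F^o}} :=
  projT1 (cid (ml_id_ex A n)).

Lemma ml_idP F (A : starAlg F) n (c : {ffun mlmon n -> F^o}) :
  c \in ml_id A n <-> star_id A (mlpoly c).
Proof. exact: projT2 (cid (ml_id_ex A n)) c. Qed.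

Definition codim F (A : starAlg F) n : nat :=
  (\dim {: {ffun mlmon n -> F^o}} - \dim (ml_id A n))%N.

Definition asymptotic (R : realType) (c : nat -> nat) (alpha : R) (k : nat) : Prop :=
  (fun n => (c n)%:R / (alpha * n%:R ^+ k) : R) @ \oo --> (1 : R).

Definition poly_growth (R : realType) F (A : starAlg F) (k : nat) : Prop :=
  exists2 alpha : R, alpha != 0 & asymptotic (codim A) alpha k.

Definition quadratic_growth (R : realType) F (A : starAlg F) : Prop :=
  poly_growth R A 2.

Definition minimal_of_growth (R : realType) F (A : starAlg F) (k : nat) : Prop :=
  poly_growth R A k /\
  forall B : starAlg F, proper_subvariety (variety A) (variety B) ->
    (\forall n \near \oo, codim B n = 0%N) \/
    exists2 t, (t < k)%N & poly_growth R B t.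

Definition generates_minimal (R : realType) F (A : starAlg F) : Prop :=
  exists k, minimal_of_growth R A k.


(* [star_subalg U G st]: the subspace [U] of matrices is a subalgebra with
   grading [U = (U `&` G false) (+) (U `&` G true)] and superinvolution [st]. *)
Record star_subalg (F : fieldType) n (U : {vspace 'M[F]_n})
    (G : bool -> 'M[F]_n -> Prop) (st : 'M[F]_n -> 'M[F]_n) : Prop := {
  ssM : forall a b, a \in U -> b \in U -> a *m b \in U;
  ss0 : forall i, G i 0;
  ss_lin : forall i (k : F) a b, G i a -> G i b -> G i (k *: a + b);
  ss_sum : forall a, a \in U -> exists a0 a1,
    [/\ a0 \in U, a1 \in U, G false a0, G true a1 & a = a0 + a1];
  ss_direct : forall a, a \in U -> G false a -> G true a -> a = 0;
  ss_homM : forall i j a b, a \in U -> b \in U ->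
    G i a -> G j b -> G (i (+) j) (a *m b);
  ss_st_lin : linear st;
  ss_st_in : forall a, a \in U -> st a \in U;
  ss_st_hom : forall i a, a \in U -> G i a -> G i (st a);
  ss_stK : forall a, a \in U -> st (st a) = a;
  ss_stM : forall i j a b, a \in U -> b \in U -> G i a -> G j b ->
    st (a *m b) = (-1) ^+ (i && j) *: (st b *m st a)
}.

Section MatrixStarAlg.
Variables (F : fieldType) (n : nat) (U : {vspace 'M[F]_n}).
Variables (G : bool -> 'M[F]_n -> Prop) (st : 'M[F]_n -> 'M[F]_n).
Hypothesis H : star_subalg U G st.

Let T : lmodType F := subvs_of U.
Definition ss_mul (a b : T) : T := vsproj U (vsval a *m vsval b).
Definition ss_homog i (a : T) : Prop := G i (vsval a).
Definition ss_star (a : T) : T := vsproj U (st (vsval a)).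

Let inU (a : T) : vsval a \in U := subvsP a.

Lemma ss_mulE a b : vsval (ss_mul a b) = vsval a *m vsval b.
Proof. by rewrite vsprojK // (ssM H) ?inU. Qed.

Lemma ss_starE a : vsval (ss_star a) = st (vsval a).
Proof. by rewrite vsprojK // (ss_st_in H) ?inU. Qed.

Let ext (a b : T) : vsval a = vsval b -> a = b.
Proof. exact: val_inj. Qed.

Lemma ss_mulA : associative ss_mul.
Proof. by move=> a b c; apply: ext; rewrite !ss_mulE mulmxA. Qed.

Lemma ss_mul_linl b : linear (ss_mul^~ b).
Proof.
move=> k a c; apply: ext; rewrite linearP !ss_mulE linearP.
by rewrite mulmxDl -scalemxAl -!ss_mulE.
Qed.

Lemma ss_mul_linr a : linear (ss_mul a).
Proof.
move=> k b c; apply: ext; rewrite linearP !ss_mulE [vsval (k *: b + c)]linearP.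
by rewrite mulmxDr -scalemxAr -!ss_mulE.
Qed.

Lemma ss_homog0 i : ss_homog i 0.
Proof. exact: (ss0 H). Qed.

Lemma ss_homog_lin i (k : F) a b :
  ss_homog i a -> ss_homog i b -> ss_homog i (k *: a + b).
Proof. by move=> ha hb; rewrite /ss_homog [vsval (_ + _)]linearP; apply: (ss_lin H). Qed.

Lemma ss_homog_sum (a : T) : exists a0 a1 : T,
  [/\ ss_homog false a0, ss_homog true a1 & a = a0 + a1].
Proof.
have [a0 [a1 [u0 u1 g0 g1 e]]] := ss_sum H (inU a).
exists (Subvs u0), (Subvs u1); split=> //.
by apply: ext; rewrite [vsval (_ + _)]linearD.
Qed.

Lemma ss_homog_direct a : ss_homog false a -> ss_homog true a -> a = 0.
Proof.
by move=> h0 h1; apply: ext; rewrite [vsval 0]linear0; apply: (ss_direct H) => //; apply: inU.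
Qed.

Lemma ss_homogM i j a b :
  ss_homog i a -> ss_homog j b -> ss_homog (i (+) j) (ss_mul a b).
Proof.
by move=> ha hb; rewrite /ss_homog /= ss_mulE; apply: (ss_homM H) => //; apply: inU.
Qed.

Lemma ss_star_lin : linear ss_star.
Proof.
move=> k a b; apply: ext.
by rewrite linearP !ss_starE [vsval (k *: a + b)]linearP (ss_st_lin H) -!ss_starE.
Qed.

Lemma ss_star_homog i a : ss_homog i a -> ss_homog i (ss_star a).
Proof.
by move=> ha; rewrite /ss_homog /= ss_starE; apply: (ss_st_hom H) => //; apply: inU.
Qed.

Lemma ss_starK : involutive ss_star.
Proof. by move=> a; apply: ext; rewrite !ss_starE (ss_stK H) ?inU. Qed.

Lemma ss_starM i j a b : ss_homog i a -> ss_homog j b ->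
  ss_star (ss_mul a b) = (-1) ^+ (i && j) *: ss_mul (ss_star b) (ss_star a).
Proof.
move=> ha hb; apply: ext; rewrite ss_starE ss_mulE.
by rewrite (ss_stM H (inU a) (inU b) ha hb) -!ss_starE -ss_mulE -linearZ.
Qed.

Definition mxStarAlg : starAlg F :=
  StarAlg ss_mulA ss_mul_linl ss_mul_linr ss_homog0 ss_homog_lin ss_homog_sum
    ss_homog_direct ss_homogM ss_star_lin ss_star_homog ss_starK ss_starM.

End MatrixStarAlg.

Section Gradings.
Variables (F : fieldType) (n : nat).
Implicit Types (U V : {vspace 'M[F]_n}).

Definition split_grading V0 V1 (i : bool) (M : 'M[F]_n) : Prop :=
  M \in if i then V1 else V0.

Definition trivial_grading U := split_grading U 0%VS.

(* [e_{ij}] has degree [g i (+) g j]. *)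
Definition elementary_grading (g : seq bool) (i : bool) (M : 'M[F]_n) : Prop :=
  forall k l : 'I_n, M k l != 0 -> nth false g k (+) nth false g l = i.

Lemma trivial_star_subalg U (st : 'M[F]_n -> 'M[F]_n) :
  (forall a b, a \in U -> b \in U -> a *m b \in U) ->
  linear st ->
  (forall a, a \in U -> st a \in U) ->
  (forall a, a \in U -> st (st a) = a) ->
  (forall a b, a \in U -> b \in U -> st (a *m b) = st b *m st a) ->
  star_subalg U (trivial_grading U) st.
Proof.
move=> hM hl hin hK hst.
have st0 : st 0 = 0.
  have /= := hl 1 0 0; rewrite !scale1r addr0 => e.
  by apply: (addIr (st 0)); rewrite -e add0r.
split=> //.
- by move=> i; rewrite /trivial_grading /split_grading mem0v.
- move=> i k a b; rewrite /trivial_grading /split_grading => ha hb.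
  by rewrite memvD // memvZ.
- move=> a ha; exists a, 0; rewrite addr0 mem0v; split=> //.
  by rewrite /trivial_grading /split_grading mem0v.
- by move=> a _ _; rewrite /trivial_grading /split_grading memv0 => /eqP.
- move=> [] [] a b _ _; rewrite /trivial_grading /split_grading /= ?memv0.
  + by move=> /eqP -> /eqP ->; rewrite mul0mx mem0v.
  + by move=> /eqP -> _; rewrite mul0mx.
  + by move=> _ /eqP ->; rewrite mulmx0.
  + exact: hM.
- move=> [] a aU; rewrite /trivial_grading /split_grading /= ?memv0.
  + by move=> /eqP ->; rewrite st0.
  + by move=> _; apply: hin.
- move=> i j a b aU bU; rewrite /trivial_grading /split_grading.
  case: i; case: j; rewrite /= ?expr0 ?expr1 ?scale1r ?memv0; move=> h1 h2; try exact: hst.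
  by rewrite (eqP h1) st0 mul0mx mulmx0 st0 scaler0.
Qed.

End Gradings.

(* The matrix unit $e_{ij}$, with indices starting from 1. *)
Definition eu (F : fieldType) n (i j : nat) : 'M[F]_n :=
  \matrix_(k, l) ((k.+1 == i) && (l.+1 == j))%:R.

Local Ltac mx3 := apply/matrixP => -[[|[|[|//]]] ?] [[|[|[|//]]] ?].
Local Ltac mx4 := apply/matrixP => -[[|[|[|[|//]]]] ?] [[|[|[|[|//]]]] ?].
Local Ltac mx6 := apply/matrixP => -[[|[|[|[|[|[|//]]]]]] ?] [[|[|[|[|[|[|//]]]]]] ?].

Section C3.
Variable F : fieldType.
Local Notation e := (@eu F 3).
Local Notation one3 := (e 1 1 + e 2 2 + e 3 3).
Local Notation "'x3'" := (e 1 2 + e 2 3).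

Definition C3mx (a b c : F) : 'M[F]_3 := a *: one3 + b *: x3 + c *: e 1 3.

Definition C3 : {vspace 'M[F]_3} := <<[:: one3; x3; e 1 3]>>%VS.

(* $(a,b,c)\mapsto(a,(-1)^sb,(-1)^tc)$; $i_1$, $i_2$, $i_3$ are the values
   [(false, true)], [(true, false)], [(true, true)] of [(s, t)]. *)
Definition C3_invol (s t : bool) (M : 'M[F]_3) : 'M[F]_3 :=
  C3mx (M 0 0) ((-1) ^+ s * M 0 1) ((-1) ^+ t * M 0 2).

Definition C3_gr := split_grading <<[:: one3; e 1 3]>>%VS <[x3]>%VS.

Lemma C3mxE a b c : C3mx a b c = \matrix_(i < 3, j < 3)
  nth 0 (nth [::] [:: [:: a; b; c]; [:: 0; a; b]; [:: 0; 0; a]] i) j.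
Proof. by mx3; rewrite /C3mx /eu !mxE /=; ring. Qed.

Lemma C3mxM a b c a' b' c' : C3mx a b c *m C3mx a' b' c' =
  C3mx (a * a') (a * b' + b * a') (a * c' + b * b' + c * a').
Proof.
by rewrite !C3mxE; mx3; rewrite !mxE !big_ord_recl big_ord0 !mxE /=; ring.
Qed.

Lemma C3P M : M \in C3 <-> exists a b c, M = C3mx a b c.
Proof.
rewrite /C3 !span_cons span_nil addv0; split.
  case/memv_addP => _ /vlineP [a ->] [_ /memv_addP [_ /vlineP [b ->]
    [_ /vlineP [c ->] ->]] ->].
  by exists a, b, c; rewrite /C3mx addrA.
move=> [a [b [c ->]]]; rewrite /C3mx -addrA.
by rewrite !memv_add // memvZ ?memv_line.
Qed.

Lemma C3_gr0P M : C3_gr false M <-> exists a c, M = C3mx a 0 c.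
Proof.
rewrite /C3_gr /split_grading !span_cons span_nil addv0; split.
  case/memv_addP => _ /vlineP [a ->] [_ /vlineP [c ->] ->].
  by exists a, c; rewrite /C3mx scale0r addr0.
move=> [a [c ->]]; rewrite /C3mx scale0r addr0.
by rewrite !memv_add // memvZ ?memv_line.
Qed.

Lemma C3_gr1P M : C3_gr true M <-> exists b, M = C3mx 0 b 0.
Proof.
rewrite /C3_gr /split_grading; split.
  by move=> /vlineP [b ->]; exists b; rewrite /C3mx !scale0r addr0 add0r.
by move=> [b ->]; rewrite /C3mx !scale0r addr0 add0r memvZ ?memv_line.
Qed.

Lemma C3_involE s t a b c :
  C3_invol s t (C3mx a b c) = C3mx a ((-1) ^+ s * b) ((-1) ^+ t * c).
Proof. by rewrite {1}C3mxE /C3_invol !mxE. Qed.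

Lemma C3_invol_lin s t : linear (C3_invol s t).
Proof. by move=> k M N; rewrite /C3_invol !C3mxE; mx3; rewrite !mxE /=; ring. Qed.

Lemma C3_inj a b c a' b' c' :
  C3mx a b c = C3mx a' b' c' -> [/\ a = a', b = b' & c = c'].
Proof.
rewrite !C3mxE => /matrixP E.
by split; [have := E 0 0|have := E 0 1|have := E 0 2]; rewrite !mxE.
Qed.

Lemma C3_trivial_subalg s : star_subalg C3 (trivial_grading C3) (C3_invol s false).
Proof.
apply: trivial_star_subalg.
- move=> _ _ /C3P [a [b [c ->]]] /C3P [a' [b' [c' ->]]].
  by rewrite C3mxM; apply/C3P; do 3!eexists.
- exact: C3_invol_lin.
- by move=> _ /C3P [a [b [c ->]]]; rewrite C3_involE; apply/C3P; do 3!eexists.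
- move=> _ /C3P [a [b [c ->]]]; rewrite !C3_involE.
  by congr C3mx; case: s; rewrite /= ?expr0 ?expr1; ring.
- move=> _ _ /C3P [a [b [c ->]]] /C3P [a' [b' [c' ->]]].
  rewrite C3mxM !C3_involE C3mxM.
  by congr C3mx; case: s; rewrite /= ?expr0 ?expr1; ring.
Qed.

Lemma C3_gr_subalg s : star_subalg C3 C3_gr (C3_invol s true).
Proof.
split.
- move=> _ _ /C3P [a [b [c ->]]] /C3P [a' [b' [c' ->]]].
  by rewrite C3mxM; apply/C3P; do 3!eexists.
- by move=> i; rewrite /C3_gr /split_grading mem0v.
- by move=> i k a b; rewrite /C3_gr /split_grading => ha hb; rewrite memvD // memvZ.
- move=> _ /C3P [a [b [c ->]]]; exists (C3mx a 0 c), (C3mx 0 b 0); split.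
  + by apply/C3P; do 3!eexists.
  + by apply/C3P; do 3!eexists.
  + by apply/C3_gr0P; do 2!eexists.
  + by apply/C3_gr1P; eexists.
  + by rewrite !C3mxE; mx3; rewrite !mxE /=; ring.
- move=> M _ /C3_gr0P [a [c ->]] /C3_gr1P [b /C3_inj [-> _ ->]].
  by rewrite /C3mx !scale0r !addr0.
- move=> [] [] M N _ _.
  + move=> /C3_gr1P [b ->] /C3_gr1P [b' ->]; rewrite C3mxM.
    by apply/C3_gr0P; do 2!eexists; congr C3mx; ring.
  + move=> /C3_gr1P [b ->] /C3_gr0P [a' [c' ->]]; rewrite C3mxM.
    by apply/C3_gr1P; eexists; congr C3mx; ring.
  + move=> /C3_gr0P [a [c ->]] /C3_gr1P [b' ->]; rewrite C3mxM.
    by apply/C3_gr1P; eexists; congr C3mx; ring.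
  + move=> /C3_gr0P [a [c ->]] /C3_gr0P [a' [c' ->]]; rewrite C3mxM.
    by apply/C3_gr0P; do 2!eexists; congr C3mx; ring.
- exact: C3_invol_lin.
- by move=> _ /C3P [a [b [c ->]]]; rewrite C3_involE; apply/C3P; do 3!eexists.
- move=> [] M _.
  + move=> /C3_gr1P [b ->]; rewrite C3_involE mulr0; apply/C3_gr1P.
    by eexists.
  + move=> /C3_gr0P [a [c ->]]; rewrite C3_involE mulr0; apply/C3_gr0P.
    by do 2!eexists.
- move=> _ /C3P [a [b [c ->]]]; rewrite !C3_involE.
  by congr C3mx; case: s; rewrite /= ?expr0 ?expr1; ring.
- have Z k a b c : k *: C3mx a b c = C3mx (k * a) (k * b) (k * c).
    by rewrite /C3mx !scalerDr !scalerA.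
  move=> [] [] M N _ _.
  + move=> /C3_gr1P [b ->] /C3_gr1P [b' ->].
    rewrite C3mxM !C3_involE C3mxM Z.
    by congr C3mx; case: s; rewrite /= ?expr0 ?expr1; ring.
  + move=> /C3_gr1P [b ->] /C3_gr0P [a' [c' ->]].
    rewrite C3mxM !C3_involE C3mxM Z.
    by congr C3mx; case: s; rewrite /= ?expr0 ?expr1; ring.
  + move=> /C3_gr0P [a [c ->]] /C3_gr1P [b' ->].
    rewrite C3mxM !C3_involE C3mxM Z.
    by congr C3mx; case: s; rewrite /= ?expr0 ?expr1; ring.
  + move=> /C3_gr0P [a [c ->]] /C3_gr0P [a' [c' ->]].
    rewrite C3mxM !C3_involE C3mxM Z.
    by congr C3mx; case: s; rewrite /= ?expr0 ?expr1; ring.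
Qed.

Definition C3_i1_gr : starAlg F := mxStarAlg (C3_gr_subalg false).
Definition C3_i2 : starAlg F := mxStarAlg (C3_trivial_subalg true).
Definition C3_i3_gr : starAlg F := mxStarAlg (C3_gr_subalg true).

End C3.

Section NU3.
Variable F : fieldType.
Local Notation e := (@eu F 6).
Local Notation one6 := (1%:M : 'M[F]_6).
Local Notation E := (e 2 3 + e 4 5).

(* $e_{ij}\mapsto e_{7-j,7-i}$ *)
Definition reflection n (M : 'M[F]_n) : 'M[F]_n :=
  \matrix_(i, j) M (rev_ord j) (rev_ord i).

(* The common form of $N_3$ ([s = true]) and $U_3$ ([s = false]). *)
Definition NU3 (s : bool) : {vspace 'M[F]_6} :=
  <<[:: one6; E; (e 1 2 + (-1) ^+ s *: e 5 6)%R; e 1 3; e 4 6]>>%VS.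

Definition N3 := NU3 true.
Definition U3 := NU3 false.

Definition gri_degrees : seq bool := [:: false; true; true; false; false; true].

Definition NU3mx (s : bool) (a b c d f : F) : 'M[F]_6 :=
  a *: one6 + (b *: E + (c *: (e 1 2 + (-1) ^+ s *: e 5 6) + (d *: e 1 3 + f *: e 4 6))).

Lemma NU3mxE s a b c d f : NU3mx s a b c d f = \matrix_(i < 6, j < 6)
  nth 0 (nth [::] [:: [:: a; c; d; 0; 0; 0]; [:: 0; a; b; 0; 0; 0];
    [:: 0; 0; a; 0; 0; 0]; [:: 0; 0; 0; a; b; f];
    [:: 0; 0; 0; 0; a; (-1) ^+ s * c]; [:: 0; 0; 0; 0; 0; a]] i) j.
Proof. by mx6; rewrite /NU3mx /eu !mxE /=; ring. Qed.

Lemma NU3mxM s a b c d f a' b' c' d' f' :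
  NU3mx s a b c d f *m NU3mx s a' b' c' d' f' =
  NU3mx s (a * a') (a * b' + b * a') (a * c' + c * a')
    (a * d' + c * b' + d * a') (a * f' + (-1) ^+ s * (b * c') + f * a').
Proof.
rewrite !NU3mxE; apply/matrixP => i j; rewrite !mxE.
under eq_bigr => k _ do rewrite !mxE.
rewrite !big_ord_recl big_ord0.
case: i j => [[|[|[|[|[|[|//]]]]]] ?] [[|[|[|[|[|[|//]]]]]] ?] /=.
all: rewrite ?(mul0r, mulr0, add0r, addr0) //; ring.
Qed.

Lemma NU3P s M : M \in NU3 s <-> exists a b c d f, M = NU3mx s a b c d f.
Proof.
rewrite /NU3 !span_cons span_nil addv0; split.
  case/memv_addP => _ /vlineP [a ->] [_ /memv_addP [_ /vlineP [b ->]
    [_ /memv_addP [_ /vlineP [c ->] [_ /memv_addP [_ /vlineP [d ->]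
    [_ /vlineP [f ->] ->]] ->]] ->]] ->].
  by exists a, b, c, d, f.
move=> [a [b [c [d [f ->]]]]]; rewrite /NU3mx.
by rewrite !memv_add // memvZ ?memv_line.
Qed.

Lemma NU3_reflectionE s a b c d f :
  reflection (NU3mx s a b c d f) = NU3mx s a b ((-1) ^+ s * c) f d.
Proof.
rewrite !NU3mxE; mx6; rewrite !mxE //=.
by case: s; rewrite ?expr0 ?expr1; ring.
Qed.

Lemma reflection_lin n : linear (@reflection n).
Proof. by move=> k M N; apply/matrixP => i j; rewrite !mxE. Qed.

Lemma reflectionK n : involutive (@reflection n).
Proof. by move=> M; apply/matrixP => i j; rewrite !mxE !rev_ordK. Qed.

Lemma reflectionM n (M N : 'M[F]_n) :
  reflection (M *m N) = reflection N *m reflection M.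
Proof.
apply/matrixP => i j; rewrite !mxE (reindex_inj rev_ord_inj) /=.
by apply: eq_bigr => k _; rewrite !mxE mulrC.
Qed.

Lemma NU3M s M N : M \in NU3 s -> N \in NU3 s -> M *m N \in NU3 s.
Proof.
move=> /NU3P [a [b [c [d [f ->]]]]] /NU3P [a' [b' [c' [d' [f' ->]]]]].
by rewrite NU3mxM; apply/NU3P; do 5!eexists.
Qed.

Lemma NU3_reflection s M : M \in NU3 s -> reflection M \in NU3 s.
Proof.
move=> /NU3P [a [b [c [d [f ->]]]]].
by rewrite NU3_reflectionE; apply/NU3P; do 5!eexists.
Qed.

Lemma NU3_trivial_subalg s :
  star_subalg (NU3 s) (trivial_grading (NU3 s)) (@reflection 6).
Proof.
apply: trivial_star_subalg.
- exact: NU3M.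
- exact: reflection_lin.
- exact: NU3_reflection.
- by move=> M _; rewrite reflectionK.
- by move=> M N _ _; rewrite reflectionM.
Qed.

Lemma NU3_gri0P s M : M \in NU3 s -> elementary_grading gri_degrees false M ->
  exists a b, M = NU3mx s a b 0 0 0.
Proof.
move=> /NU3P [a [b [c [d [f ->]]]]] G; exists a, b.
have c0 : c = 0.
  by apply: contrapT => /eqP nz; have := G 0 1; rewrite NU3mxE !mxE /= => /(_ nz).
have d0 : d = 0.
  by apply: contrapT => /eqP nz; have := G 0 2; rewrite NU3mxE !mxE /= => /(_ nz).
have f0 : f = 0.
  by apply: contrapT => /eqP nz; have := G 3 5; rewrite NU3mxE !mxE /= => /(_ nz).
by rewrite c0 d0 f0.
Qed.

Lemma NU3_gri1P s M : M \in NU3 s -> elementary_grading gri_degrees true M ->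
  exists c d f, M = NU3mx s 0 0 c d f.
Proof.
move=> /NU3P [a [b [c [d [f ->]]]]] G; exists c, d, f.
have a0 : a = 0.
  by apply: contrapT => /eqP nz; have := G 0 0; rewrite NU3mxE !mxE /= => /(_ nz).
have b0 : b = 0.
  by apply: contrapT => /eqP nz; have := G 1 2; rewrite NU3mxE !mxE /= => /(_ nz).
by rewrite a0 b0.
Qed.

Lemma NU3_gri0 s a b : elementary_grading gri_degrees false (NU3mx s a b 0 0 0).
Proof.
rewrite NU3mxE => -[[|[|[|[|[|[|//]]]]]] ?] [[|[|[|[|[|[|//]]]]]] ?];
by rewrite !mxE /= ?mulr0 ?eqxx.
Qed.

Lemma NU3_gri1 s c d f : elementary_grading gri_degrees true (NU3mx s 0 0 c d f).
Proof.
rewrite NU3mxE => -[[|[|[|[|[|[|//]]]]]] ?] [[|[|[|[|[|[|//]]]]]] ?];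
by rewrite !mxE /= ?mulr0 ?eqxx.
Qed.

Lemma NU3_gri_subalg s :
  star_subalg (NU3 s) (elementary_grading gri_degrees) (@reflection 6).
Proof.
have Z k a b c d f : k *: NU3mx s a b c d f =
    NU3mx s (k * a) (k * b) (k * c) (k * d) (k * f).
  by rewrite !NU3mxE; mx6; rewrite !mxE /=; ring.
split.
- exact: NU3M.
- by move=> i k l; rewrite mxE eqxx.
- move=> i k a b ha hb u v; rewrite !mxE.
  have [a0|/ha //] := eqVneq (a u v) 0.
  have [b0|/hb //] := eqVneq (b u v) 0.
  by rewrite a0 b0 mulr0 addr0 eqxx.
- move=> _ /NU3P [a [b [c [d [f ->]]]]].
  exists (NU3mx s a b 0 0 0), (NU3mx s 0 0 c d f); split.
  + by apply/NU3P; do 5!eexists.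
  + by apply/NU3P; do 5!eexists.
  + exact: NU3_gri0.
  + exact: NU3_gri1.
  + by rewrite !NU3mxE; mx6; rewrite !mxE /=; ring.
- move=> M _ h0 h1; apply/matrixP => i j; rewrite mxE.
  have [//|nz] := eqVneq (M i j) 0.
  by have := h0 _ _ nz; rewrite (h1 _ _ nz).
- move=> i j M N _ _ hM hN k l; rewrite mxE => nz.
  have [m] : exists m, M k m * N m l != 0.
    apply: contrapT => h; case/eqP: nz; rewrite big1 // => m _.
    by apply: contrapT => /eqP nz; apply: h; exists m.
  rewrite mulf_eq0 negb_or => /andP [/hM <- /hN <-].
  by do 3!case: (nth _ _ _).
- exact: reflection_lin.
- exact: NU3_reflection.
- move=> [] M hM G.
  + have [c [d [f ->]]] := NU3_gri1P hM G.
    by rewrite NU3_reflectionE; apply: NU3_gri1.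
  + have [a [b ->]] := NU3_gri0P hM G.
    by rewrite NU3_reflectionE mulr0; apply: NU3_gri0.
- by move=> M _; rewrite reflectionK.
- move=> i j M N hM hN gM gN; rewrite reflectionM.
  case: (boolP (i && j)) => [/andP [hi hj]|_]; last by rewrite expr0 scale1r.
  rewrite hi in gM; rewrite hj in gN.
  have [c [d [f ->]]] := NU3_gri1P hM gM.
  have [c' [d' [f' ->]]] := NU3_gri1P hN gN.
  rewrite !NU3_reflectionE NU3mxM Z.
  by congr NU3mx; ring.
Qed.

Definition N3_star : starAlg F := mxStarAlg (NU3_trivial_subalg true).
Definition U3_star : starAlg F := mxStarAlg (NU3_trivial_subalg false).
Definition N3_star_gri : starAlg F := mxStarAlg (NU3_gri_subalg true).
Definition U3_star_gri : starAlg F := mxStarAlg (NU3_gri_subalg false).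

End NU3.

Section W.
Variable F : fieldType.
Local Notation e := (@eu F 4).
Local Notation one4 := (e 1 1 + e 2 2 + e 3 3 + e 4 4).
Local Notation "'xb'" := (e 1 2 + e 3 4).
Local Notation "'xc'" := (e 1 3 + e 2 4).

Definition Wmx (a b c d : F) : 'M[F]_4 :=
  a *: one4 + b *: xb + c *: xc + d *: e 1 4.

Definition W : {vspace 'M[F]_4} :=
  <<[:: one4; xb; xc; e 1 4]>>%VS.

(* $(a,b,c,d)\mapsto(a,(-1)^rb,(-1)^sc,(-1)^td)$; $\eta_1$, $\eta_2$, $\eta_3$
   are the values [(true, false, true)], [(true, false, false)],
   [(true, true, false)] of [(r, s, t)]. *)
Definition W_invol (r s t : bool) (M : 'M[F]_4) : 'M[F]_4 :=
  Wmx (M 0 0) ((-1) ^+ r * M 0 1) ((-1) ^+ s * M 0 2) ((-1) ^+ t * M 0 3).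

Definition W_gr :=
  split_grading <<[:: one4; e 1 4]>>%VS <<[:: xb; xc]>>%VS.

Definition W_gri :=
  split_grading <<[:: one4; xb]>>%VS <<[:: xc; e 1 4]>>%VS.

Lemma WmxE a b c d : Wmx a b c d = \matrix_(i < 4, j < 4)
  nth 0 (nth [::] [:: [:: a; b; c; d]; [:: 0; a; 0; c]; [:: 0; 0; a; b];
    [:: 0; 0; 0; a]] i) j.
Proof. by mx4; rewrite /Wmx /eu !mxE /=; ring. Qed.

Lemma WmxM a b c d a' b' c' d' : Wmx a b c d *m Wmx a' b' c' d' =
  Wmx (a * a') (a * b' + b * a') (a * c' + c * a')
    (a * d' + b * c' + c * b' + d * a').
Proof.
by rewrite !WmxE; mx4; rewrite !mxE !big_ord_recl big_ord0 !mxE /=; ring.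
Qed.

Lemma WmxZ k a b c d : k *: Wmx a b c d = Wmx (k * a) (k * b) (k * c) (k * d).
Proof. by rewrite /Wmx !scalerDr !scalerA. Qed.

Lemma WP M : M \in W <-> exists a b c d, M = Wmx a b c d.
Proof.
rewrite /W !span_cons span_nil addv0; split.
  case/memv_addP => _ /vlineP [a ->] [_ /memv_addP [_ /vlineP [b ->]
    [_ /memv_addP [_ /vlineP [c ->] [_ /vlineP [d ->] ->]] ->]] ->].
  by exists a, b, c, d; rewrite /Wmx !addrA.
move=> [a [b [c [d ->]]]]; rewrite /Wmx -!addrA.
by rewrite !memv_add // memvZ ?memv_line.
Qed.

Lemma W_gr0P M : W_gr false M <-> exists a d, M = Wmx a 0 0 d.
Proof.
rewrite /W_gr /split_grading !span_cons span_nil addv0; split.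
  case/memv_addP => _ /vlineP [a ->] [_ /vlineP [d ->] ->].
  by exists a, d; rewrite /Wmx !scale0r !addr0.
move=> [a [d ->]]; rewrite /Wmx !scale0r !addr0.
by rewrite !memv_add // memvZ ?memv_line.
Qed.

Lemma W_gr1P M : W_gr true M <-> exists b c, M = Wmx 0 b c 0.
Proof.
rewrite /W_gr /split_grading !span_cons span_nil addv0; split.
  case/memv_addP => _ /vlineP [b ->] [_ /vlineP [c ->] ->].
  by exists b, c; rewrite /Wmx !scale0r addr0 add0r.
move=> [b [c ->]]; rewrite /Wmx !scale0r addr0 add0r.
by rewrite !memv_add // memvZ ?memv_line.
Qed.

Lemma W_gri0P M : W_gri false M <-> exists a b, M = Wmx a b 0 0.
Proof.
rewrite /W_gri /split_grading !span_cons span_nil addv0; split.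
  case/memv_addP => _ /vlineP [a ->] [_ /vlineP [b ->] ->].
  by exists a, b; rewrite /Wmx !scale0r !addr0.
move=> [a [b ->]]; rewrite /Wmx !scale0r !addr0.
by rewrite !memv_add // memvZ ?memv_line.
Qed.

Lemma W_gri1P M : W_gri true M <-> exists c d, M = Wmx 0 0 c d.
Proof.
rewrite /W_gri /split_grading !span_cons span_nil addv0; split.
  case/memv_addP => _ /vlineP [c ->] [_ /vlineP [d ->] ->].
  by exists c, d; rewrite /Wmx !scale0r !add0r.
move=> [c [d ->]]; rewrite /Wmx !scale0r !add0r.
by rewrite !memv_add // memvZ ?memv_line.
Qed.

Lemma W_involE r s t a b c d : W_invol r s t (Wmx a b c d) =
  Wmx a ((-1) ^+ r * b) ((-1) ^+ s * c) ((-1) ^+ t * d).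
Proof. by rewrite {1}WmxE /W_invol !mxE. Qed.

Lemma W_invol_lin r s t : linear (W_invol r s t).
Proof. by move=> k M N; rewrite /W_invol !WmxE; mx4; rewrite !mxE /=; ring. Qed.

Lemma W_inj a b c d a' b' c' d' :
  Wmx a b c d = Wmx a' b' c' d' -> [/\ a = a', b = b', c = c' & d = d'].
Proof.
rewrite !WmxE => /matrixP E.
split; [have := E 0 0|have := E 0 1|have := E 0 2|have := E 0 3];
  by rewrite !mxE.
Qed.

Lemma WM M N : M \in W -> N \in W -> M *m N \in W.
Proof.
move=> /WP [a [b [c [d ->]]]] /WP [a' [b' [c' [d' ->]]]].
by rewrite WmxM; apply/WP; do 4!eexists.
Qed.

Lemma W_invol_in r s t M : M \in W -> W_invol r s t M \in W.
Proof.
by move=> /WP [a [b [c [d ->]]]]; rewrite W_involE; apply/WP; do 4!eexists.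
Qed.

Lemma W_involK r s t M : M \in W -> W_invol r s t (W_invol r s t M) = M.
Proof.
by move=> /WP [a [b [c [d ->]]]]; rewrite !W_involE !mulrA -!signr_addb !addbb !mul1r.
Qed.

Lemma W_gr_subalg r s : star_subalg W W_gr (W_invol r s (~~ (r (+) s))).
Proof.
split.
- exact: WM.
- by move=> i; rewrite /W_gr /split_grading mem0v.
- by move=> i k a b; rewrite /W_gr /split_grading => ha hb; rewrite memvD // memvZ.
- move=> _ /WP [a [b [c [d ->]]]]; exists (Wmx a 0 0 d), (Wmx 0 b c 0); split.
  + by apply/WP; do 4!eexists.
  + by apply/WP; do 4!eexists.
  + by apply/W_gr0P; do 2!eexists.
  + by apply/W_gr1P; do 2!eexists.
  + by rewrite !WmxE; mx4; rewrite !mxE /=; ring.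
- move=> M _ /W_gr0P [a [d ->]] /W_gr1P [b [c /W_inj [-> _ _ ->]]].
  by rewrite /Wmx !scale0r !addr0.
- move=> [] [] M N _ _.
  + move=> /W_gr1P [b [c ->]] /W_gr1P [b' [c' ->]]; rewrite WmxM.
    by apply/W_gr0P; do 2!eexists; congr Wmx; ring.
  + move=> /W_gr1P [b [c ->]] /W_gr0P [a' [d' ->]]; rewrite WmxM.
    by apply/W_gr1P; do 2!eexists; congr Wmx; ring.
  + move=> /W_gr0P [a [d ->]] /W_gr1P [b' [c' ->]]; rewrite WmxM.
    by apply/W_gr1P; do 2!eexists; congr Wmx; ring.
  + move=> /W_gr0P [a [d ->]] /W_gr0P [a' [d' ->]]; rewrite WmxM.
    by apply/W_gr0P; do 2!eexists; congr Wmx; ring.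
- exact: W_invol_lin.
- exact: W_invol_in.
- move=> [] M _.
  + move=> /W_gr1P [b [c ->]]; rewrite W_involE mulr0; apply/W_gr1P.
    by do 2!eexists.
  + move=> /W_gr0P [a [d ->]]; rewrite W_involE !mulr0; apply/W_gr0P.
    by do 2!eexists.
- exact: W_involK.
- move=> [] [] M N _ _.
  + move=> /W_gr1P [b [c ->]] /W_gr1P [b' [c' ->]].
    rewrite WmxM !W_involE WmxM WmxZ.
    by congr Wmx; case: r; case: s; rewrite /= ?expr0 ?expr1; ring.
  + move=> /W_gr1P [b [c ->]] /W_gr0P [a' [d' ->]].
    rewrite WmxM !W_involE WmxM WmxZ.
    by congr Wmx; case: r; case: s; rewrite /= ?expr0 ?expr1; ring.
  + move=> /W_gr0P [a [d ->]] /W_gr1P [b' [c' ->]].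
    rewrite WmxM !W_involE WmxM WmxZ.
    by congr Wmx; case: r; case: s; rewrite /= ?expr0 ?expr1; ring.
  + move=> /W_gr0P [a [d ->]] /W_gr0P [a' [d' ->]].
    rewrite WmxM !W_involE WmxM WmxZ.
    by congr Wmx; case: r; case: s; rewrite /= ?expr0 ?expr1; ring.
Qed.

Lemma W_gri_subalg r s : star_subalg W W_gri (W_invol r s (r (+) s)).
Proof.
split.
- exact: WM.
- by move=> i; rewrite /W_gri /split_grading mem0v.
- by move=> i k a b; rewrite /W_gri /split_grading => ha hb; rewrite memvD // memvZ.
- move=> _ /WP [a [b [c [d ->]]]]; exists (Wmx a b 0 0), (Wmx 0 0 c d); split.
  + by apply/WP; do 4!eexists.
  + by apply/WP; do 4!eexists.
  + by apply/W_gri0P; do 2!eexists.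
  + by apply/W_gri1P; do 2!eexists.
  + by rewrite !WmxE; mx4; rewrite !mxE /=; ring.
- move=> M _ /W_gri0P [a [b ->]] /W_gri1P [c [d /W_inj [-> -> _ _]]].
  by rewrite /Wmx !scale0r !addr0.
- move=> [] [] M N _ _.
  + move=> /W_gri1P [c [d ->]] /W_gri1P [c' [d' ->]]; rewrite WmxM.
    by apply/W_gri0P; do 2!eexists; congr Wmx; ring.
  + move=> /W_gri1P [c [d ->]] /W_gri0P [a' [b' ->]]; rewrite WmxM.
    by apply/W_gri1P; do 2!eexists; congr Wmx; ring.
  + move=> /W_gri0P [a [b ->]] /W_gri1P [c' [d' ->]]; rewrite WmxM.
    by apply/W_gri1P; do 2!eexists; congr Wmx; ring.
  + move=> /W_gri0P [a [b ->]] /W_gri0P [a' [b' ->]]; rewrite WmxM.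
    by apply/W_gri0P; do 2!eexists; congr Wmx; ring.
- exact: W_invol_lin.
- exact: W_invol_in.
- move=> [] M _.
  + move=> /W_gri1P [c [d ->]]; rewrite W_involE mulr0; apply/W_gri1P.
    by do 2!eexists.
  + move=> /W_gri0P [a [b ->]]; rewrite W_involE !mulr0; apply/W_gri0P.
    by do 2!eexists.
- exact: W_involK.
- move=> [] [] M N _ _.
  + move=> /W_gri1P [c [d ->]] /W_gri1P [c' [d' ->]].
    rewrite WmxM !W_involE WmxM WmxZ.
    by congr Wmx; case: r; case: s; rewrite /= ?expr0 ?expr1; ring.
  + move=> /W_gri1P [c [d ->]] /W_gri0P [a' [b' ->]].
    rewrite WmxM !W_involE WmxM WmxZ.
    by congr Wmx; case: r; case: s; rewrite /= ?expr0 ?expr1; ring.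
  + move=> /W_gri0P [a [b ->]] /W_gri1P [c' [d' ->]].
    rewrite WmxM !W_involE WmxM WmxZ.
    by congr Wmx; case: r; case: s; rewrite /= ?expr0 ?expr1; ring.
  + move=> /W_gri0P [a [b ->]] /W_gri0P [a' [b' ->]].
    rewrite WmxM !W_involE WmxM WmxZ.
    by congr Wmx; case: r; case: s; rewrite /= ?expr0 ?expr1; ring.
Qed.

Definition W_eta1_gri : starAlg F := mxStarAlg (W_gri_subalg true false).
Definition W_eta2_gr : starAlg F := mxStarAlg (W_gr_subalg true false).
Definition W_eta3_gri : starAlg F := mxStarAlg (W_gri_subalg true true).

End W.

Section G2.
Variable F : fieldType.
Local Notation V := ('rV[F]_4).

(* The coordinates of an element of $\mathcal G_2$ are relative to the basis
   $1,e_1,e_2,e_1e_2$. *)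
Definition G2vec (a b c d : F) : V := \row_(k < 4) nth 0 [:: a; b; c; d] k.

Definition G2_mul (x y : V) : V :=
  G2vec (x 0 0 * y 0 0)
    (x 0 0 * y 0 1 + x 0 1 * y 0 0)
    (x 0 0 * y 0 2 + x 0 2 * y 0 0)
    (x 0 0 * y 0 3 + x 0 1 * y 0 2 - x 0 2 * y 0 1 + x 0 3 * y 0 0).

Definition G2_gen (i : bool) : V := if i then G2vec 0 0 1 0 else G2vec 0 1 0 0.

(* Degrees of the basis elements when $e_1$, $e_2$ have degrees [d1], [d2]. *)
Definition G2_deg (d1 d2 : bool) : seq bool := [:: false; d1; d2; d1 (+) d2].

Definition G2_homog (d1 d2 i : bool) (x : V) : Prop :=
  forall k : 'I_4, x 0 k != 0 -> nth false (G2_deg d1 d2) k = i.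

(* Signs of the superinvolution with $e_i^*=(-1)^{s_i}e_i$: one has
   $(e_1e_2)^*=(-1)^{d_1d_2}e_2^*e_1^*=-(-1)^{d_1d_2+s_1+s_2}e_1e_2$. *)
Definition G2_sign (d1 d2 s1 s2 : bool) : seq bool :=
  [:: false; s1; s2; ~~ ((d1 && d2) (+) s1 (+) s2)].

Definition G2_star (d1 d2 s1 s2 : bool) (x : V) : V :=
  \row_(k < 4) ((-1) ^+ nth false (G2_sign d1 d2 s1 s2) k * x 0 k).

Local Ltac rv4 := apply/rowP => -[[|[|[|[|//]]]] ?].

Lemma G2_gen_anticomm i j :
  G2_mul (G2_gen i) (G2_gen j) = - G2_mul (G2_gen j) (G2_gen i).
Proof. by case: i; case: j; rv4; rewrite !mxE /=; ring. Qed.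

Lemma G2_gen_basis a b c d : G2vec a b c d =
  a *: G2vec 1 0 0 0 + b *: G2_gen false + c *: G2_gen true
  + d *: G2_mul (G2_gen false) (G2_gen true).
Proof. by rv4; rewrite !mxE /=; ring. Qed.

Lemma G2vecP (x : V) : x = G2vec (x 0 0) (x 0 1) (x 0 2) (x 0 3).
Proof. by rv4; rewrite !mxE /=; congr (x _ _); apply/val_inj. Qed.

Lemma G2_mulA : associative G2_mul.
Proof. by move=> x y z; rv4; rewrite !mxE /=; ring. Qed.

Lemma G2_mul_linl y : linear (G2_mul^~ y).
Proof. by move=> k x z; rv4; rewrite !mxE /=; ring. Qed.

Lemma G2_mul_linr x : linear (G2_mul x).
Proof. by move=> k y z; rv4; rewrite !mxE /=; ring. Qed.

Lemma G2_star_lin d1 d2 s1 s2 : linear (G2_star d1 d2 s1 s2).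
Proof. by move=> k x y; rv4; rewrite !mxE /=; ring. Qed.

Lemma G2_starK d1 d2 s1 s2 : involutive (G2_star d1 d2 s1 s2).
Proof. by move=> x; apply/rowP => k; rewrite !mxE mulrA -signr_addb addbb mul1r. Qed.

Lemma G2_homog0 d1 d2 i : G2_homog d1 d2 i 0.
Proof. by move=> k; rewrite mxE eqxx. Qed.

Lemma G2_homog_lin d1 d2 i (k : F) x y :
  G2_homog d1 d2 i x -> G2_homog d1 d2 i y -> G2_homog d1 d2 i (k *: x + y).
Proof.
move=> hx hy u; rewrite !mxE.
have [a0|/hx //] := eqVneq (x 0 u) 0.
have [b0|/hy //] := eqVneq (y 0 u) 0.
by rewrite a0 b0 mulr0 addr0 eqxx.
Qed.

Lemma G2_homog_sum d1 d2 x : exists x0 x1,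
  [/\ G2_homog d1 d2 false x0, G2_homog d1 d2 true x1 & x = x0 + x1].
Proof.
pose p i : V := \row_(k < 4)
  (if nth false (G2_deg d1 d2) k == i then x 0 k else 0).
exists (p false), (p true); split.
- by move=> k; rewrite mxE; case: (nth _ (G2_deg d1 d2) k); rewrite /= ?eqxx.
- by move=> k; rewrite mxE; case: (nth _ (G2_deg d1 d2) k); rewrite /= ?eqxx.
- by apply/rowP => k; rewrite !mxE; case: (nth _ _ _); rewrite ?addr0 ?add0r.
Qed.

Lemma G2_homog_direct d1 d2 x :
  G2_homog d1 d2 false x -> G2_homog d1 d2 true x -> x = 0.
Proof.
move=> h0 h1; apply/rowP => k; rewrite mxE.
have [//|nz] := eqVneq (x 0 k) 0.
by have := h0 _ nz; rewrite (h1 _ nz).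
Qed.

Lemma G2_star_homog d1 d2 s1 s2 i x :
  G2_homog d1 d2 i x -> G2_homog d1 d2 i (G2_star d1 d2 s1 s2 x).
Proof.
move=> hx k; rewrite mxE => nz; apply: hx.
by apply: contraNneq nz => ->; rewrite mulr0.
Qed.

Lemma G2_homogE d1 d2 i x : G2_homog d1 d2 i x -> exists a b c d, x =
  G2vec ((~~ i)%:R * a) ((d1 == i)%:R * b) ((d2 == i)%:R * c)
    ((d1 (+) d2 == i)%:R * d).
Proof.
move=> h; exists (x 0 0), (x 0 1), (x 0 2), (x 0 3).
have Z k : x 0 k = (nth false (G2_deg d1 d2) k == i)%:R * x 0 k.
  have [->|/h ->] := eqVneq (x 0 k) 0; first by rewrite mulr0.
  by rewrite eqxx mul1r.
rewrite {1}(G2vecP x) {1}(Z 0) {1}(Z 1) {1}(Z 2) {1}(Z 3) /=.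
by case: i {h Z}.
Qed.

Lemma G2_homogM d1 d2 i j x y : G2_homog d1 d2 i x -> G2_homog d1 d2 j y ->
  G2_homog d1 d2 (i (+) j) (G2_mul x y).
Proof.
move=> /G2_homogE [a [b [c [d ->]]]] /G2_homogE [a' [b' [c' [d' ->]]]].
by case: i; case: j; case: d1; case: d2 => -[[|[|[|[|//]]]] ?];
  rewrite !mxE /= ?(mulr0, mul0r, addr0, subr0) ?eqxx.
Qed.

Lemma G2_starM d1 d2 s1 s2 i j x y :
  G2_homog d1 d2 i x -> G2_homog d1 d2 j y ->
  G2_star d1 d2 s1 s2 (G2_mul x y) =
  (-1) ^+ (i && j) *: G2_mul (G2_star d1 d2 s1 s2 y) (G2_star d1 d2 s1 s2 x).
Proof.
move=> /G2_homogE [a [b [c [d ->]]]] /G2_homogE [a' [b' [c' [d' ->]]]].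
have S : (-1) ^+ (~~ ((d1 && d2) (+) s1 (+) s2)) =
    - ((-1) ^+ (d1 && d2) * ((-1) ^+ s1 * (-1) ^+ s2)) :> F.
  by rewrite signrN !signr_addb mulrA.
have [u hu] : exists u : F, (-1) ^+ s1 = u by eexists.
have [v hv] : exists v : F, (-1) ^+ s2 = v by eexists.
rewrite hu hv in S; rv4; rewrite !mxE /= ?S ?hu ?hv {S hu hv};
by case: i; case: j; case: d1; case: d2;
  rewrite /= ?expr0 ?expr1 ?mulr0n ?mulr1n; ring.
Qed.

Definition G2 (d1 d2 s1 s2 : bool) : starAlg F :=
  @StarAlg F V G2_mul (G2_homog d1 d2) (G2_star d1 d2 s1 s2)
    G2_mulA G2_mul_linl G2_mul_linr (@G2_homog0 d1 d2) (@G2_homog_lin d1 d2)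
    (@G2_homog_sum d1 d2) (@G2_homog_direct d1 d2) (@G2_homogM d1 d2)
    (@G2_star_lin d1 d2 s1 s2) (@G2_star_homog d1 d2 s1 s2)
    (@G2_starK d1 d2 s1 s2) (@G2_starM d1 d2 s1 s2).

Definition G2_psi_gr : starAlg F := G2 true true false false.
Definition G2_tau : starAlg F := G2 false false true true.
Definition G2_tau_gr : starAlg F := G2 true true true true.
Definition G2_tau_gri : starAlg F := G2 false true true true.
Definition G2_gamma_gr : starAlg F := G2 true true true false.
Definition G2_gamma_gri : starAlg F := G2 false true true false.

End G2.

Definition Itilde (F : fieldType) (B : starAlg F) : Prop :=
  List.In B [::
    C3_i1_gr F; C3_i2 F; C3_i3_gr F;
    U3_star F; U3_star_gri F; N3_star F; N3_star_gri F;
    G2_psi_gr F; G2_tau F; G2_tau_gr F; G2_tau_gri F;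
    G2_gamma_gr F; G2_gamma_gri F;
    W_eta1_gri F; W_eta2_gr F; W_eta3_gri F].

(* Main.v *)
From HB Require Import structures.
Require Import Defs.
From mathcomp Require Import all_boot all_order all_algebra all_fingroup finmap.
From mathcomp Require Import boolp classical_sets reals topology normedtype sequences.
From mathcomp Require Import ring lra.

(** In a unitary algebra of quadratic growth the multilinear identities are
    determined by setting all but at most two letters equal to [1], so that the
    algebra is controlled by which of the sixteen atoms, [uv + vu] or [uv - vu] with
    [u], [v] of prescribed types, vanish on it.  If all do, words with two
    letters outside $A_0^+$ vanish, the others commute, and the growth is at most
    linear; so some atom survives, and the one algebra [B] of the list on which only
    this atom survives satisfies all identities of [A].  As [B] has at least
    [n(n-1)/2] codimensions, minimality forces [A] and [B] to be equivalent.

    Conversely let [C], not necessarily unitary, satisfy all identities of [B] and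
    one more.  Unable to substitute [1], one replaces [x] by [xb + bx] and subtracts
    [2b] times the original on the right: this isolates the atom [p] of [B] and gives
    [p x_1 ... x_m = 0] on [C].  Modulo this identity long words commute or
    vanish, so that the codimension of [C] is eventually of the form [b + nk]. *)

Set Implicit Arguments.
Unset Strict Implicit.
Unset Printing Implicit Defensive.

Import Order.TTheory GRing.Theory Num.Theory.
Import numFieldNormedType.Exports.

Local Open Scope classical_set_scope.
Local Open Scope ring_scope.

(** * Words in a superalgebra with superinvolution *)

(** The count sixteen arises as follows. With a factor in $A_0^+$ only the commutator is
    informative, because $1v+v1=2v$; this leaves four choices for the other factor. The three
    remaining types form six unordered pairs, each with two signs. No other combinations are needed:
    the superinvolution exchanges $uv$ and $vu$ up to a sign, so a relation $a\,uv+b\,vu=0$ splits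
    into $(a+b)(uv+vu)=0$ and $(a-b)(uv-vu)=0$. A multilinear polynomial is therefore recorded by
    two kinds of numbers, the sum of its coefficients and the sums over the words in which one given
    letter precedes another. The obstacle in the converse is an atom with a factor in $A_0^+$. An
    identity isolates the atom only if a single pair of letters contributes to it, but many pairs in
    the same polynomial can then play the part of $u$, $v$, and without a unit the other letters
    cannot be removed. Subtracting $2b$ times the original on the right cancels every contribution
    of two old letters, so that only pairs containing the new letter remain. *)

Notation vtype := (bool * bool)%type.

Notation sym0 := ((false, false) : vtype).

Section Words.
Variables (F : fieldType) (A : starAlg F).
Implicit Types (a b c : A) (l : seq A).

Lemma amulDl a b c : amul (a + b) c = amul a c + amul b c.
Proof. by have := amul_linl c 1 a b; rewrite !scale1r. Qed.

Lemma amulDr a b c : amul a (b + c) = amul a b + amul a c.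
Proof. by have := amul_linr a 1 b c; rewrite !scale1r. Qed.

Lemma amul0l b : amul 0 b = 0.
Proof. by apply: (addrI (amul 0 b)); rewrite -amulDl !addr0. Qed.

Lemma amul0r b : amul b 0 = 0.
Proof. by apply: (addrI (amul b 0)); rewrite -amulDr !addr0. Qed.

Lemma amulZl k a b : amul (k *: a) b = k *: amul a b.
Proof. by have := amul_linl b k a 0; rewrite amul0l !addr0. Qed.

Lemma amulZr k a b : amul a (k *: b) = k *: amul a b.
Proof. by have := amul_linr a k b 0; rewrite amul0r !addr0. Qed.

Lemma amul_suml (I : Type) (s : seq I) (P : pred I) (G : I -> A) b :
  amul (\sum_(i <- s | P i) G i) b = \sum_(i <- s | P i) amul (G i) b.
Proof.
exact: (big_morph (fun x => amul x b) (fun x y => amulDl x y b) (amul0l b)).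
Qed.

Lemma amul_sumr (I : Type) (s : seq I) (P : pred I) (G : I -> A) b :
  amul b (\sum_(i <- s | P i) G i) = \sum_(i <- s | P i) amul b (G i).
Proof. exact: (big_morph (amul b) (amulDr b) (amul0r b)). Qed.

Lemma starD a b : star (a + b) = star a + star b.
Proof. by have := star_lin 1 a b; rewrite !scale1r. Qed.

Lemma star0 : star (0 : A) = 0.
Proof. by apply: (addrI (star 0)); rewrite -starD !addr0. Qed.

Lemma starZ k a : star (k *: a) = k *: star a.
Proof. by have := star_lin k a 0; rewrite star0 !addr0. Qed.

Lemma homogD i a b : homog i a -> homog i b -> homog i (a + b).
Proof. by move=> ha hb; have := homog_lin 1 ha hb; rewrite scale1r. Qed.

Lemma homogZ i k a : homog i a -> homog i (k *: a).
Proof. by move=> ha; have := homog_lin k ha (homog0 A i); rewrite addr0. Qed.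

Definition typed (t : vtype) (a : A) : Prop := sympart t.1 t.2 a.

Lemma typed0 t : typed t 0.
Proof. by split; [apply: homog0|rewrite star0 scaler0]. Qed.

Lemma typedD t a b : typed t a -> typed t b -> typed t (a + b).
Proof.
by move=> [ha sa] [hb sb]; split; [exact: homogD|rewrite starD sa sb scalerDr].
Qed.

Lemma typedZ t k a : typed t a -> typed t (k *: a).
Proof.
move=> [ha sa]; split; first exact: homogZ.
by rewrite starZ sa !scalerA mulrC.
Qed.

(* Products of elements of types [t] and [t'] are exchanged by the
   superinvolution up to this sign. *)
Definition swap_sign (t t' : vtype) : bool := (t.1 && t'.1) (+) t.2 (+) t'.2.

Lemma star_typedM t t' a b : typed t a -> typed t' b ->
  star (amul a b) = (-1) ^+ swap_sign t t' *: amul b a.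
Proof.
move=> [ha sa] [hb sb]; rewrite (starM ha hb) sa sb amulZl amulZr !scalerA.
by rewrite /swap_sign !signr_addb -mulrA [X in _ * X]mulrC mulrA.
Qed.

Definition pmul (eps : bool) a b := amul a b + (-1) ^+ eps *: amul b a.

Definition ptype eps (t t' : vtype) : vtype :=
  (t.1 (+) t'.1, swap_sign t t' (+) eps).

(** Up to the sign [swap_sign] the superinvolution exchanges $ab$ and $ba$, so $ab+ba$ and $ab-ba$
    are eigenvectors for it, while $ab$ alone in general is not. *)
Lemma typed_pmul eps t t' a b : typed t a -> typed t' b ->
  typed (ptype eps t t') (pmul eps a b).
Proof.
move=> ta tb; have [[ha _] [hb _]] := (ta, tb); split.
  apply: homogD; first exact: homogM.
  by apply: homogZ; rewrite /= addbC; apply: homogM.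
rewrite /pmul starD starZ (star_typedM ta tb) (star_typedM tb ta) scalerDr.
rewrite !scalerA /= [in RHS]addrC.
have -> : swap_sign t' t = swap_sign t t'.
  by rewrite /swap_sign andbC addbAC.
congr (_ *: _ + _ *: _); rewrite !signr_addb; last by rewrite mulrC.
by rewrite -[RHS]mulrA -(signr_addb _ eps) addbb mulr1.
Qed.

(** The empty product is [0], as in [weval], since there may be no unit; hence the nonemptiness
    conditions on words below. *)
Definition wprod l : A := if l is a :: l' then foldl (@amul F A) a l' else 0.

Lemma foldl_amul a b l : foldl (@amul F A) (amul a b) l = amul a (foldl (@amul F A) b l).
Proof. by elim: l b => //= c l IH b; rewrite -amulA IH. Qed.

Lemma foldl_amul0 l : foldl (@amul F A) 0 l = 0.
Proof. by elim: l => //= a l IH; rewrite amul0l. Qed.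

Lemma foldl_amul_lin k a b l :
  foldl (@amul F A) (k *: a + b) l =
  k *: foldl (@amul F A) a l + foldl (@amul F A) b l.
Proof. by elim: l a b => //= c l IH a b; rewrite amulDl amulZl IH. Qed.

Lemma foldl_amulZ k a l :
  foldl (@amul F A) (k *: a) l = k *: foldl (@amul F A) a l.
Proof. by have := foldl_amul_lin k a 0 l; rewrite foldl_amul0 !addr0. Qed.

Lemma foldl_amulD a b l :
  foldl (@amul F A) (a + b) l =
  foldl (@amul F A) a l + foldl (@amul F A) b l.
Proof. by have := foldl_amul_lin 1 a b l; rewrite !scale1r. Qed.

Lemma wprod_cons a l : l != [::] -> wprod (a :: l) = amul a (wprod l).
Proof. by case: l => //= b l _; rewrite foldl_amul. Qed.

Lemma wprod_rcons a l : l != [::] -> wprod (rcons l a) = amul (wprod l) a.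
Proof. by case: l => //= b l _; rewrite -cats1 foldl_cat. Qed.

Lemma wprod_lin l1 l2 k a b : wprod (l1 ++ (k *: a + b) :: l2) =
  k *: wprod (l1 ++ a :: l2) + wprod (l1 ++ b :: l2).
Proof.
case: l1 => [|c l1] /=; first exact: foldl_amul_lin.
by rewrite !foldl_cat /= amulDr amulZr foldl_amul_lin.
Qed.

Lemma wprod_0 l1 l2 : wprod (l1 ++ 0 :: l2) = 0.
Proof.
case: l1 => [|c l1] /=; first exact: foldl_amul0.
by rewrite foldl_cat /= amul0r foldl_amul0.
Qed.

Lemma wprod_mem0 l : 0 \in l -> wprod l = 0.
Proof. by case/splitPr => l1 l2; apply: wprod_0. Qed.

Lemma wprod_split l1 l2 a b :
  wprod (l1 ++ amul a b :: l2) = wprod (l1 ++ a :: b :: l2).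
Proof. by case: l1 => [|c l1] //=; rewrite !foldl_cat /= amulA. Qed.

Lemma wprod_pmul l1 l2 eps a b : wprod (l1 ++ pmul eps a b :: l2) =
  wprod (l1 ++ a :: b :: l2) + (-1) ^+ eps *: wprod (l1 ++ b :: a :: l2).
Proof. by rewrite /pmul addrC wprod_lin !wprod_split addrC. Qed.

Section Unit.
Variable e : A.
Hypothesis eu : forall a, amul e a = a /\ amul a e = a.

(** The odd part $e_1$ of the unit satisfies $e_1b=b-e_0b$, which for homogeneous $b$ has both
    degrees; so $e_1$ annihilates the algebra and $e_1=e_1e=0$. Since $e$ is then even, applying the
    superinvolution to $e^*e=e^*$ gives $e^*e=e$, whence $e^*=e$. *)
Lemma unit_typed : typed sym0 e.
Proof.
have [e0 [e1 [h0 h1 ee]]] := homog_sum e.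
have e1M a : amul e1 a = 0.
  have H i b : homog i b -> amul e1 b = 0.
    move=> hb; have M1 : homog (true (+) i) (amul e1 b) by apply: homogM.
    have M0 : homog i (amul e1 b).
      have -> : amul e1 b = b + (-1) *: amul e0 b.
        by rewrite scaleN1r -{2}(eu b).1 ee amulDl [_ + amul e1 b]addrC addrK.
      by apply: homogD => //; apply: homogZ; have := homogM h0 hb.
    by case: i M1 M0 {hb} => /= M1 M0; apply: homog_direct.
  have [a0 [a1 [g0 g1 ->]]] := homog_sum a.
  by rewrite amulDr (H _ _ g0) (H _ _ g1) addr0.
have he : homog false e.
  by rewrite ee -[e1](eu e1).2 e1M addr0.
split=> //=; rewrite expr0 scale1r.
have L i a : homog i a -> amul (star e) (star a) = star a.
  by move=> ha; rewrite -{2}(eu a).2 (starM ha he) andbF expr0 scale1r.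
by have := L false _ (star_homog he); rewrite starK (eu _).2.
Qed.

Lemma foldl_unit a (I : Type) (r : I -> A) (P : pred I) (w : seq I) :
  (forall i, ~~ P i -> r i = e) ->
  foldl (@amul F A) a (map r w) = foldl (@amul F A) a (map r (seq.filter P w)).
Proof.
move=> H; elim: w a => //= i w IH a.
by case: ifP => /= Pi; rewrite IH // H ?Pi // (eu _).2.
Qed.

Lemma wprod_foldl_unit l : l != [::] -> wprod l = foldl (@amul F A) e l.
Proof. by case: l => //= a l _; rewrite (eu a).1. Qed.

End Unit.

End Words.

(** * Relative positions of letters *)

Section Before.
Implicit Types (i j k l : nat) (w : seq nat).

(** A letter missing from [w] counts as standing after all letters of [w]. *)
Definition before i j w : bool := (index i w < index j w)%N.

Lemma before_cons i j x w : before i j (x :: w) =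
  if x == j then false else if x == i then true else before i j w.
Proof. by rewrite /before /=; case: (x == j); case: (x == i). Qed.

Lemma beforeC i j w : i \in w -> i != j -> before j i w = ~~ before i j w.
Proof.
elim: w => //= x w IH; rewrite !before_cons inE => xw ij.
have [->|xi] := eqVneq x i; first by rewrite (negbTE ij).
by have [//|xj] := eqVneq x j; rewrite IH //; move: xw; rewrite [i == x]eq_sym (negbTE xi).
Qed.

Lemma filter2_before i j w : uniq w -> i \in w -> j \in w -> i != j ->
  seq.filter (fun k => (k == i) || (k == j)) w =
  if before i j w then [:: i; j] else [:: j; i].
Proof.
have H k m u : k != m -> m \notin u -> uniq u -> k \in u ->
    seq.filter (fun x => (x == k) || (x == m)) u = [:: k].
  move=> km mu uu ku; rewrite (eq_in_filter (a2 := pred1 k)).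
    by rewrite filter_pred1_uniq.
  by move=> x xu /=; case: (eqVneq x m) xu => [->|]; rewrite ?orbF // (negbTE mu).
elim: w => //= x w IH /andP [xw uw]; rewrite !inE before_cons => iw jw ij.
have [ix|xi] := eqVneq i x.
  subst x; rewrite (negbTE ij) /=; move: jw; rewrite eq_sym (negbTE ij) /= => jw.
  congr cons; rewrite (eq_filter (a2 := fun k => (k == j) || (k == i))).
    by rewrite H // 1?eq_sym.
  by move=> k /=; rewrite orbC.
move: iw; rewrite (negbTE xi) /= => iw; have [jx|xj] := eqVneq j x.
  by subst x; rewrite H.
move: jw; rewrite (negbTE xj) /= => jw.
exact: IH.
Qed.

Lemma before_swap i j k l w1 w2 : k != l -> (i, j) != (k, l) -> (i, j) != (l, k) ->
  before i j (w1 ++ k :: l :: w2) = before i j (w1 ++ l :: k :: w2).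
Proof.
move=> /eqP kl /eqP H1 /eqP H2.
elim: w1 => [|x w1 IH] /=; last by rewrite !before_cons IH.
rewrite !before_cons.
by case: (k =P j) => e1; case: (l =P j) => e2; case: (k =P i) => e3;
  case: (l =P i) => e4; subst; rewrite ?eqxx.
Qed.

Lemma before_rcons1 i b w : i \in w -> b \notin w -> before i b (rcons w b).
Proof.
move=> iw bw; rewrite /before -cats1 !index_cat iw (negbTE bw) /= eqxx addn0.
by rewrite index_mem.
Qed.

Lemma before_rcons2 i b w : i \in w -> b \notin w -> before b i (rcons w b) = false.
Proof.
move=> iw bw; apply/negbTE; rewrite -leqNgt; exact/ltnW/before_rcons1.
Qed.

Lemma before_rcons i j b w : i \in w -> j \in w -> 
  before i j (rcons w b) = before i j w.
Proof. by move=> iw jw; rewrite /before -cats1 !index_cat iw jw. Qed.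

(** In a word without repetitions, [insa] and [insb] are the effect of replacing $x_i$ by $x_ix_b$
    and by $x_bx_i$. *)
Definition insa b i w := flatten [seq if x == i then [:: x; b] else [:: x] | x <- w].
Definition insb b i w := flatten [seq if x == i then [:: b; x] else [:: x] | x <- w].

Lemma insa_cons b i x w : insa b i (x :: w) =
  if x == i then x :: b :: insa b i w else x :: insa b i w.
Proof. by rewrite /insa /=; case: eqP. Qed.

Lemma insb_cons b i x w : insb b i (x :: w) =
  if x == i then b :: x :: insb b i w else x :: insb b i w.
Proof. by rewrite /insb /=; case: eqP. Qed.

Lemma insa_notin b i w : i \notin w -> insa b i w = w.
Proof.
elim: w => //= x w IH; rewrite inE negb_or eq_sym => /andP [/negbTE xi iw].
by rewrite insa_cons xi IH.
Qed.

Lemma insb_notin b i w : i \notin w -> insb b i w = w.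
Proof.
elim: w => //= x w IH; rewrite inE negb_or eq_sym => /andP [/negbTE xi iw].
by rewrite insb_cons xi IH.
Qed.

Lemma insa_cat b i w1 w2 : insa b i (w1 ++ w2) = insa b i w1 ++ insa b i w2.
Proof. by rewrite /insa map_cat flatten_cat. Qed.

Lemma insb_cat b i w1 w2 : insb b i (w1 ++ w2) = insb b i w1 ++ insb b i w2.
Proof. by rewrite /insb map_cat flatten_cat. Qed.

Lemma insE b i w : uniq w -> i \in w -> exists w1 w2,
  [/\ w = w1 ++ i :: w2, i \notin w1, i \notin w2,
    insa b i w = w1 ++ i :: b :: w2 & insb b i w = w1 ++ b :: i :: w2].
Proof.
move=> uw iw; case/splitPr: iw uw => w1 w2.
rewrite cat_uniq /= negb_or -andbA => /and5P [_ i1 _ i2 _].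
exists w1, w2; split=> //.
  by rewrite insa_cat insa_cons eqxx !insa_notin.
by rewrite insb_cat insb_cons eqxx !insb_notin.
Qed.

Lemma perm_insa b i w : uniq w -> i \in w -> perm_eq (insa b i w) (b :: w).
Proof.
move=> uw iw; have [w1 [w2 [E _ _ -> _]]] := insE b uw iw.
by rewrite E -[b :: w1 ++ _]cat1s perm_sym perm_catCA perm_cat2l; apply/permPl/(perm_catCA [:: b] [:: i] w2).
Qed.

Lemma perm_insb b i w : uniq w -> i \in w -> perm_eq (insb b i w) (b :: w).
Proof.
move=> uw iw; have [w1 [w2 [E _ _ _ ->]]] := insE b uw iw.
by rewrite E -[b :: w1 ++ _]cat1s perm_sym perm_catCA perm_cat2l.
Qed.

Lemma before_insa b i k l w : k != b -> l != b -> before k l (insa b i w) = before k l w.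
Proof.
move=> kb lb; elim: w => //= x w IH; rewrite insa_cons before_cons.
by case: ifP => _; rewrite !before_cons IH // ![b == _]eq_sym (negbTE kb) (negbTE lb).
Qed.

Lemma before_insb b i k l w : k != b -> l != b -> before k l (insb b i w) = before k l w.
Proof.
move=> kb lb; elim: w => //= x w IH; rewrite insb_cons before_cons.
by case: ifP => _; rewrite !before_cons IH // ![b == _]eq_sym (negbTE kb) (negbTE lb).
Qed.

Lemma before_insa_l b i l w : l != b -> l != i -> b \notin w ->
  before b l (insa b i w) = before i l w.
Proof.
move=> lb li; elim: w => //= x w IH; rewrite inE negb_or => /andP [bx bw].
rewrite insa_cons before_cons; case: (eqVneq x i) bx => [->|xi] bx.
  rewrite !before_cons eqxx [i == l]eq_sym [b == l]eq_sym (negbTE li) (negbTE lb).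
  by rewrite [i == b]eq_sym (negbTE bx).
by rewrite before_cons IH // [x == b]eq_sym (negbTE bx).
Qed.

Lemma before_insb_l b i l w : l != b -> l != i -> b \notin w ->
  before b l (insb b i w) = before i l w.
Proof.
move=> lb li; elim: w => //= x w IH; rewrite inE negb_or => /andP [bx bw].
rewrite insb_cons before_cons; case: (eqVneq x i) bx => [->|xi] bx.
  by rewrite !before_cons eqxx [i == l]eq_sym [b == l]eq_sym (negbTE li) (negbTE lb).
by rewrite before_cons IH // [x == b]eq_sym (negbTE bx).
Qed.

Lemma before_insa_i b i w : i \in w -> b \notin w -> before i b (insa b i w).
Proof.
elim: w => //= x w IH; rewrite !inE negb_or insa_cons => iw /andP [bx bw].
move: iw bx; case: (eqVneq x i) => [->|xi] /= iw bx; rewrite !before_cons.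
  by rewrite [i == b]eq_sym (negbTE bx) eqxx.
by rewrite [x == b]eq_sym (negbTE bx) (negbTE xi) IH //; move: iw; rewrite eq_sym (negbTE xi).
Qed.

Lemma before_insb_i b i w : i \in w -> b \notin w -> before b i (insb b i w).
Proof.
elim: w => //= x w IH; rewrite !inE negb_or insb_cons => iw /andP [bx bw].
move: iw bx; case: (eqVneq x i) => [->|xi] /= iw bx; rewrite !before_cons.
  by rewrite (negbTE bx) eqxx.
by rewrite [x == b]eq_sym (negbTE bx) (negbTE xi) IH //; move: iw; rewrite eq_sym (negbTE xi).
Qed.

End Before.

(** * Multilinear identities as sums of words *)

Section WordPoly.
Variable F : fieldType.
Implicit Types (g : seq (F * seq nat)) (w : seq nat) (ty : nat -> vtype).

(** In a multilinear polynomial, setting all letters but $x_i$ and $x_j$ equal to the unit leaves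
    $x_ix_j$ with coefficient [bsum i j g] and $x_jx_i$ with coefficient [bsum j i g]. If at most
    one letter is kept, the coefficient left is [csum g]. *)
Definition csum g : F := \sum_(x <- g) x.1.
Definition bsum i j g : F := \sum_(x <- g) x.1 * (before i j x.2)%:R.
Definition geval (A : starAlg F) (r : nat -> A) g : A :=
  \sum_(x <- g) x.1 *: wprod (map r x.2).

Definition assignment (A : starAlg F) ty (r : nat -> A) : Prop :=
  forall j, typed (ty j) (r j).

Definition gident (A : starAlg F) ty g : Prop :=
  forall r : nat -> A, assignment ty r -> geval r g = 0.

Lemma csum_cat g g' : csum (g ++ g') = csum g + csum g'.
Proof. exact: big_cat. Qed.
Lemma csum_cons x g : csum (x :: g) = x.1 + csum g.
Proof. exact: big_cons. Qed.
Lemma csum_nil : csum [::] = 0.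
Proof. exact: big_nil. Qed.
Lemma bsum_cat i j g g' : bsum i j (g ++ g') = bsum i j g + bsum i j g'.
Proof. exact: big_cat. Qed.
Lemma bsum_cons i j x g : bsum i j (x :: g) = x.1 * (before i j x.2)%:R + bsum i j g.
Proof. exact: big_cons. Qed.
Lemma bsum_nil i j : bsum i j [::] = 0.
Proof. exact: big_nil. Qed.

Definition gmap (k : F) (h : seq nat -> seq nat) g :=
  [seq (k * x.1, h x.2) | x <- g].

Lemma csum_map k h g : csum (gmap k h g) = k * csum g.
Proof. by rewrite /csum big_map mulr_sumr. Qed.

Lemma bsum_map i j k h g : bsum i j (gmap k h g) =
  k * \sum_(x <- g) x.1 * (before i j (h x.2))%:R.
Proof. by rewrite /bsum big_map mulr_sumr; apply: eq_bigr => x _; rewrite mulrA. Qed.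

Section Eval.
Variable A : starAlg F.
Implicit Types r : nat -> A.

Lemma geval_cat r g g' : geval r (g ++ g') = geval r g + geval r g'.
Proof. exact: big_cat. Qed.
Lemma geval_cons r x g : geval r (x :: g) = x.1 *: wprod (map r x.2) + geval r g.
Proof. exact: big_cons. Qed.
Lemma geval_nil r : geval r [::] = 0.
Proof. exact: big_nil. Qed.
Lemma geval_map r k h g : geval r (gmap k h g) =
  k *: \sum_(x <- g) x.1 *: wprod (map r (h x.2)).
Proof. by rewrite /geval big_map scaler_sumr; apply: eq_bigr => x _; rewrite scalerA. Qed.

End Eval.

Lemma bsumC i j w0 g : i != j -> i \in w0 ->
  (forall x, x \in g -> perm_eq x.2 w0) ->
  bsum j i g = csum g - bsum i j g.
Proof.
move=> ij iw pg; rewrite /bsum /csum -sumrB; apply: eq_big_seq => x /pg px.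
by rewrite beforeC ?(perm_mem px) //; case: before; rewrite /= ?mulr0 ?mulr1 ?subr0 ?subrr.
Qed.

Definition gpoly ty g : freeAlg F :=
  \sum_(x <- g) x.1 *: mkmalgU (FMonom [seq (j, ty j) : svar | j <- x.2]) 1.

Lemma peval0 (A : starAlg F) (s : svar -> A) : peval s 0 = 0.
Proof. by rewrite /peval big1 // => w _; rewrite mcoeff0 scale0r. Qed.

Lemma pevalD (A : starAlg F) (s : svar -> A) f h :
  peval s (f + h) = peval s f + peval s h.
Proof. by have := peval_lin s 1 f h; rewrite !scale1r. Qed.

Lemma pevalZ (A : starAlg F) (s : svar -> A) k f :
  peval s (k *: f) = k *: peval s f.
Proof. by have := peval_lin s k f 0; rewrite peval0 !addr0. Qed.

Lemma peval_sum (A : starAlg F) (s : svar -> A) (I : Type) (t : seq I)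
    (P : pred I) (G : I -> freeAlg F) :
  peval s (\sum_(i <- t | P i) G i) = \sum_(i <- t | P i) peval s (G i).
Proof. exact: (big_morph (peval s) (pevalD s) (peval0 s)). Qed.

Lemma wevalE (A : starAlg F) (s : svar -> A) (w : seq svar) : weval s w = wprod (map s w).
Proof. by case: w => //= x w; elim: w (s x) => //= y w IH a; rewrite IH. Qed.

Lemma pevalU (A : starAlg F) (s : svar -> A) (m : fmonom svar) :
  peval s (mkmalgU m 1 : freeAlg F) = wprod (map s m).
Proof.
rewrite /peval msuppU oner_eq0 big_seq_fset1 mcoeffU eqxx.
by rewrite scale1r wevalE.
Qed.

Lemma peval_gpoly (A : starAlg F) ty (s : svar -> A) g :
  peval s (gpoly ty g) = geval (fun j => s (j, ty j)) g.
Proof.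
rewrite peval_sum; apply: eq_bigr => x _.
by rewrite pevalZ pevalU -map_comp.
Qed.

Lemma gident_star_id (A : starAlg F) ty g :
  (forall x, x \in g -> x.2 != [::]) ->
  star_id A (gpoly ty g) <-> gident A ty g.
Proof.
move=> ng; split=> [[_ H] r hr|H].
  (* Variables whose type disagrees with [ty] do not occur in [gpoly ty g], and [0] is a legitimate
     value for them. *)
  pose s (x : svar) : A := if x.2 == ty x.1 then r x.1 else 0.
  have hs : substitution s.
    move=> [j t]; rewrite /s /=; case: eqP => [->|_]; first exact: hr.
    exact: typed0.
  by have := H s hs; rewrite peval_gpoly /s /= => <-; apply: eq_bigr => x _;
    congr (_ *: wprod _); apply: eq_map => j; rewrite eqxx.
split; last first.
  by move=> s hs; rewrite peval_gpoly; apply: H => j; apply: hs (j, ty j).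
rewrite raddf_sum /= big_seq big1 // => x /ng xn.
rewrite mcoeffZ mcoeffU.
case: eqP => [/(congr1 (@fmonom_val _))|]; last by rewrite mulr0.
by rewrite fm1 /=; case: x.2 xn.
Qed.

Lemma gident_variety (A B : starAlg F) ty g :
  (forall x, x \in g -> x.2 != [::]) ->
  variety A B -> gident A ty g -> gident B ty g.
Proof. by move=> ng V /(gident_star_id A ty ng) /V /(gident_star_id B ty ng). Qed.

End WordPoly.

(** * The common shape of the sixteen algebras *)

Lemma typed_inj (F : fieldType) (char2 : 2%:R != 0 :> F) (A : starAlg F) t t' (a : A) :
  typed t a -> typed t' a -> a != 0 -> t = t'.
Proof.
case: t t' => [i s] [i' s'] [/= h e] [/= h' e'] a0.
have ii : i = i'.
  by apply/eqP; apply: contraNT a0; case: i i' h h' {e e'} => [] [] //= h h' _;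
    apply/eqP; apply: homog_direct.
congr pair => //; apply/eqP; apply: contraNT a0 => ss.
have aN : a = - a.
  move: e; rewrite e'; case: s s' ss {e' h h'} => [] [] //= _;
    rewrite !expr0 !expr1 scale1r scaleN1r => E; [exact: E|exact: esym].
have /eqP : (2%:R : F) *: a = 0 by rewrite scaler_nat mulr2n {2}aN subrr.
by rewrite scaler_eq0 (negbTE char2).
Qed.

Section Model.
Variables (F : fieldType) (p1 p2 : vtype) (eps : bool).
Hypothesis char2 : 2%:R != 0 :> F.

Notation ptyp := (ptype eps p1 p2).

(* The algebras of the list share this shape: [J] is a radical complementing the
   line of the unit, with [J^3 = 0], in which [pmul eps] is nonzero for elements
   of types [p1], [p2] and all other products that could detect an identity
   vanish. *)
Record model (B : starAlg F) (e : B) (J : B -> Prop) : Prop := Model {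
  mod_unit : forall a : B, amul e a = a /\ amul a e = a;
  mod_dec : forall t (b : B), typed t b -> exists k v,
    [/\ b = k *: e + v, typed t v, J v & t != sym0 -> k = 0];
  mod_J3 : forall u v w, J u -> J v -> J w -> amul (amul u v) w = 0;
  mod_J2 : forall t t' u v, typed t u -> J u -> typed t' v -> J v ->
    amul u v != 0 -> (t, t') = (p1, p2) \/ (t, t') = (p2, p1);
  mod_eps : p1 != sym0 -> forall u v, typed p1 u -> J u -> typed p2 v -> J v ->
    amul u v = (-1) ^+ eps *: amul v u;
  mod_types : forall t (u : B), typed t u -> u != 0 -> t \in [:: sym0; p1; p2; ptyp];
  mod_wit : exists u v : B, [/\ typed p1 u, typed p2 v & pmul eps u v != 0]
}.

(** A factor in $A_0^+$ is listed first and only allows the commutator: the unit belongs to $A_0^+$,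
    and $1v+v1=2v$. *)
Definition valid_atom : bool :=
  ((p1 == sym0) ==> eps) && ((p2 == sym0) ==> (p1 == sym0)).
Hypothesis valid : valid_atom.

Lemma valid_eps : p1 = sym0 -> eps.
Proof. by move=> e; have /andP [/implyP h _] := valid; apply: h; apply/eqP. Qed.

Lemma valid_sym0 : p2 = sym0 -> p1 = sym0.
Proof. by move=> e; have /andP [_ /implyP h] := valid; apply/eqP/h/eqP. Qed.

Implicit Types (g : seq (F * seq nat)) (w : seq nat) (ty : nat -> vtype).

Definition relevant ty w0 k l : bool :=
  [&& k \in w0, l \in w0, k != l, ty k == p1, ty l == p2 &
    all (fun j => [|| j == k, j == l | ty j == sym0]) w0].

Definition nonsym0 ty w0 := count (fun j => ty j != sym0) w0.

(* [condL] and [condP] are what is left of a multilinear identity with letters [w0]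
   when the letters of type [sym0], except those in question, are set to [1]; they
   characterize the identities of a model. *)
Definition condL ty w0 g : Prop := (nonsym0 ty w0 <= 1)%N ->
  all (fun j => ty j \in [:: sym0; p1; p2; ptyp]) w0 -> csum g = 0.

Definition condP ty w0 g : Prop := forall k l, relevant ty w0 k l ->
  bsum k l g + (-1) ^+ eps * bsum l k g = 0.

(** With [p1] equal to [sym0], only the second letter of a relevant pair can lie outside $A_0^+$, so
    that [condL] applies besides [condP]. *)
Lemma relevant_nonsym0 ty w0 k l : uniq w0 -> relevant ty w0 k l ->
  p1 = sym0 -> (nonsym0 ty w0 <= 1)%N.
Proof.
move=> uw /and5P [kw lw kl /eqP tk /andP [/eqP tl /allP h]] e1.
rewrite /nonsym0 (eq_in_count (a2 := fun j => (j == l) && (ty l != sym0))).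
  case: (ty l == sym0) => /=; first by rewrite (eq_count (a2 := pred0)) ?count_pred0 // => j; rewrite andbF.
  rewrite (eq_count (a2 := pred1 l)); last by move=> j; rewrite andbT.
  by rewrite count_uniq_mem //; case: (_ \in _).
move=> j /h /or3P [/eqP ->|/eqP ->|/eqP tj].
- by rewrite tk e1 eqxx (negbTE kl).
- by rewrite eqxx.
- by rewrite tj eqxx; case: eqP => // <-; rewrite tj eqxx.
Qed.

Lemma relevant_types ty w0 k l : relevant ty w0 k l ->
  all (fun j => ty j \in [:: sym0; p1; p2; ptyp]) w0.
Proof.
move=> /and5P [kw lw kl /eqP tk /andP [/eqP tl /allP h]].
apply/allP => j /h /or3P [] /eqP => [->|->|->]; rewrite ?tk ?tl !inE eqxx ?orbT //.
Qed.

Section Check.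
Variables (B : starAlg F) (e : B) (J : B -> Prop).
Hypothesis M : model e J.

Lemma mod_e0 : e != 0.
Proof.
have [u [v [_ _]]] := mod_wit M; apply: contraNneq => e0.
by rewrite -[pmul _ _ _](mod_unit M _).1 e0 amul0l.
Qed.

Lemma check_resolved ty w0 g r : uniq w0 ->
  (forall x, x \in g -> perm_eq x.2 w0) -> w0 != [::] ->
  condL ty w0 g -> condP ty w0 g -> assignment ty r ->
  (forall j, j \in w0 -> r j = e \/ J (r j)) -> @geval F B r g = 0.
Proof.
move=> uw pg nw cL cP hr res.
have E := mod_unit M; pose P j := r j != e.
have ty_e j : r j = e -> ty j = sym0.
  by move=> re; apply/esym/(typed_inj char2 (unit_typed E) _ mod_e0); rewrite -re.
have ev x : x \in g -> wprod (map r x.2) = foldl (@amul F B) e (map r (seq.filter P x.2)).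
  move=> /pg px; rewrite (wprod_foldl_unit E).
    by apply: (foldl_unit E) => j; rewrite negbK => /eqP.
  by rewrite -size_eq0 size_map (perm_size px) size_eq0.
have pf x : x \in g -> perm_eq (seq.filter P x.2) (seq.filter P w0).
  by move=> /pg; apply: perm_filter.
have rJ j : j \in seq.filter P w0 -> J (r j).
  by rewrite mem_filter => /andP [/eqP nj /res []].
have nP j : j \in w0 -> j \notin seq.filter P w0 -> ty j = sym0.
  by rewrite mem_filter => -> /=; rewrite andbT negbK => /eqP /ty_e.
(* The letters not sent to the unit are sent into [J]. With none or one of them [condL] decides,
   with two [condP] (and [condL] if [p1] is [sym0]), and three or more give [0] since $J^3=0$. *)
case D : (seq.filter P w0) => [|z [|z' [|z'' D']]].
- have -> : geval r g = csum g *: e.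
    rewrite /geval /csum scaler_suml; apply: eq_big_seq => x xg.
    by rewrite ev //; have := pf x xg; rewrite D => /perm_nilP ->.
  rewrite cL ?scale0r //.
    rewrite /nonsym0 (eq_in_count (a2 := pred0)) ?count_pred0 // => j jw.
    by rewrite nP ?D.
  by apply/allP => j jw; rewrite nP ?D // inE eqxx.
- have zw : z \in w0 by have := mem_head z [::]; rewrite -D mem_filter => /andP [].
  have -> : geval r g = csum g *: r z.
    rewrite /geval /csum scaler_suml; apply: eq_big_seq => x xg.
    rewrite ev //; have := pf x xg; rewrite D => /perm_size; case Ex : (seq.filter P x.2) => [|y [|]] // _.
    have := pf x xg; rewrite D Ex => /perm_mem /(_ y); rewrite !inE eqxx => /esym/eqP ->.
    by rewrite /= (E _).1.
  have [->|rz0] := eqVneq (r z) 0; first by rewrite scaler0.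
  rewrite cL ?scale0r //.
    rewrite /nonsym0 (eq_in_count (a2 := fun j => (j == z) && (ty z != sym0))).
      case: (ty z == sym0) => /=; first by rewrite (eq_count (a2 := pred0)) ?count_pred0 // => j; rewrite andbF.
      rewrite (eq_count (a2 := pred1 z)); last by move=> j; rewrite andbT.
      by rewrite count_uniq_mem //; case: (_ \in _).
    move=> j jw; have [->//|jz] := eqVneq j z.
    by rewrite nP ?D ?inE ?jz.
  apply/allP => j jw; have [->|jz] := eqVneq j z; first exact: (mod_types M (hr z)).
  by rewrite nP ?D ?inE ?jz.
- have uD : uniq [:: z; z'] by rewrite -D filter_uniq.
  have zz : z != z' by move: uD; rewrite /= inE andbT.
  have zw : z \in w0 by have := mem_head z [:: z']; rewrite -D mem_filter => /andP [].
  have zw' : z' \in w0.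
    have : z' \in seq.filter P w0 by rewrite D !inE eqxx orbT.
    by rewrite mem_filter => /andP [].
  have Jz : J (r z) by apply: rJ; rewrite D mem_head.
  have Jz' : J (r z') by apply: rJ; rewrite D !inE eqxx orbT.
  have Ev : geval r g = bsum z z' g *: amul (r z) (r z') + bsum z' z g *: amul (r z') (r z).
    rewrite /geval /bsum !scaler_suml -big_split; apply: eq_big_seq => x xg /=.
    have zx : z \in x.2 by rewrite (perm_mem (pg x xg)).
    have zx' : z' \in x.2 by rewrite (perm_mem (pg x xg)).
    rewrite ev // (eq_in_filter (a2 := fun k => (k == z) || (k == z'))); last first.
      move=> k kx; have kw : k \in w0 by rewrite -(perm_mem (pg x xg)).
      have := mem_filter P k w0; rewrite D kw andbT !inE; exact: esym.
    rewrite filter2_before // ?(perm_uniq (pg x xg)) // (beforeC zx zz).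
    by case: before => /=; rewrite (E _).1 ?mulr1 ?mulr0 scale0r ?addr0 ?add0r.
  have key k l : (k = z /\ l = z') \/ (k = z' /\ l = z) -> ty k = p1 -> ty l = p2 ->
      bsum k l g *: amul (r k) (r l) + bsum l k g *: amul (r l) (r k) = 0.
    move=> kl tk tl; have Dkl j : (j \in [:: z; z']) = (j == k) || (j == l).
      by rewrite !inE; case: kl => -[-> ->]; rewrite // orbC.
    have kw : k \in w0 by case: kl => -[-> _].
    have lw : l \in w0 by case: kl => -[_ ->].
    have nkl : k != l by case: kl => -[-> ->] //; rewrite eq_sym.
    have rel : relevant ty w0 k l.
      apply/and5P; split=> //; first by rewrite tk.
      rewrite tl eqxx; apply/allP => j jw.
      case: (boolP (j \in [:: z; z'])); first by rewrite Dkl orbA => ->.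
      by rewrite -D => /nP -> //; rewrite eqxx !orbT.
    have Pkl := cP k l rel.
    (* If [p1] is [sym0] the two products may be independent, as in $U_3$ and $N_3$. But then
       [condL] makes the two coefficients opposite, and [condP] for the commutator forces both to
       vanish. *)
    have [e1|n1] := eqVneq p1 sym0.
      have a0 := cL (relevant_nonsym0 uw rel e1) (relevant_types rel).
      have := bsumC nkl kw pg; rewrite a0 sub0r => b1.
      move: Pkl; rewrite b1 (valid_eps e1) expr1 mulN1r opprK -mulr2n -mulr_natl => /eqP.
      by rewrite mulf_eq0 (negbTE char2) /= => /eqP ->; rewrite oppr0 !scale0r addr0.
    have Jk : J (r k) by case: kl => -[-> _].
    have Jl : J (r l) by case: kl => -[_ ->].
    have tyk := hr k; have tyl := hr l; rewrite tk in tyk; rewrite tl in tyl.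
    rewrite (mod_eps M n1 tyk Jk tyl Jl) scalerA -scalerDl.
    have -> : bsum k l g * (-1) ^+ eps + bsum l k g =
        (-1) ^+ eps * (bsum k l g + (-1) ^+ eps * bsum l k g).
      by rewrite mulrDr mulrA -signr_addb addbb mul1r mulrC.
    by rewrite Pkl mulr0 scale0r.
  rewrite Ev.
  have [z1|n1] := eqVneq (amul (r z) (r z')) 0.
    have [z2|n2] := eqVneq (amul (r z') (r z)) 0; first by rewrite z1 z2 !scaler0 addr0.
    have [[t1 t2]|[t1 t2]] := mod_J2 M (hr z') Jz' (hr z) Jz n2.
      by rewrite addrC; apply: key; [right|..].
    by apply: key; [left|..].
  have [[t1 t2]|[t1 t2]] := mod_J2 M (hr z) Jz (hr z') Jz' n1.
    by apply: key; [left|..].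
  by rewrite addrC; apply: key; [right|..].
- rewrite /geval big1_seq // => x /andP [_ xg]; rewrite ev //.
  have := pf x xg; rewrite D; case Ex : (seq.filter P x.2) => [|y [|y' [|y'' D'']]] px;
    try by have := perm_size px.
  have Jy k : k \in [:: y, y', y'' & D''] -> J (r k).
    by move=> kx; apply: rJ; rewrite D -(perm_mem px).
  rewrite /= (E _).1 (mod_J3 M) ?foldl_amul0 ?scaler0 //; apply: Jy;
    by rewrite !inE eqxx ?orbT.
Qed.

Lemma check_model ty w0 g : uniq w0 ->
  (forall x, x \in g -> perm_eq x.2 w0) -> w0 != [::] ->
  condL ty w0 g -> condP ty w0 g -> gident B ty g.
Proof.
move=> uw pg nw cL cP.
(* By multilinearity each letter is split into its multiple of the unit and its part in [J], which
   are treated separately. The list [l] contains the letters not yet split. *)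
have step (l : seq nat) : forall r : nat -> B, assignment ty r ->
    (forall j, j \in w0 -> j \notin l -> r j = e \/ J (r j)) -> geval r g = 0.
  elim: l => [|i l IH] r hr res.
    apply: (check_resolved uw pg nw cL cP hr) => j jw; exact: (res j jw).
  case: (boolP (i \in w0)) => iw; last first.
    apply: IH => // j jw jl; apply: res => //; rewrite inE negb_or jl andbT.
    by apply: contraNneq iw => <-.
  have [k [v [ri tv Jv kt]]] := mod_dec M (hr i).
  pose r' a j := if j == i then a else r j.
  have res' a : a = e \/ J a -> forall j, j \in w0 -> j \notin l -> r' a j = e \/ J (r' a j).
    move=> ha j jw jl; rewrite /r'; case: eqP => // /eqP ji.
    by apply: res => //; rewrite inE negb_or ji.
  have hr' a : typed (ty i) a -> assignment ty (r' a).
    by move=> ha j; rewrite /r'; case: eqP => [->|].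
  have -> : geval r g = k *: geval (r' e) g + geval (r' v) g.
    rewrite /geval scaler_sumr -big_split; apply: eq_big_seq => x xg /=.
    have ix : i \in x.2 by rewrite (perm_mem (pg x xg)).
    have ux : uniq x.2 by rewrite (perm_uniq (pg x xg)).
    case/splitPr: ix ux => w1 w2.
    rewrite cat_uniq /= negb_or -andbA => /and5P [_ i1 _ i2 _].
    have off a w : i \notin w -> map (r' a) w = map r w.
      move=> iw'; apply/eq_in_map => j jw; rewrite /r'; case: eqP => // ji.
      by move: iw'; rewrite -ji jw.
    rewrite !map_cat /= !off // /r' eqxx ri wprod_lin scalerDr !scalerA.
    by rewrite [k * _]mulrC.
  rewrite (IH (r' v)) ?addr0; [|by apply: hr'|by apply: res'; right].
  have [t0|/kt ->] := eqVneq (ty i) sym0; last by rewrite scale0r.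
  rewrite (IH (r' e)) ?scaler0 //; last by apply: res'; left.
  by apply: hr'; rewrite t0; apply: unit_typed (mod_unit M).
move=> r hr; apply: (step w0) => // j jw.
by rewrite jw.
Qed.

End Check.
End Model.

(** * Identities of unitary algebras *)

Section UnitalConditions.
Variables (F : fieldType) (p1 p2 : vtype) (eps : bool).
Variables (A : starAlg F) (e u v : A).
Hypothesis eu : forall a : A, amul e a = a /\ amul a e = a.
Hypotheses (tu : typed p1 u) (tv : typed p2 v) (uv : pmul eps u v != 0).

Lemma atom_type_neq0 t : t \in [:: sym0; p1; p2; ptype eps p1 p2] ->
  exists2 b : A, typed t b & b != 0.
Proof.
have nz (a : A) : (a = 0 -> pmul eps u v = 0) -> a != 0.
  by move=> h; apply: contraNneq uv => /h ->.
rewrite !inE => /or4P [] /eqP ->.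
- exists e; first exact: unit_typed.
  by apply: nz => e0; rewrite -[LHS](eu _).1 e0 amul0l.
- by exists u => //; apply: nz => ->; rewrite /pmul amul0l amul0r scaler0 addr0.
- by exists v => //; apply: nz => ->; rewrite /pmul amul0l amul0r scaler0 addr0.
- by exists (pmul eps u v) => //; apply: typed_pmul.
Qed.

Lemma ident_condL ty w0 g : uniq w0 -> (forall x, x \in g -> perm_eq x.2 w0) ->
  w0 != [::] -> gident A ty g -> condL p1 p2 eps ty w0 g.
Proof.
move=> uw pg nw id n1 /allP tw.
have ev (r : nat -> A) (P : pred nat) x : (forall j, ~~ P j -> r j = e) -> x \in g ->
    wprod (map r x.2) = foldl (@amul F A) e (map r (seq.filter P x.2)).
  move=> h /pg px; rewrite (wprod_foldl_unit eu).
    exact: (foldl_unit eu).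
  by rewrite -size_eq0 size_map (perm_size px) size_eq0.
case: (boolP (has (fun j => ty j != sym0) w0)) => [/hasP [z zw tz]|].
  have [b tb b0] := atom_type_neq0 (tw z zw).
  have oz j : j \in w0 -> j != z -> ty j = sym0.
    move=> jw jz; apply/eqP; apply: contraTT n1 => tj; rewrite -ltnNge.
    have : uniq [:: j; z] by rewrite /= inE jz.
    rewrite /nonsym0 -size_filter => /uniq_leq_size; apply.
    by move=> y; rewrite !inE mem_filter => /orP [] /eqP ->; apply/andP.
  pose r j := if j == z then b else if ty j == sym0 then e else 0.
  have hr : assignment ty r.
    move=> j; rewrite /r; case: eqP => [->//|_]; case: eqP => [->|_]; last exact: typed0.
    exact: unit_typed.
  have := id r hr.
  have -> : geval r g = csum g *: b.
    rewrite /geval /csum scaler_suml; apply: eq_big_seq => x xg.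
    rewrite (ev _ (fun j => (j == z) || (ty j != sym0))) //; last first.
      by move=> j; rewrite negb_or negbK /r => /andP [/negbTE -> ->].
    rewrite (eq_in_filter (a2 := pred1 z)); last first.
      move=> j; rewrite (perm_mem (pg x xg)) => jw /=.
      by case: (eqVneq j z) => // jz; rewrite oz.
    rewrite filter_pred1_uniq ?(perm_uniq (pg x xg)) ?(perm_mem (pg x xg)) //=.
    by rewrite /r eqxx (eu _).1.
  by move=> /eqP; rewrite scaler_eq0 (negbTE b0) orbF => /eqP.
rewrite -all_predC => /allP h.
have [b tb b0] := atom_type_neq0 (mem_head sym0 _).
have e0 : e != 0 by apply: contraNneq b0 => e0; rewrite -[b](eu _).1 e0 amul0l.
pose r j := if ty j == sym0 then e else 0.
have hr : assignment ty r.
  move=> j; rewrite /r; case: eqP => [->|_]; last exact: typed0.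
  exact: unit_typed.
have := id r hr.
have -> : geval r g = csum g *: e.
  rewrite /geval /csum scaler_suml; apply: eq_big_seq => x xg.
  rewrite (ev _ (fun j => ty j != sym0)) //; last first.
    by move=> j; rewrite negbK /r => ->.
  rewrite (eq_in_filter (a2 := pred0)) ?filter_pred0 //.
  by move=> j; rewrite (perm_mem (pg x xg)) => /h /= /negbTE.
by move=> /eqP; rewrite scaler_eq0 (negbTE e0) orbF => /eqP.
Qed.

Lemma ident_condP ty w0 g : uniq w0 -> (forall x, x \in g -> perm_eq x.2 w0) ->
  w0 != [::] -> gident A ty g -> condP p1 p2 eps ty w0 g.
Proof.
move=> uw pg nw id k l /and5P [kw lw kl /eqP tk /andP [/eqP tl /allP h]].
pose r j := if j == k then u else if j == l then v else if ty j == sym0 then e else 0.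
have hr : assignment ty r.
  move=> j; rewrite /r; case: eqP => [->|_]; first by rewrite tk.
  case: eqP => [->|_]; first by rewrite tl.
  case: eqP => [->|_]; last exact: typed0.
  exact: unit_typed.
have E : bsum k l g *: amul u v + bsum l k g *: amul v u = 0.
  rewrite -(id r hr) /geval /bsum !scaler_suml -big_split; apply: eq_big_seq => x xg /=.
  have px := pg x xg.
  have kx : k \in x.2 by rewrite (perm_mem px).
  have lx : l \in x.2 by rewrite (perm_mem px).
  rewrite (wprod_foldl_unit eu); last first.
    by rewrite -size_eq0 size_map (perm_size px) size_eq0.
  rewrite (@foldl_unit F A e eu e _ r (fun j => [|| j == k, j == l | ty j != sym0])); last first.
    by move=> j; rewrite !negb_or negbK /r => /and3P [/negbTE -> /negbTE -> ->].
  rewrite (eq_in_filter (a2 := fun j => (j == k) || (j == l))); last first.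
    move=> j; rewrite (perm_mem px) => jw; have := h j jw.
    by case: (j == k); case: (j == l) => //= ->.
  rewrite filter2_before // ?(perm_uniq px) // (beforeC kx kl).
  have rk : r k = u by rewrite /r eqxx.
  have rl : r l = v by rewrite /r eqxx eq_sym (negbTE kl).
  by case: before; rewrite /= rk rl (eu _).1 ?mulr1 ?mulr0 scale0r ?addr0 ?add0r.
(* The superinvolution turns [E] into the relation with $uv$ and $vu$ exchanged; on adding
   [(-1) ^+ eps] times the latter to [E], the atom [pmul eps u v] factors out. *)
have := congr1 (@star F A) E.
rewrite starD !starZ star0 (star_typedM tu tv) (star_typedM tv tu).
have -> : swap_sign p2 p1 = swap_sign p1 p2.
  by rewrite /swap_sign andbC addbAC.
rewrite !scalerA ![_ * (-1) ^+ _]mulrC -!scalerA -scalerDr => /eqP.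
rewrite scaler_eq0 signr_eq0 /= => /eqP E'.
have : (bsum k l g + (-1) ^+ eps * bsum l k g) *: pmul eps u v = 0.
  have := congr2 +%R E (congr1 ( *:%R ((-1) ^+ eps)) E').
  rewrite scaler0 addr0 => <-.
  rewrite /pmul !scalerDr !scalerDl !scalerA.
  have -> : (-1) ^+ eps * bsum l k g * (-1) ^+ eps = bsum l k g :> F.
    by rewrite mulrAC -signr_addb addbb mul1r.
  by rewrite [bsum k l g * _]mulrC [LHS](AC (2*2) ((1*4)*(3*2))).
by move=> /eqP; rewrite scaler_eq0 (negbTE uv) orbF => /eqP.
Qed.

End UnitalConditions.

(** * Consequences of the identities of a model *)

Definition others (i j : nat) (w : seq nat) := [seq k <- w | (k != i) && (k != j)].

Lemma perm_others i j w : uniq w -> i \in w -> j \in w -> i != j ->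
  perm_eq [:: i, j & others i j w] w.
Proof.
move=> uw iw jw ij; apply: uniq_perm => //.
  by rewrite /= !inE !mem_filter filter_uniq // !eqxx !andbF orbF ij.
move=> k; rewrite !inE mem_filter.
by case: (eqVneq k i) => [->|_]; rewrite ?iw //; case: (eqVneq k j) => [->|].
Qed.

Section SubVariety.
Variables (F : fieldType) (p1 p2 : vtype) (eps : bool).
Hypothesis char2 : 2%:R != 0 :> F.
Hypothesis valid : valid_atom p1 p2 eps.
Variables (B : starAlg F) (e : B) (J : B -> Prop).
Hypothesis M : model p1 p2 eps e J.
Variable C : starAlg F.
Hypothesis BC : variety B C.

Notation sg := ((-1) ^+ eps : F).
Notation rel := (relevant p1 p2).

Implicit Types (g : seq (F * seq nat)) (w : seq nat) (ty : nat -> vtype).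

Lemma sgK : sg * sg = 1.
Proof. by rewrite -signr_addb addbb. Qed.

Lemma variety_check ty w0 g : uniq w0 ->
  (forall x, x \in g -> perm_eq x.2 w0) -> w0 != [::] ->
  condL p1 p2 eps ty w0 g -> condP p1 p2 eps ty w0 g -> gident C ty g.
Proof.
move=> uw pg nw cL cP.
apply: (gident_variety _ BC); last exact: (check_model char2 valid M uw pg nw cL cP).
by move=> x /pg px; rewrite -size_eq0 (perm_size px) size_eq0.
Qed.

Definition pairsum i j g : F := bsum i j g + sg * bsum j i g.

(** Twice [g] minus [pairsum i j g] times the atom in $x_i$, $x_j$ followed by the other letters
    satisfies [condL] and [condP]; so it vanishes on [B], hence on [C]. The factor 2 is the pair sum
    $1+(\pm1)^2$ of that product. *)
Lemma variety_eval ty w0 g i j (r : nat -> C) : uniq w0 ->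
  (forall x, x \in g -> perm_eq x.2 w0) -> rel ty w0 i j ->
  condL p1 p2 eps ty w0 g ->
  (forall k l, rel ty w0 k l -> (k, l) != (i, j) -> (k, l) != (j, i) ->
    pairsum k l g = 0) ->
  assignment ty r ->
  2%:R *: geval r g =
  pairsum i j g *: foldl (@amul F C) (pmul eps (r i) (r j)) (map r (others i j w0)).
Proof.
move=> uw pg rij cL cP hr.
have /and5P [iw jw ij /eqP ti /andP [/eqP tj /allP h]] := rij.
set P := pairsum i j g; set w1 := [:: i, j & others i j w0].
set w2 := [:: j, i & others i j w0].
have pw1 : perm_eq w1 w0 by apply: perm_others.
have pw2 : perm_eq w2 w0.
  by rewrite -(permPr pw1); apply/permPl/(perm_catCA [:: j] [:: i]).
have nw : w0 != [::] by case: w0 iw {uw pg rij cL cP jw h P w1 w2 pw1 pw2}.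
pose g' := gmap 2%:R id g ++ [:: (- P, w1); (- (P * sg), w2)].
have pg' x : x \in g' -> perm_eq x.2 w0.
  rewrite mem_cat => /orP [/mapP [y /pg py ->] //|].
  by rewrite !inE => /orP [] /eqP ->.
have c' : csum g' = 2%:R * csum g - P * (1 + sg).
  by rewrite csum_cat csum_map !csum_cons csum_nil /=; ring.
have b' k l : bsum k l g' = 2%:R * bsum k l g - P * (before k l w1)%:R
    - P * sg * (before k l w2)%:R.
  by rewrite bsum_cat bsum_map !bsum_cons bsum_nil /= -/(bsum k l g); ring.
have cL' : condL p1 p2 eps ty w0 g'.
  move=> n1 tw; rewrite c' (cL n1 tw) mulr0 sub0r.
  (* For the commutator the coefficients of the two added words cancel; for the anticommutator
     [pairsum i j g] is [csum g], which is zero. *)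
  case E : eps; first by rewrite expr1 subrr mulr0 oppr0.
  rewrite /P /pairsum E expr0 mul1r (bsumC ij iw pg) (cL n1 tw).
  by rewrite sub0r subrr mul0r oppr0.
have ji : (j == i) = false by rewrite eq_sym (negbTE ij).
have o1 : before i j w1 by rewrite !before_cons (negbTE ij) eqxx.
have o2 : before j i w1 = false by rewrite !before_cons eqxx.
have o3 : before i j w2 = false by rewrite !before_cons eqxx.
have o4 : before j i w2 by rewrite !before_cons ji eqxx.
have cP' : condP p1 p2 eps ty w0 g'.
  move=> k l rkl; rewrite !b'.
  have [E|/eqP E1] := (k, l) =P (i, j).
    case: E => -> ->; rewrite o1 o2 o3 o4.
    rewrite /= mulr1 !mulr0 mulr1 /P /pairsum.
    by case: (eps); rewrite ?expr0 ?expr1; ring.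
  have [E|/eqP E2] := (k, l) =P (j, i).
    case: E => -> ->; rewrite o1 o2 o3 o4.
    rewrite /= !mulr1 !mulr0 /P /pairsum.
    by case: (eps); rewrite ?expr0 ?expr1; ring.
  have kl : k != l by case/and5P: rkl.
  have kw : k \in w0 by case/and5P: rkl.
  have kw2 : k \in w2 by rewrite (perm_mem pw2).
  have kl1 : before k l w1 = before k l w2 by apply: (@before_swap _ _ _ _ [::]).
  have kl2 : before l k w1 = before l k w2.
    apply: (@before_swap _ _ _ _ [::]) => //; rewrite xpair_eqE andbC;
    by rewrite -xpair_eqE.
  have := cP _ _ rkl E1 E2; rewrite /pairsum => Pkl.
  rewrite kl1 kl2 (beforeC kw2 kl).
  (* For the anticommutator neither type is [sym0], so the letters $i$ and $j$ form the only
     relevant pair. For the commutator [w1] and [w2] order $k$ and $l$ alike, and their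
     contributions cancel. *)
  case He : eps; last first.
    have [kk ll] : k \in [:: i; j] /\ l \in [:: i; j].
      have n1 : p1 != sym0 by apply/eqP => /(valid_eps valid); rewrite He.
      have n2 : p2 != sym0 by apply/eqP => /(valid_sym0 valid) /(valid_eps valid); rewrite He.
      have /and5P [_ lw _ /eqP tk /andP [/eqP tl _]] := rkl.
      have := h k kw; have := h l lw; rewrite tk tl (negbTE n1) (negbTE n2).
      by rewrite !inE !orbF.
    move: E1 E2 kk ll kl; rewrite !inE !xpair_eqE => E1 E2 /orP [] /eqP ? /orP [] /eqP ?;
      subst; move: E1 E2; rewrite ?eqxx //=.
  have s1 : sg = -1 by rewrite He expr1.
  move: Pkl; rewrite s1 mulN1r => /eqP; rewrite subr_eq0 => /eqP ->.
  by case: before => /=; rewrite ?mulr1 ?mulr0; ring.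
have := variety_check uw pg' nw cL' cP' hr.
rewrite geval_cat geval_map !geval_cons geval_nil /= addr0 => /eqP.
rewrite addr_eq0 => /eqP; rewrite /geval => ->.
by rewrite !scaleNr opprD !opprK /pmul foldl_amulD foldl_amulZ scalerDr scalerA.
Qed.

End SubVariety.

(** * Derivatives in the direction of the unit *)

Lemma fresh_letter (w : seq nat) : exists n, forall k, k \in w -> (k < n)%N.
Proof.
elim: w => [|x w [n H]]; first by exists 0%N.
exists (maxn x.+1 n) => k; rewrite inE leq_max => /orP [/eqP ->|/H ->].
  by rewrite leqnn.
by rewrite orbT.
Qed.

Section Delta.
Variable F : fieldType.
Implicit Types (g : seq (F * seq nat)) (w : seq nat) (ty : nat -> vtype).

(* For a multilinear [g(x_i, ...)], this is [g(x_i b + b x_i) - 2 g(x_i) b]: in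
   a possibly nonunital algebra it plays the part of the derivative of [g] with
   respect to [x_i] in the direction of the unit. *)
Definition delta b i g := gmap 1 (insa b i) g ++ gmap 1 (insb b i) g ++
  gmap (- 2%:R) (rcons^~ b) g.

Lemma csum_delta b i g : csum (delta b i g) = 0.
Proof. by rewrite !csum_cat !csum_map; ring. Qed.

Section DeltaPerm.
Variables (b i : nat) (w0 : seq nat) (g : seq (F * seq nat)).
Hypotheses (uw : uniq w0) (pg : forall x, x \in g -> perm_eq x.2 w0).
Hypotheses (iw : i \in w0) (bw : b \notin w0).

Lemma perm_delta x : x \in delta b i g -> perm_eq x.2 (b :: w0).
Proof.
rewrite !mem_cat => /or3P [] /mapP [y yg -> /=]; have py := pg yg.
- apply: perm_trans (perm_insa _ _ _) _; rewrite ?(perm_uniq py) ?(perm_mem py) //.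
  by rewrite perm_cons.
- apply: perm_trans (perm_insb _ _ _) _; rewrite ?(perm_uniq py) ?(perm_mem py) //.
  by rewrite perm_cons.
- by rewrite perm_rcons perm_cons.
Qed.

Lemma bsum_delta k l : bsum k l (delta b i g) =
  \sum_(x <- g) x.1 * ((before k l (insa b i x.2))%:R + (before k l (insb b i x.2))%:R
    - 2%:R * (before k l (rcons x.2 b))%:R).
Proof.
rewrite !bsum_cat !bsum_map !mulr_sumr -!big_split /=; apply: eq_bigr => x _.
ring.
Qed.

(** This is what the subtracted words are for: the two insertions do not change the order of the old
    letters, and contribute exactly twice the original. *)
Lemma bsum_delta_old k l : k \in w0 -> l \in w0 -> bsum k l (delta b i g) = 0.
Proof.
move=> kw lw; rewrite bsum_delta big1_seq // => x /andP [_ /pg px].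
have nb j : j \in w0 -> j != b by apply: contraTneq => ->.
rewrite before_insa ?nb // before_insb ?nb // before_rcons ?(perm_mem px) //.
by rewrite mulr_natl mulr2n subrr mulr0.
Qed.

(** In both insertions $b$ stands next to $i$, on the same side of $l$; in the subtracted words it
    is last and precedes nothing. *)
Lemma bsum_delta_new l : l \in w0 -> l != i -> bsum b l (delta b i g) = 2%:R * bsum i l g.
Proof.
move=> lw li; rewrite bsum_delta /bsum mulr_sumr; apply: eq_big_seq => x /pg px.
have lb : l != b by apply: contraTneq lw => ->.
rewrite before_insa_l ?before_insb_l ?(perm_mem px) //.
rewrite before_rcons2 ?(perm_mem px) //=; ring.
Qed.

Lemma bsum_delta_i : bsum b i (delta b i g) = csum g.
Proof.
rewrite bsum_delta /csum; apply: eq_big_seq => x /pg px.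
have ib : i != b by apply: contraTneq iw => ->.
rewrite before_insb_i ?before_rcons2 ?(perm_mem px) //.
have ix : i \in x.2 by rewrite (perm_mem px).
rewrite (@beforeC i b) ?before_insa_i ?(perm_mem px) //=; first by ring.
rewrite (perm_mem (perm_insa _ _ _)) ?(perm_uniq px) //.
by rewrite inE ix orbT.
Qed.

Lemma bsum_deltaC l : l \in w0 -> bsum l b (delta b i g) = - bsum b l (delta b i g).
Proof.
move=> lw; rewrite (@bsumC _ b l (b :: w0)) ?mem_head ?csum_delta ?sub0r //.
  by apply: contraNneq bw => ->.
exact: perm_delta.
Qed.

End DeltaPerm.

Lemma gident_ext (A : starAlg F) ty w0 g (r : nat -> A) :
  (forall x, x \in g -> perm_eq x.2 w0) -> gident A ty g ->
  (forall k, k \in w0 -> typed (ty k) (r k)) -> geval r g = 0.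
Proof.
move=> pg id hr; pose r' k := if k \in w0 then r k else 0.
have <- : geval r' g = 0.
  apply: id => k; rewrite /r'; case: ifP => [/hr //|_]; exact: typed0.
apply: eq_big_seq => x /pg px; congr (_ *: wprod _).
by apply/eq_in_map => k; rewrite (perm_mem px) /r' => ->.
Qed.

(** This is why the direction of the unit is probed with $xb+bx$: neither product alone need be
    symmetric or skew. *)
Lemma typed_anticomm (A : starAlg F) t (a b : A) : typed t a -> typed sym0 b ->
  typed t (pmul false a b).
Proof.
move=> ta tb; have := typed_pmul false ta tb.
by case: t {ta} => i s; rewrite /ptype /swap_sign /= !addbF andbF.
Qed.

Lemma wprod_pmul_ins (A : starAlg F) eps b i w (r r' : nat -> A) : uniq w -> i \in w ->
  (forall k, k != i -> r' k = r k) -> r' i = pmul eps (r i) (r b) ->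
  wprod (map r' w) = wprod (map r (insa b i w)) + (-1) ^+ eps *: wprod (map r (insb b i w)).
Proof.
move=> uw iw rk ri; have [w1 [w2 [E i1 i2 -> ->]]] := insE b uw iw.
have off v : i \notin v -> map r' v = map r v.
  move=> iv; apply/eq_in_map => k kv; apply: rk; by apply: contraNneq iv => <-.
by rewrite E !map_cat /= !off // ri wprod_pmul.
Qed.

Lemma gident_delta (A : starAlg F) ty w0 g b i :
  uniq w0 -> (forall x, x \in g -> perm_eq x.2 w0) -> i \in w0 -> b \notin w0 ->
  ty b = sym0 -> gident A ty g -> gident A ty (delta b i g).
Proof.
move=> uw pg iw bw tb id r hr.
rewrite !geval_cat !geval_map !scale1r.
have rb : typed sym0 (r b) by rewrite -tb.
have -> : \sum_(x <- g) x.1 *: wprod (map r (rcons x.2 b)) = amul (geval r g) (r b).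
  rewrite amul_suml; apply: eq_big_seq => x /pg px.
  rewrite map_rcons wprod_rcons ?amulZl // -size_eq0 size_map (perm_size px) size_eq0.
  by case: w0 iw {uw pg bw px}.
rewrite (id r hr) amul0l scaler0 addr0 -big_split /=.
pose r' k := if k == i then pmul false (r i) (r b) else r k.
rewrite -[RHS](id r').
  apply: eq_big_seq => x /pg px; rewrite -scalerDr; congr (_ *: _).
  rewrite (@wprod_pmul_ins _ false b i x.2 r r') ?(perm_uniq px) ?(perm_mem px) //.
  - by rewrite expr0 scale1r.
  - by move=> k /negbTE ki; rewrite /r' ki.
  - by rewrite /r' eqxx.
move=> k; rewrite /r'; case: eqP => [->|_ //].
exact: typed_anticomm.
Qed.

End Delta.

(** * Identities of a proper subvariety *)

Section Vanish.
Variables (F : fieldType) (p1 p2 : vtype) (eps : bool).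
Hypothesis char2 : 2%:R != 0 :> F.
Hypothesis valid : valid_atom p1 p2 eps.
Variables (B : starAlg F) (e : B) (J : B -> Prop).
Hypothesis M : model p1 p2 eps e J.
Variable C : starAlg F.
Hypothesis BC : variety B C.

Notation sg := ((-1) ^+ eps : F).
Notation rel := (relevant p1 p2).

Implicit Types (g : seq (F * seq nat)) (w : seq nat) (ty : nat -> vtype).

Definition vanishes (m : nat) : Prop := forall (u v : C) (l : seq C),
  typed p1 u -> typed p2 v -> size l = m -> (forall a, a \in l -> typed sym0 a) ->
  foldl (@amul F C) (pmul eps u v) l = 0.

(** In the presence of a relevant pair, [condL] is void unless [p1] is [sym0], since otherwise both
    letters of the pair lie outside $A_0^+$. *)
Lemma relevant_condL ty w0 i j g : rel ty w0 i j ->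
  (p1 = sym0 -> csum g = 0) -> condL p1 p2 eps ty w0 g.
Proof.
move=> /and5P [iw jw ij /eqP ti /andP [/eqP tj _]] c0 n1 _.
apply: c0; apply/eqP; apply: contraTT n1 => n1.
rewrite -ltnNge /nonsym0 -size_filter.
have /uniq_leq_size : uniq [:: i; j] by rewrite /= inE ij.
apply=> k; rewrite !inE mem_filter => /orP [] /eqP ->.
  by rewrite ti n1.
rewrite tj jw andbT; apply/eqP => /(valid_sym0 valid) e1.
by rewrite e1 eqxx in n1.
Qed.

Lemma relevant_unique ty w0 i j k l : p1 != sym0 -> rel ty w0 i j -> rel ty w0 k l ->
  (k, l) = (i, j) \/ (k, l) = (j, i).
Proof.
move=> n1 /and5P [iw jw ij /eqP ti /andP [/eqP tj /allP h]].
move=> /and5P [kw lw kl /eqP tk /andP [/eqP tl _]].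
have n2 : p2 != sym0.
  by apply/eqP => /(valid_sym0 valid) e1; rewrite e1 eqxx in n1.
have := h k kw; have := h l lw; rewrite tk tl (negbTE n1) (negbTE n2) !orbF.
move=> /orP [] /eqP e2 /orP [] /eqP e3; move: kl; rewrite e2 e3 ?eqxx // => _; by [left|right].
Qed.

(** For an identity of [C] the left side of [variety_eval] is zero, and dividing by the pair sum
    leaves the atom followed by the remaining letters. Other pairs can be relevant only if [p1] is
    [sym0]; the condition that they do not contribute is then written for the commutator, the only
    valid sign. *)
Lemma pairsum_vanishes ty w0 g i j : uniq w0 ->
  (forall x, x \in g -> perm_eq x.2 w0) -> rel ty w0 i j ->
  (p1 = sym0 -> csum g = 0) ->
  (p1 = sym0 -> forall k l, rel ty w0 k l -> (k, l) != (i, j) -> (k, l) != (j, i) ->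
    bsum k l g = bsum l k g) ->
  gident C ty g -> pairsum eps i j g != 0 -> vanishes (size (others i j w0)).
Proof.
move=> uw pg rij c0 oth id P0 u v l tu tv sl tl.
have cL := relevant_condL rij c0.
have /and5P [iw jw ij /eqP ti /andP [/eqP tj /allP h]] := rij.
pose r k := if k == i then u else if k == j then v else nth 0 l (index k (others i j w0)).
have tr k : k \in w0 -> typed (ty k) (r k).
  move=> kw; rewrite /r; case: eqP => [->|/eqP ki]; first by rewrite ti.
  case: eqP => [->|/eqP kj]; first by rewrite tj.
  have := h k kw; rewrite (negbTE ki) (negbTE kj) /= => /eqP ->; apply: tl.
  by rewrite mem_nth // sl index_mem mem_filter ki kj.
pose r' k := if k \in w0 then r k else 0.
have hr' : assignment ty r'.
  by move=> k; rewrite /r'; case: ifP => [/tr //|_]; apply: typed0.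
have oth' k k' : rel ty w0 k k' -> (k, k') != (i, j) -> (k, k') != (j, i) ->
    pairsum eps k k' g = 0.
  move=> rk n1 n2; have [e1|/eqP e1] := p1 =P sym0; last first.
    by have [E|E] := relevant_unique e1 rij rk; rewrite E eqxx in n1 n2.
  by rewrite /pairsum (oth e1 _ _ rk) // (valid_eps valid e1) expr1 mulN1r subrr.
have := variety_eval char2 valid M BC uw pg rij cL oth' hr'.
rewrite (id r' hr') scaler0 => /esym/eqP; rewrite scaler_eq0 (negbTE P0) /=.
have -> : r' i = u by rewrite /r' iw /r eqxx.
have -> : r' j = v by rewrite /r' jw /r [j == i]eq_sym (negbTE ij) eqxx.
move=> /eqP <-; congr foldl.
apply: (@eq_from_nth _ 0); first by rewrite size_map sl.
rewrite sl => n ln; rewrite (nth_map 0%N) //; set k := nth 0%N _ _.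
have : k \in others i j w0 by rewrite mem_nth.
rewrite mem_filter => /andP [/andP [ki kj] kw].
rewrite /r' kw /r (negbTE ki) (negbTE kj).
by rewrite /k index_uniq // filter_uniq.
Qed.

Section Detect.
Variables (ty : nat -> vtype) (w0 : seq nat) (g : seq (F * seq nat)).
Hypotheses (uw : uniq w0) (nw : w0 != [::]).
Hypothesis pg : forall x, x \in g -> perm_eq x.2 w0.
Hypothesis id : gident C ty g.
Hypothesis nv : forall m, ~ vanishes m.

(** The tool of this section: each coefficient sum of [g] to be annihilated is made, up to a nonzero
    factor, the pair sum of a new identity of [C] in which no other relevant pair contributes. *)
Lemma pairsum0 ty' w0' g' i j : uniq w0' ->
  (forall x, x \in g' -> perm_eq x.2 w0') -> rel ty' w0' i j ->
  (p1 = sym0 -> csum g' = 0) ->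
  (p1 = sym0 -> forall k l, rel ty' w0' k l -> (k, l) != (i, j) -> (k, l) != (j, i) ->
    bsum k l g' = bsum l k g') ->
  gident C ty' g' -> pairsum eps i j g' = 0.
Proof.
move=> uw' pg' rij c0 oth id'; apply/eqP; apply: contrapT => /negP P0.
exact: (nv (pairsum_vanishes uw' pg' rij c0 oth id' P0)).
Qed.

Lemma sum_eq0_of_pairsum (a : F) i j g' : bsum i j g' + sg * bsum j i g' = 2%:R * a ->
  pairsum eps i j g' = 0 -> a = 0.
Proof.
rewrite /pairsum => -> /eqP; rewrite mulf_eq0 (negbTE char2) /=.
by move=> /eqP.
Qed.

Lemma wprod_word_cons x (r : nat -> C) u : x \in g ->
  wprod (map r (u :: x.2)) = amul (r u) (wprod (map r x.2)).
Proof.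
move=> /pg px; rewrite /= -[foldl _ _ _]/(wprod (r u :: map r x.2)) wprod_cons //.
by rewrite -size_eq0 size_map (perm_size px) size_eq0.
Qed.

Lemma wprod_word_rcons x (r : nat -> C) u : x \in g ->
  wprod (map r (rcons x.2 u)) = amul (wprod (map r x.2)) (r u).
Proof.
move=> /pg px; rewrite map_rcons wprod_rcons //.
by rewrite -size_eq0 size_map (perm_size px) size_eq0.
Qed.

Lemma bsum_all k l h : (forall x, x \in g -> before k l (h x.2)) ->
  \sum_(x <- g) x.1 * (before k l (h x.2))%:R = csum g.
Proof. by move=> H; apply: eq_big_seq => x /H ->; rewrite mulr1. Qed.

Lemma bsum_none k l h : (forall x, x \in g -> before k l (h x.2) = false) ->
  \sum_(x <- g) x.1 * (before k l (h x.2))%:R = 0.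
Proof. by move=> H; rewrite big1_seq // => x /andP [_ /H ->]; rewrite mulr0. Qed.

(** Multiplying [g] on the left by the atom in two fresh letters gives an identity whose pair sum at
    these letters is [2 * csum g]. For the commutator its two halves order all other pairs alike and
    cancel there. *)
Lemma csum0_even : all (fun k => ty k == sym0) w0 -> csum g = 0.
Proof.
move=> /allP te; have [n fn] := fresh_letter w0.
have nw0 : n \notin w0 by apply/negP => /fn; rewrite ltnn.
have nw1 : n.+1 \notin w0 by apply/negP => /fn /ltnW; rewrite ltnn.
have n01 : n != n.+1 by rewrite neq_ltn ltnSn.
have kn k : k \in w0 -> ((k == n) = false) * ((k == n.+1) = false).
  by move=> kw; split; apply/negbTE; apply: contraTneq kw => ->.
pose ty' k := if k == n then p1 else if k == n.+1 then p2 else ty k.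
pose g' := gmap 1 (fun w => [:: n, n.+1 & w]) g ++ gmap sg (fun w => [:: n.+1, n & w]) g.
have uw' : uniq [:: n, n.+1 & w0] by rewrite /= inE (negbTE n01) nw0 nw1.
have pg' x : x \in g' -> perm_eq x.2 [:: n, n.+1 & w0].
  rewrite mem_cat => /orP [] /mapP [y /pg py ->] /=; first by rewrite !perm_cons.
  rewrite -[[:: n.+1, n & _]]/([:: n.+1] ++ [:: n] ++ y.2) perm_catCA.
  by rewrite !perm_cons.
have tn : ty' n = p1 by rewrite /ty' eqxx.
have tn1 : ty' n.+1 = p2 by rewrite /ty' [n.+1 == n]eq_sym (negbTE n01) eqxx.
have tk k : k \in w0 -> ty' k = ty k by move=> kw; rewrite /ty' !kn.
have rij : rel ty' [:: n, n.+1 & w0] n n.+1.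
  apply/and5P; split; rewrite ?mem_head ?n01 ?tn ?tn1 //.
    by rewrite !inE eqxx orbT.
  rewrite eqxx; apply/allP => k; rewrite !inE => /or3P [->//|->|kw].
    by rewrite orbT.
  by rewrite tk // te // !orbT.
have id' : gident C ty' g'.
  move=> r hr; rewrite geval_cat !geval_map scale1r.
  have -> : \sum_(x <- g) x.1 *: wprod (map r [:: n, n.+1 & x.2]) =
      amul (amul (r n) (r n.+1)) (geval r g).
    rewrite amul_sumr; apply: eq_big_seq => x xg; rewrite amulZr; congr (_ *: _).
    by rewrite -amulA -wprod_word_cons // -[RHS]wprod_cons.
  have -> : \sum_(x <- g) x.1 *: wprod (map r [:: n.+1, n & x.2]) =
      amul (amul (r n.+1) (r n)) (geval r g).
    rewrite amul_sumr; apply: eq_big_seq => x xg; rewrite amulZr; congr (_ *: _).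
    by rewrite -amulA -wprod_word_cons // -[RHS]wprod_cons.
  rewrite (gident_ext pg id) ?amul0r ?scaler0 ?addr0 // => k kw.
  by have := hr k; rewrite /ty' !kn.
apply: (@sum_eq0_of_pairsum _ n n.+1 g').
  rewrite !bsum_cat !bsum_map.
  rewrite (bsum_all (k := n) (l := n.+1) (h := fun w => [:: n, n.+1 & w])); last first.
    by move=> x _; rewrite before_cons (negbTE n01) eqxx.
  rewrite (bsum_none (k := n) (l := n.+1) (h := fun w => [:: n.+1, n & w])); last first.
    by move=> x _; rewrite before_cons eqxx.
  rewrite (bsum_none (k := n.+1) (l := n) (h := fun w => [:: n, n.+1 & w])); last first.
    by move=> x _; rewrite before_cons eqxx.
  rewrite (bsum_all (k := n.+1) (l := n) (h := fun w => [:: n.+1, n & w])); last first.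
    by move=> x _; rewrite before_cons [n.+1 == n]eq_sym (negbTE n01) eqxx.
  by rewrite !mulr0 addr0 add0r mulrA sgK !mul1r mulr_natl.
apply: (pairsum0 uw' pg' rij _ _ id').
  by move=> /(valid_eps valid) ep; rewrite csum_cat !csum_map ep expr1 -mulrDl addrN mul0r.
move=> /(valid_eps valid) ep k l _ E1 E2.
have Z k' l' : (k', l') != (n, n.+1) -> (k', l') != (n.+1, n) -> bsum k' l' g' = 0.
  move=> F1 F2; rewrite bsum_cat !bsum_map ep expr1 mul1r mulN1r; apply/eqP.
  rewrite subr_eq0; apply/eqP; apply: eq_bigr => x _.
  by rewrite (@before_swap _ _ _ _ [::]).
by rewrite !Z // xpair_eqE andbC -xpair_eqE.
Qed.


Section OneOdd.
Variable z : nat.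
Hypotheses (zw : z \in w0) (tz : ty z != sym0) (n1 : (nonsym0 ty w0 <= 1)%N).

Lemma one_odd k : k \in w0 -> k != z -> ty k = sym0.
Proof.
move=> kw kz; apply/eqP; apply: contraTT n1 => tk; rewrite -ltnNge.
have : uniq [:: k; z] by rewrite /= inE kz.
rewrite /nonsym0 -size_filter => /uniq_leq_size; apply.
by move=> y; rewrite !inE mem_filter => /orP [] /eqP ->; apply/andP.
Qed.

(** The letter $z$ has the type of the atom, so the atom in $x_z$ and a fresh letter $x_n$ may be
    substituted for it; the pair sum at $z$, $n$ is then [2 * csum g]. *)
Lemma csum0_ptype : ty z = ptype eps p1 p2 -> csum g = 0.
Proof.
move=> tzp; have [n fn] := fresh_letter w0.
have nw0 : n \notin w0 by apply/negP => /fn; rewrite ltnn.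
have kn k : k \in w0 -> (k == n) = false.
  by move=> kw; apply/negbTE; apply: contraTneq kw => ->.
pose ty' k := if k == z then p1 else if k == n then p2 else ty k.
pose g' := gmap 1 (insa n z) g ++ gmap sg (insb n z) g.
have uw' : uniq (n :: w0) by rewrite /= nw0.
have pg' x : x \in g' -> perm_eq x.2 (n :: w0).
  rewrite mem_cat => /orP [] /mapP [y /pg py ->] /=.
    apply: perm_trans (perm_insa _ _ _) _; rewrite ?(perm_uniq py) ?(perm_mem py) //.
    by rewrite perm_cons.
  apply: perm_trans (perm_insb _ _ _) _; rewrite ?(perm_uniq py) ?(perm_mem py) //.
  by rewrite perm_cons.
have zn := kn z zw.
have tz' : ty' z = p1 by rewrite /ty' eqxx.
have tn' : ty' n = p2 by rewrite /ty' eq_sym zn eqxx.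
have rij : rel ty' (n :: w0) z n.
  apply/and5P; split; rewrite ?mem_head ?tz' ?tn' ?zn //.
    by rewrite inE zw orbT.
  rewrite eqxx; apply/allP => k; rewrite !inE => /orP [->//|kw].
    by rewrite orbT.
  rewrite (kn k kw); have [//|kz] := eqVneq k z.
  by rewrite /ty' (negbTE kz) (kn k kw) one_odd.
have id' : gident C ty' g'.
  move=> r hr; rewrite geval_cat !geval_map scale1r scaler_sumr -big_split /=.
  pose r' k := if k == z then pmul eps (r z) (r n) else r k.
  rewrite -[RHS](gident_ext (r := r') pg id).
    apply: eq_big_seq => x /pg px; rewrite scalerA mulrC -scalerA -scalerDr; congr (_ *: _).
    rewrite (@wprod_pmul_ins _ _ eps n z x.2 r r') ?(perm_uniq px) ?(perm_mem px) //.
      by move=> k /negbTE kz; rewrite /r' kz.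
    by rewrite /r' eqxx.
  move=> k kw; rewrite /r'; case: eqP => [->|/eqP kz].
    by rewrite tzp -tz' -tn'; apply: typed_pmul.
  by have := hr k; rewrite /ty' (negbTE kz) (kn k kw).
have bz x : x \in g -> [/\ before z n (insa n z x.2), before n z (insa n z x.2) = false,
    before n z (insb n z x.2) & before z n (insb n z x.2) = false].
  move=> /pg px; have zx : z \in x.2 by rewrite (perm_mem px).
  have nx : n \notin x.2 by rewrite (perm_mem px).
  have ux : uniq x.2 by rewrite (perm_uniq px).
  have H1 := before_insa_i zx nx; have H2 := before_insb_i zx nx.
  split=> //.
    rewrite (@beforeC z n) ?H1 ?zn //.
    by rewrite (perm_mem (perm_insa _ ux zx)) inE zx orbT.
  rewrite (@beforeC n z) ?H2 1?eq_sym ?zn //.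
  by rewrite (perm_mem (perm_insb _ ux zx)) inE eqxx.
apply: (@sum_eq0_of_pairsum _ z n g').
  rewrite !bsum_cat !bsum_map.
  rewrite (bsum_all (k := z) (l := n) (h := insa n z)); last by move=> x /bz [].
  rewrite (bsum_none (k := z) (l := n) (h := insb n z)); last by move=> x /bz [].
  rewrite (bsum_none (k := n) (l := z) (h := insa n z)); last by move=> x /bz [].
  rewrite (bsum_all (k := n) (l := z) (h := insb n z)); last by move=> x /bz [].
  by rewrite !mulr0 addr0 add0r mulrA sgK !mul1r mulr_natl.
apply: (pairsum0 uw' pg' rij _ _ id').
  by move=> /(valid_eps valid) ep; rewrite csum_cat !csum_map ep expr1 -mulrDl addrN mul0r.
move=> /(valid_eps valid) ep k l _ E1 E2.
have Z k' l' : (k', l') != (z, n) -> (k', l') != (n, z) -> bsum k' l' g' = 0.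
  move=> F1 F2; rewrite bsum_cat !bsum_map ep expr1 mul1r mulN1r; apply/eqP.
  rewrite subr_eq0; apply/eqP; apply: eq_big_seq => x /pg px.
  have [w1 [w2 [_ _ _ -> ->]]] := @insE n z x.2
    (etrans (perm_uniq px) uw) (etrans (perm_mem px z) zw).
  by rewrite before_swap // zn.
by rewrite !Z // xpair_eqE andbC -xpair_eqE.
Qed.

(** A fresh letter $x_n$ supplies the missing factor of the atom: in $x_ng\pm gx_n$ it precedes $z$
    in one half and follows it in the other. The boolean tells which of the two factors $z$ is. *)
Lemma csum0_side (s1 : bool) : ty z = (if s1 then p2 else p1) -> csum g = 0.
Proof.
move=> tzp; have [n fn] := fresh_letter w0.
have nw0 : n \notin w0 by apply/negP => /fn; rewrite ltnn.
have kn k : k \in w0 -> (k == n) = false.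
  by move=> kw; apply/negbTE; apply: contraTneq kw => ->.
have zn := kn z zw.
pose ty' k := if k == n then if s1 then p1 else p2 else ty k.
pose g' := gmap 1 (cons n) g ++ gmap sg (rcons^~ n) g.
have uw' : uniq (n :: w0) by rewrite /= nw0.
have pg' x : x \in g' -> perm_eq x.2 (n :: w0).
  rewrite mem_cat => /orP [] /mapP [y /pg py ->] /=; rewrite ?perm_cons //.
  by rewrite perm_rcons perm_cons.
have tn' : ty' n = if s1 then p1 else p2 by rewrite /ty' eqxx.
have tz' : ty' z = if s1 then p2 else p1 by rewrite /ty' zn.
have tk k : k \in w0 -> ty' k = ty k by move=> kw; rewrite /ty' kn.
have ev : all (fun k => [|| k == n, k == z | ty' k == sym0]) (n :: w0).
  apply/allP => k; rewrite inE => /orP [->//|kw].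
  have [->|kz] := eqVneq k z; first by rewrite orbT.
  by rewrite tk // one_odd // eqxx !orbT.
have rij : if s1 then rel ty' (n :: w0) n z else rel ty' (n :: w0) z n.
  have zm : z \in n :: w0 by rewrite inE zw orbT.
  case: (s1) tn' tz' => tn' tz'; apply/and5P; split;
    rewrite ?mem_head ?zm ?tn' ?tz' ?zn // 1?eq_sym ?zn // eqxx //.
  by apply/allP => k /(allP ev); rewrite orbCA.
have id' : gident C ty' g'.
  move=> r hr; rewrite geval_cat !geval_map scale1r.
  have -> : \sum_(x <- g) x.1 *: wprod (map r (n :: x.2)) = amul (r n) (geval r g).
    rewrite amul_sumr; apply: eq_big_seq => x xg; rewrite amulZr; congr (_ *: _).
    by rewrite -wprod_word_cons.
  have -> : \sum_(x <- g) x.1 *: wprod (map r (rcons x.2 n)) = amul (geval r g) (r n).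
    rewrite amul_suml; apply: eq_big_seq => x xg; rewrite amulZl; congr (_ *: _).
    by rewrite -wprod_word_rcons.
  rewrite (gident_ext pg id) ?amul0l ?amul0r ?scaler0 ?addr0 // => k kw.
  by have := hr k; rewrite tk.
have b1 : bsum n z g' = csum g.
  rewrite bsum_cat !bsum_map (bsum_all (k := n) (l := z) (h := cons n)); last first.
    by move=> x _; rewrite before_cons eq_sym zn eqxx.
  rewrite (bsum_none (k := n) (l := z) (h := rcons^~ n)) ?mulr0 ?addr0 ?mul1r //.
  by move=> x /pg px; rewrite before_rcons2 ?(perm_mem px).
have b2 : bsum z n g' = sg * csum g.
  rewrite bsum_cat !bsum_map (bsum_none (k := z) (l := n) (h := cons n)); last first.
    by move=> x _; rewrite before_cons eqxx.
  rewrite (bsum_all (k := z) (l := n) (h := rcons^~ n)) ?mulr0 ?add0r //.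
  by move=> x /pg px; rewrite before_rcons1 ?(perm_mem px).
have c0 : p1 = sym0 -> csum g' = 0.
  by move=> /(valid_eps valid) ep; rewrite csum_cat !csum_map ep expr1 -mulrDl addrN mul0r.
have old k l : p1 = sym0 -> k \in w0 -> l \in w0 -> bsum k l g' = 0.
  move=> /(valid_eps valid) ep kw lw; rewrite bsum_cat !bsum_map ep expr1 mul1r mulN1r.
  apply/eqP; rewrite subr_eq0; apply/eqP; apply: eq_big_seq => x /pg px.
  rewrite before_rcons ?(perm_mem px) // before_cons.
  by rewrite eq_sym kn // eq_sym kn.
case: (s1) tzp tn' tz' rij {ev} => tzp tn' tz' rij.
  apply: (@sum_eq0_of_pairsum _ n z g').
    by rewrite b1 b2 mulrA sgK !mul1r mulr_natl.
  (* With [p1] equal to [sym0], the old letters may also form relevant pairs with $z$, but both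
     halves of $x_ng-gx_n$ order the old letters alike, so these pairs cancel. *)
  apply: (pairsum0 uw' pg' rij c0 _ id') => e1 k l rkl E1 E2.
  have n2 : p2 != sym0 by rewrite -tzp.
  have /and5P [kw lw kl /eqP tyk /andP [/eqP tyl _]] := rkl.
  have lz : l = z.
    move: lw; rewrite inE => /orP [/eqP ln|lw].
      by move: tyl; rewrite ln tn' e1 => e2; rewrite -e2 eqxx in n2.
    apply/eqP; apply: contraNT n2 => lz.
    by rewrite -tyl tk // one_odd.
  subst l; move: kw; rewrite inE => /orP [/eqP kn'|kw]; first by rewrite kn' eqxx in E1.
  by rewrite !old.
suff /eqP : sg * csum g = 0 by rewrite mulf_eq0 signr_eq0 => /eqP.
apply: (@sum_eq0_of_pairsum _ z n g').
  by rewrite b1 b2 mulr_natl.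
apply: (pairsum0 uw' pg' rij c0 _ id') => e1.
by move: tz; rewrite tzp e1.
Qed.

End OneOdd.

Lemma detect_condL : condL p1 p2 eps ty w0 g.
Proof.
move=> n1 /allP tw.
case: (boolP (has (fun k => ty k != sym0) w0)) => [/hasP [z zw tz]|]; last first.
  by rewrite -all_predC => h; apply: csum0_even; apply: sub_all h => k /=; rewrite negbK.
have := tw z zw; rewrite !inE (negbTE tz) /= => /or3P [] /eqP E.
- exact: (csum0_side zw tz n1 (s1 := false)).
- exact: (csum0_side zw tz n1 (s1 := true)).
- exact: (csum0_ptype zw tz n1).
Qed.

(** If [p1] is [sym0], several pairs can be relevant in [g], and [pairsum0] does not apply to it
    directly. One derivative, or two if [p2] is [sym0] as well, replaces one or both letters of the
    pair by fresh ones and annihilates the contributions of all other relevant pairs. *)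
Lemma detect_condP : condP p1 p2 eps ty w0 g.
Proof.
move=> k l rkl; have /and5P [kw lw kl /eqP tyk /andP [/eqP tyl /allP h]] := rkl.
have [e1|/eqP n1] := p1 =P sym0; last first.
  apply: (pairsum0 uw pg rkl _ _ id) => e1; by rewrite e1 eqxx in n1.
have ep := valid_eps valid e1.
have c0 : csum g = 0.
  by apply: detect_condL; [exact: relevant_nonsym0 uw rkl e1|exact: relevant_types rkl].
rewrite ep expr1 mulN1r (bsumC kl kw pg) c0 sub0r opprK -mulr2n -mulr_natl.
suff -> : bsum k l g = 0 by rewrite mulr0.
have [n fn] := fresh_letter w0.
have nw0 : n \notin w0 by apply/negP => /fn; rewrite ltnn.
have nw1 : n.+1 \notin w0 by apply/negP => /fn /ltnW; rewrite ltnn.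
have n01 : n != n.+1 by rewrite neq_ltn ltnSn.
have kn j : j \in w0 -> ((j == n) = false) * ((j == n.+1) = false).
  by move=> jw; split; apply/negbTE; apply: contraTneq jw => ->.
pose ty' j := if (j == n) || (j == n.+1) then sym0 else ty j.
have tn : ty' n = sym0 by rewrite /ty' eqxx.
have tn1 : ty' n.+1 = sym0 by rewrite /ty' eqxx orbT.
have tk j : j \in w0 -> ty' j = ty j by move=> jw; rewrite /ty' !kn.
have id0 : gident C ty' g.
  by move=> r hr; apply: (gident_ext pg id) => j jw; rewrite -tk.
pose g1 := delta n k g.
have uw1 : uniq (n :: w0) by rewrite /= nw0.
have pg1 x : x \in g1 -> perm_eq x.2 (n :: w0) by apply: perm_delta.
have id1 : gident C ty' g1 by apply: (gident_delta uw pg).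
have lk : l != k by rewrite eq_sym.
have b1 : bsum n l g1 = 2%:R * bsum k l g by apply: (bsum_delta_new pg).
have b2 : bsum l n g1 = - bsum n l g1 by apply: (bsum_deltaC uw pg).
have fin a i j g' : a * a != 0 -> bsum i j g' + sg * bsum j i g' = a * a * bsum k l g ->
    pairsum eps i j g' = 0 -> bsum k l g = 0.
  rewrite /pairsum => a0 -> /eqP; rewrite mulf_eq0 (negbTE a0) /=; by move/eqP.
have four : 2%:R * 2%:R != 0 :> F by rewrite mulf_neq0.
(* If only [p1] is [sym0], every relevant pair has $l$ as its second letter, and in [g1] the old
   letters contribute nothing against $l$; only the pair $n$, $l$ is left. *)
have [e2|/eqP n2] := p2 =P sym0; last first.
  have old j : ty' j = p2 -> j \in n :: w0 -> j = l.
    rewrite inE => tj /orP [/eqP jn|jw]; first by rewrite -tj jn tn in n2.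
    have := h j jw; rewrite -tk // tj (negbTE n2) orbF => /orP [] /eqP // jk.
    by move: n2; rewrite -tj tk // jk tyk e1.
  apply: (fin 2%:R n l g1) => //.
    by rewrite b2 b1 ep expr1; ring.
  apply: (pairsum0 uw1 pg1 _ _ _ id1).
  - apply/and5P; split; rewrite ?mem_head ?inE ?lw ?orbT ?tn ?e1 //.
      by rewrite eq_sym kn.
    rewrite tk // tyl eqxx; apply/allP => j; rewrite inE => /orP [->//|jw].
    have := h j jw; rewrite -tk // => /or3P [/eqP ->|->|->]; rewrite ?orbT //.
    by rewrite tk // tyk e1 eqxx !orbT.
  - by move=> _; rewrite csum_delta.
  - move=> _ i j /and5P [iw jw ij _ /andP [/eqP tj _]] E1 E2.
    have jl := old j tj jw; subst j.
    move: iw; rewrite inE => /orP [/eqP i_n|iw]; first by rewrite i_n eqxx in E1.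
    by rewrite !(bsum_delta_old _ pg).
(* If both types are [sym0], the letter $n$ may contribute in [g1] together with any old letter. A
   second derivative, at $l$, cancels all these pairs. Against the newest letter each letter
   contributes twice what it did in [g1] against $l$, and that is zero for all but $n$; the letter
   $l$ itself contributes [csum g1], again zero. *)
pose g2 := delta n.+1 l g1.
have nw1' : n.+1 \notin n :: w0 by rewrite inE negb_or eq_sym n01.
have lw1 : l \in n :: w0 by rewrite inE lw orbT.
have uw2 : uniq [:: n.+1, n & w0] by rewrite cons_uniq nw1'.
have pg2 x : x \in g2 -> perm_eq x.2 [:: n.+1, n & w0] by apply: perm_delta.
have id2 : gident C ty' g2 by apply: (gident_delta uw1 pg1).
have nl : n != l by rewrite eq_sym kn.
have c1 : bsum n.+1 n g2 = 2%:R * bsum l n g1.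
  by apply: (bsum_delta_new pg1); rewrite ?mem_head.
have c2 : bsum n n.+1 g2 = - bsum n.+1 n g2 by apply: (bsum_deltaC uw1 pg1); rewrite ?mem_head.
suff /eqP : (2%:R * 2%:R * 2%:R) * bsum k l g = 0.
  by rewrite mulf_eq0 (negbTE (mulf_neq0 four char2)) => /eqP.
have : pairsum eps n.+1 n g2 = 0.
  apply: (pairsum0 uw2 pg2 _ _ _ id2).
  - apply/and5P; split; rewrite ?mem_head ?tn ?tn1 ?e1 ?e2 //.
      by rewrite !inE eqxx orbT.
    by rewrite eq_sym.
    rewrite eqxx; apply/allP => j; rewrite !inE => /or3P [->//|->|jw]; rewrite ?orbT //.
    rewrite tk //; have := h j jw => /or3P [/eqP ->|/eqP ->|->]; rewrite ?orbT //.
      by rewrite tyk e1 eqxx !orbT.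
    by rewrite tyl e2 eqxx !orbT.
  - by move=> _; rewrite csum_delta.
  - have Z j : j \in n :: w0 -> j != n -> bsum n.+1 j g2 = 0.
      rewrite inE => /orP [->//|jw] jn.
      have [->|jl] := eqVneq j l; first by rewrite (bsum_delta_i uw1 pg1) ?csum_delta.
      have jw1 : j \in n :: w0 by rewrite inE jw orbT.
      by rewrite (bsum_delta_new pg1) // (bsum_delta_old _ pg) ?mulr0.
    have Z' j : j \in n :: w0 -> j != n -> bsum j n.+1 g2 = 0.
      by move=> jw jn; rewrite (bsum_deltaC uw1 pg1) // Z ?oppr0.
    move=> _ i j /and5P [iw jw ij _ _] E1 E2.
    move: iw jw; rewrite inE => /orP [/eqP i1|iw]; rewrite inE => /orP [/eqP j1|jw].
    + by rewrite i1 j1 eqxx in ij.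
    + have jn : j != n by apply: contraNneq E1 => ->; rewrite i1.
      by rewrite i1 Z ?Z'.
    + have i_n : i != n by apply: contraNneq E2 => ->; rewrite j1.
      by rewrite j1 Z ?Z'.
    + by rewrite !(bsum_delta_old _ pg1).
rewrite /pairsum c2 c1 b2 b1 ep expr1 => E; rewrite -oppr0 -E; ring.
Qed.

End Detect.

(** If [vanishes m] failed for every [m], the identity would satisfy [condL] and [condP], which are
    enough to make it hold in [B]. *)
Lemma sub_vanishes ty w0 g : uniq w0 -> w0 != [::] ->
  (forall x, x \in g -> perm_eq x.2 w0) -> gident C ty g -> ~ gident B ty g ->
  exists m, vanishes m.
Proof.
move=> uw nw pg id nB; apply: contrapT => nv; apply: nB.
have nv' m : ~ vanishes m by move=> h; apply: nv; exists m.
apply: (check_model char2 valid M uw pg nw).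
  exact: detect_condL.
exact: detect_condP.
Qed.

End Vanish.

(** * Codimensions as ranks *)

Section Rank.
Variables (F : fieldType) (A : starAlg F) (n : nat).
Notation V := {ffun mlmon n -> F^o}.

Lemma dim_ffun (I : finType) : \dim {: {ffun I -> F^o}} = #|I|.
Proof. by rewrite dimvf /dim /= muln1. Qed.

(** The identities lie in the kernel of [f], whose codimension is the rank; under the last condition
    they exhaust it. *)
Lemma codim_rank (I : finType) (f : V -> {ffun I -> F^o}) :
  linear f -> (forall y, exists c, f c = y) ->
  (forall c, star_id A (mlpoly c) -> f c = 0) ->
  (#|I| <= codim A n)%N /\
  ((forall c, f c = 0 -> star_id A (mlpoly c)) -> codim A n = #|I|).
Proof.
move=> lf sf kf.
pose fl : {linear V -> {ffun I -> F^o}} := HB.pack f (GRing.isLinear.Build _ _ _ _ f lf).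
have img : limg (linfun fl) = fullv.
  apply/eqP; rewrite eqEsubv subvf; apply/subvP => y _.
  by have [c <-] := sf y; rewrite -[f c](lfunE fl) memv_img ?memvf.
have D := limg_ker_dim (linfun fl) fullv.
rewrite img dim_ffun capfv in D.
have sub : (ml_id A n <= lker (linfun fl))%VS.
  by apply/subvP => c /ml_idP /kf fc; rewrite memv_ker lfunE /= fc.
split.
  by rewrite /codim -D -{1}[#|I|](addKn (\dim (lker (linfun fl)))) leq_sub2l ?dimvS.
move=> kf'; rewrite /codim.
have -> : ml_id A n = lker (linfun fl).
  apply/eqP; rewrite eqEsubv sub; apply/subvP => c.
  by rewrite memv_ker lfunE /= => /eqP /kf' /ml_idP.
by rewrite -D addKn.
Qed.

End Rank.

Section Multilinear.
Variables (F : fieldType) (n : nat).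

Definition tyof (t : {ffun 'I_n -> vtype}) (j : nat) : vtype :=
  if insub j is Some i then t i else sym0.

Lemma tyofE t (i : 'I_n) : tyof t i = t i.
Proof. by rewrite /tyof valK. Qed.

Definition permword (s : 'S_n) : seq nat := [seq val (s i) | i <- enum 'I_n].

Lemma perm_permword s : perm_eq (permword s) (iota 0 n).
Proof.
rewrite -val_enum_ord /permword (map_comp val s); apply: perm_map.
apply: uniq_perm; [|exact: enum_uniq|].
  by rewrite map_inj_uniq ?enum_uniq //; apply: perm_inj.
move=> i; rewrite mem_enum; apply/mapP; exists ((s^-1)%g i); rewrite ?mem_enum //.
by rewrite permKV.
Qed.

Definition mlpart (c : {ffun mlmon n -> F^o}) t : seq (F * seq nat) :=
  [seq (c (s, t), permword s) | s <- enum {: 'S_n}].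

Lemma perm_mlpart c t x : x \in mlpart c t -> perm_eq x.2 (iota 0 n).
Proof. by case/mapP => s _ ->; apply: perm_permword. Qed.

Lemma geval_mlpart (A : starAlg F) c t (r : nat -> A) :
  geval r (mlpart c t) = \sum_s c (s, t) *: wprod (map r (permword s)).
Proof. by rewrite /geval big_map big_enum. Qed.

Lemma csum_mlpart c t : csum (mlpart c t) = \sum_s c (s, t).
Proof. by rewrite /csum big_map big_enum. Qed.

Lemma bsum_mlpart i j c t :
  bsum i j (mlpart c t) = \sum_s c (s, t) * (before i j (permword s))%:R.
Proof. by rewrite /bsum big_map big_enum. Qed.

Lemma peval_mlpoly (A : starAlg F) (c : {ffun mlmon n -> F^o}) (s : svar -> A) :
  peval s (mlpoly c) = \sum_t geval (fun j => s (j, tyof t j)) (mlpart c t).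
Proof.
rewrite /mlpoly peval_sum.
under eq_bigr => p _ do rewrite pevalZ mlmonomialE pevalU.
under [RHS]eq_bigr => t _ do rewrite geval_mlpart.
rewrite exchange_big pair_big /=; apply: eq_bigr => -[u t] _.
congr (_ *: wprod _); rewrite /permword -!map_comp; apply: eq_map => i.
by rewrite /= tyofE.
Qed.

(** A multilinear identity splits into its components with prescribed letter types, since [0] may be
    substituted for every variable of another type. Positive degree ensures that there is no
    constant term. *)
Lemma star_id_mlpoly (A : starAlg F) (c : {ffun mlmon n -> F^o}) : (0 < n)%N ->
  star_id A (mlpoly c) <-> forall t, gident A (tyof t) (mlpart c t).
Proof.
move=> n0; split=> [[_ H] t r hr|H].
  pose s (x : svar) : A := if x.2 == tyof t x.1 then r x.1 else 0.
  have hs : substitution s.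
    move=> [j t']; rewrite /s /=; case: eqP => [->|_]; first exact: hr.
    exact: typed0.
  have := H s hs; rewrite peval_mlpoly (bigD1 t) //= big1 ?addr0.
    by move=> <-; apply: eq_bigr => x _; congr (_ *: wprod _); apply: eq_map => j;
      rewrite /s /= eqxx.
  move=> t' tt; rewrite geval_mlpart big1 // => u _.
  have [i ti] : exists i, t' i != t i.
    apply/existsP; rewrite -negb_forall; apply: contra tt => /forallP h.
    by apply/eqP/ffunP => i; apply/eqP.
  rewrite wprod_mem0 ?scaler0 //; apply/mapP; exists (val i).
    by rewrite (perm_mem (perm_permword u)) mem_iota ltn_ord.
  by rewrite /s /= !tyofE (negbTE ti).
split; last first.
  by move=> s hs; rewrite peval_mlpoly big1 // => t _; apply: H => j; apply: (hs (j, _)).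
rewrite /mlpoly raddf_sum /= big1 // => p _.
rewrite mcoeffZ mlmonomialE mcoeffU.
case: eqP => [/(congr1 (fun w : fmonom svar => size w))|]; last by rewrite mulr0.
by rewrite fm1 /= size_map size_enum_ord => n0'; rewrite n0' in n0.
Qed.

End Multilinear.

(** * Codimensions of flat algebras *)

Section AdjacentSwaps.
Variables (T : eqType) (V : Type) (f : seq T -> V) (w0 : seq T).
Hypothesis swap : forall w1 x y w2, perm_eq (w1 ++ [:: x, y & w2]) w0 ->
  f (w1 ++ [:: x, y & w2]) = f (w1 ++ [:: y, x & w2]).

Lemma swap_move p a x b : perm_eq (p ++ x :: a ++ b) w0 ->
  f (p ++ x :: a ++ b) = f (p ++ a ++ x :: b).
Proof.
elim: a p => //= y a IH p pw; rewrite swap //.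
rewrite -cat_rcons IH ?cat_rcons //.
rewrite -(permPr pw) perm_cat2l.
by rewrite -[y :: x :: _]/([:: y] ++ [:: x] ++ _) perm_catCA.
Qed.

Lemma swap_perm w w' : perm_eq w w0 -> perm_eq w w' -> f w = f w'.
Proof.
suff H u p u' : perm_eq (p ++ u) w0 -> perm_eq u u' -> f (p ++ u) = f (p ++ u').
  exact: (H w [::] w').
elim: u p u' {w w'} => [|x w IH] p w' pw ww'.
  by have /perm_nilP -> : perm_eq w' [::] by rewrite perm_sym.
have xw' : x \in w' by rewrite -(perm_mem ww') mem_head.
case/splitPr: xw' ww' => a b ww'.
have wab : perm_eq w (a ++ b).
  by rewrite -(perm_cons x) (permPl ww') perm_sym -cat1s perm_catCA.
have pab : perm_eq (rcons p x ++ a ++ b) w0.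
  by rewrite -(permPr pw) -cat_rcons perm_cat2l perm_sym.
rewrite -cat_rcons (IH _ (a ++ b)) ?cat_rcons //.
by rewrite swap_move // -cat_rcons.
Qed.

End AdjacentSwaps.

Section Flat.
Variables (F : fieldType) (C : starAlg F).
Implicit Types (w : seq nat) (ty : nat -> vtype).

(** Modulo identities such an algebra has in degree [N] at most one monomial for each assignment of
    types with at most one letter outside $A_0^+$, and none for the other assignments. *)
Definition flat (N : nat) : Prop := forall ty (r : nat -> C) w w',
  assignment ty r -> size w = N -> uniq w -> perm_eq w w' ->
  ((1 < nonsym0 ty w)%N -> wprod (map r w) = 0) /\
  ((nonsym0 ty w <= 1)%N -> wprod (map r w) = wprod (map r w')).

(** These are the monomials of a flat algebra that survive: one special letter of type [t] and $N-1$
    letters of $A_0^+$. The special letter comes first, as the order is immaterial. *)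
Definition reached (N : nat) (t : vtype) : Prop := exists (u : C) (l : seq C),
  [/\ typed t u, size l = N.-1, forall a, a \in l -> typed sym0 a &
    foldl (@amul F C) u l != 0].

(** Initial segments of a nonzero product are nonzero. *)
Lemma reached_leq N N' t : (N <= N')%N -> reached N' t -> reached N t.
Proof.
move=> le [u [l [tu sl tl]]]; rewrite -{1}(cat_take_drop N.-1 l) foldl_cat => nz.
exists u, (take N.-1 l); split=> //.
- by rewrite size_takel // sl -!subn1 leq_sub2r.
- by move=> a /mem_take; apply: tl.
- by apply: contraNneq nz => ->; rewrite foldl_amul0.
Qed.

Section Codim.
Variable N : nat.
Hypotheses (N0 : (0 < N)%N) (fC : flat N).

Notation X := (unit + 'I_N * vtype)%type.

(** An element of [X] encodes a type assignment with at most one special letter: [inl] stands for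
    none, [inr (i, t)] for the letter [i] of type [t]. To avoid encoding an assignment twice, [t]
    must not be [sym0], as [xgood] and [xproper] require. *)
Definition xtype (x : X) : {ffun 'I_N -> vtype} :=
  [ffun j => if x is inr (i, t) then if j == i then t else sym0 else sym0].

Definition xgood (x : X) : bool :=
  if x is inr (i, t) then (t != sym0) && `[< reached N t >] else `[< reached N sym0 >].

Definition xproper (x : X) : bool := if x is inr (i, t) then t != sym0 else true.

Lemma tyof_xtype x (j : nat) : tyof (xtype x) j =
  if x is inr (i, t) then if j == val i then t else sym0 else sym0.
Proof.
rewrite /tyof; case: insubP => [k _ <-|jN].
  by rewrite ffunE; case: x.
by case: x => // -[i t]; case: eqP => // ji; rewrite ji ltn_ord in jN.
Qed.

Lemma nonsym0_xtype x : (nonsym0 (tyof (xtype x)) (iota 0 N) <= 1)%N.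
Proof.
case: x => [u|[i t]].
  by rewrite /nonsym0 (eq_count (a2 := pred0)) ?count_pred0 // => j; rewrite tyof_xtype.
apply: (@leq_trans (count_mem (val i) (iota 0 N))).
  by apply: sub_count => j /=; rewrite tyof_xtype; case: (j == _).
by rewrite count_uniq_mem ?iota_uniq //; case: (_ \in _).
Qed.

Lemma nonsym0_xtypeP t : (nonsym0 (tyof t) (iota 0 N) <= 1)%N ->
  exists2 x, t = xtype x & xproper x.
Proof.
move=> n1; case: (pickP (fun i => t i != sym0)) => [i ti|h]; last first.
  by exists (inl tt) => //; apply/ffunP => j; rewrite ffunE; apply/eqP/negbFE/h.
exists (inr (i, t i)) => //; apply/ffunP => j; rewrite ffunE; case: eqP => [->//|/eqP ji].
apply/eqP; apply: contraTT n1 => tj; rewrite -ltnNge /nonsym0 -size_filter.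
have : uniq [:: val i; val j] by rewrite /= inE andbT -val_eqE eq_sym in ji *.
move=> /uniq_leq_size; apply=> k; rewrite !inE mem_filter mem_iota.
by case/orP => /eqP ->; rewrite tyofE ltn_ord ?ti ?tj.
Qed.

Lemma reachedP (i : 'I_N) t : reached N t <-> exists2 r : nat -> C,
  assignment (tyof (xtype (inr (i, t)))) r & wprod (map r (iota 0 N)) != 0.
Proof.
pose rest := [seq k <- iota 0 N | k != val i].
have pr : perm_eq (iota 0 N) (val i :: rest).
  apply: uniq_perm; rewrite ?iota_uniq //=.
    by rewrite mem_filter eqxx filter_uniq ?iota_uniq.
  move=> k; rewrite inE mem_filter mem_iota /=.
  by case: eqP => [->|]; rewrite ?ltn_ord.
have sr : size rest = N.-1.
  by have := perm_size pr; rewrite size_iota /= => ->.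
have fw (r : nat -> C) : assignment (tyof (xtype (inr (i, t)))) r ->
    wprod (map r (iota 0 N)) = wprod (map r (val i :: rest)).
  move=> hr; apply: (fC hr (size_iota 0 N) (iota_uniq 0 N) pr).2.
  exact: nonsym0_xtype.
split=> [[u [l [tu sl tl nz]]]|[r hr]]; last first.
  rewrite fw // => nz; exists (r (val i)), (map r rest); split=> //.
  - by have := hr (val i); rewrite tyof_xtype eqxx.
  - by rewrite size_map.
  - move=> a /mapP [k kr ->]; have := hr k; rewrite tyof_xtype.
    by move: kr; rewrite mem_filter => /andP [/negbTE ->].
pose r k := if k == val i then u else nth 0 l (index k rest).
have hr : assignment (tyof (xtype (inr (i, t)))) r.
  move=> k; rewrite tyof_xtype /r; case: eqP => // _.
  have [kl|kl] := ltnP (index k rest) (size l); first by apply: tl; rewrite mem_nth.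
  by rewrite nth_default //; apply: typed0.
exists r => //; rewrite fw //= {1}/r eqxx.
have -> // : map r rest = l.
apply: (@eq_from_nth _ 0); first by rewrite size_map sr.
rewrite size_map => n nr; rewrite (nth_map 0%N) // /r.
have : nth 0%N rest n \in rest by rewrite mem_nth.
rewrite mem_filter => /andP [/negbTE -> _].
by rewrite index_uniq // filter_uniq ?iota_uniq.
Qed.

Lemma xgoodP x : xproper x ->
  xgood x <-> exists2 r : nat -> C,
    assignment (tyof (xtype x)) r & wprod (map r (iota 0 N)) != 0.
Proof.
case: x => [u _|[i t] /= ->] /=.
  (* Having no special letter amounts to having one of type [sym0], which may be taken at position 0
     because [N] is positive. *)
  have -> : xtype (inl u) = xtype (inr (Ordinal N0, sym0)).
    by apply/ffunP => j; rewrite !ffunE; case: ifP.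
  by split=> [/asboolP/reachedP|/reachedP/asboolP].
by split=> [/asboolP/reachedP|/reachedP/asboolP].
Qed.

(** Given the types, all words take the same value, so only the sum of the coefficients matters. *)
Lemma star_id_flat (c : {ffun mlmon N -> F^o}) : star_id C (mlpoly c) <->
  forall x, xgood x -> csum (mlpart c (xtype x)) = 0.
Proof.
have ev x (r : nat -> C) : assignment (tyof (xtype x)) r ->
    geval r (mlpart c (xtype x)) =
    csum (mlpart c (xtype x)) *: wprod (map r (iota 0 N)).
  move=> hr; rewrite /geval /csum scaler_suml; apply: eq_big_seq => y /perm_mlpart py.
  rewrite perm_sym in py; congr (_ *: _); apply/esym.
  apply: (fC hr (size_iota 0 N) (iota_uniq 0 N) py).2; exact: nonsym0_xtype.
split=> [/(star_id_mlpoly C c N0) id x gx|H].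
  have vx : xproper x.
    by case: x gx => // -[i u] /= /andP [].
  have [r hr nz] := (xgoodP vx).1 gx.
  have := id _ r hr; rewrite ev // => /eqP; rewrite scaler_eq0 (negbTE nz) orbF.
  by move/eqP.
apply/(star_id_mlpoly C c N0) => t r hr.
have [n1|n1] := leqP (nonsym0 (tyof t) (iota 0 N)) 1.
  have [x tx vx] := nonsym0_xtypeP n1; rewrite tx in hr *; rewrite ev //.
  have [->|nz] := eqVneq (wprod (map r (iota 0 N))) 0; first by rewrite scaler0.
  by rewrite H ?scale0r //; apply/(xgoodP vx); exists r.
rewrite /geval big1_seq // => y /andP [_ /perm_mlpart py]; rewrite perm_sym in py.
have uy : uniq y.2 by rewrite -(perm_uniq py) iota_uniq.
have sy : size y.2 = N by rewrite -(perm_size py) size_iota.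
rewrite (fC hr sy uy (perm_refl _)).1 ?scaler0 //.
by rewrite /nonsym0 -(seq.permP py).
Qed.

Lemma xtype_inj x y : xgood x -> xgood y -> xtype x = xtype y -> x = y.
Proof.
move=> gx gy /ffunP E; case: x y gx gy E => [[]|[i t]] [[]|[j u]] //=.
- by move=> _ /andP [nu _] /(_ j); rewrite !ffunE eqxx => e; rewrite -e eqxx in nu.
- by move=> /andP [nt _] _ /(_ i); rewrite !ffunE eqxx => e; rewrite e eqxx in nt.
move=> /andP [nt _] _ /(_ i); rewrite !ffunE eqxx.
by case: eqP => [-> ->//|_ e]; rewrite e eqxx in nt.
Qed.

Lemma codim_xgood : codim C N = #|[pred x | xgood x]|.
Proof.
rewrite -card_sig.
pose f (c : {ffun mlmon N -> F^o}) : {ffun {x | xgood x} -> F^o} :=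
  [ffun x => csum (mlpart c (xtype (val x)))].
have [|||_ ->//] := @codim_rank F C N _ f.
- move=> k c d; apply/ffunP => x; rewrite !ffunE !csum_mlpart scaler_sumr -big_split.
  by apply: eq_bigr => s _; rewrite !ffunE.
(* The preimage puts the whole coefficient of each assignment on the identity permutation. *)
- move=> y; exists [ffun p : mlmon N => \sum_(x : {x | xgood x})
    y x * ((p.1 == 1%g) && (p.2 == xtype (val x)))%:R].
  apply/ffunP => x; rewrite ffunE csum_mlpart (bigD1 1%g) //= big1 ?addr0.
    rewrite ffunE (bigD1 x) //= !eqxx mulr1 big1 ?addr0 // => z zx.
    case: eqP => [/xtype_inj e|_]; last by rewrite mulr0.
    by case/eqP: zx; apply/val_inj/esym/e; apply: valP.
  by move=> s s1; rewrite ffunE big1 // => z _; rewrite (negbTE s1) mulr0.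
- move=> c /star_id_flat H; apply/ffunP => x; rewrite !ffunE; apply: H.
  exact: valP.
move=> c /ffunP fc; apply/star_id_flat => x gx.
by have := fc (exist _ x gx); rewrite !ffunE.
Qed.

(** One monomial has all its letters in $A_0^+$; every other type offers [N] choices of the special
    letter. *)
Lemma codim_flat : codim C N =
  (`[< reached N sym0 >] + N * #|[pred t | (t != sym0) && `[< reached N t >]]|)%N.
Proof.
rewrite codim_xgood -sum1_card big_sumType /=; congr addn.
  case: asboolP => h; first by rewrite (big_pred1 tt) // => -[]; rewrite inE; apply/asboolP.
  by rewrite big_pred0 // => -[]; rewrite inE; apply/asboolP.
have -> : (N * #|[pred t | (t != sym0) && `[< reached N t >]]| =
    \sum_(i < N) \sum_(t : vtype | (t != sym0) && `[< reached N t >]) 1)%N.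
  by rewrite sum_nat_const card_ord sum1_card.
rewrite pair_big; apply: eq_bigl => -[i t] //.
Qed.

End Codim.
End Flat.

(** * Flatness of subvarieties of a model in large degree *)

Section SubFlat.
Variables (F : fieldType) (p1 p2 : vtype) (eps : bool).
Hypothesis char2 : 2%:R != 0 :> F.
Hypothesis valid : valid_atom p1 p2 eps.
Variables (B : starAlg F) (e : B) (J : B -> Prop).
Hypothesis M : model p1 p2 eps e J.
Variable C : starAlg F.
Hypothesis BC : variety B C.

Notation rel := (relevant p1 p2).

Lemma vanishes_leq m m' : (m <= m')%N -> vanishes p1 p2 eps C m -> vanishes p1 p2 eps C m'.
Proof.
move=> le vm u v l tu tv sl tl; rewrite -(cat_take_drop m l) foldl_cat vm ?foldl_amul0 //.
  by rewrite size_takel // sl.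
by move=> a /mem_take; apply: tl.
Qed.

(** By [variety_eval], twice a word, or twice the difference of two words, is a multiple of the atom
    followed by $N-2\ge m$ letters, which vanishes. Where no pair is relevant, the identities of [B]
    suffice. *)
Lemma sub_flat m N : vanishes p1 p2 eps C m -> (m.+2 <= N)%N -> flat C N.
Proof.
move=> vm mN ty r w w' hr sw uw ww'.
have nw : w != [::] by rewrite -size_eq0 sw -lt0n (leq_trans _ mN).
have van i j : rel ty w i j -> foldl (@amul F C) (pmul eps (r i) (r j)) (map r (others i j w)) = 0.
  move=> /and5P [iw jw ij /eqP ti /andP [/eqP tj /allP h]].
  have /vanishes_leq vm' : (m <= size (others i j w))%N.
    by have := perm_size (perm_others uw iw jw ij) => /= so; rewrite -2!ltnS so sw.
  apply: (vm' vm); rewrite ?size_map -?ti -?tj //.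
  move=> a /mapP [k]; rewrite mem_filter => /andP [/andP [ki kj] kw] ->.
  by have := h k kw; rewrite (negbTE ki) (negbTE kj) /= => /eqP <-.
have two (a : C) : 2%:R *: a = 0 -> a = 0.
  by move=> /eqP; rewrite scaler_eq0 (negbTE char2) => /eqP.
split=> n1.
  pose g : seq (F * seq nat) := [:: (1, w)].
  have pg x : x \in g -> perm_eq x.2 w by rewrite inE => /eqP ->.
  have ev : geval r g = wprod (map r w) by rewrite geval_cons geval_nil scale1r addr0.
  have cL : condL p1 p2 eps ty w g by rewrite /condL leqNgt n1.
  have [[i [j rij]]|nr] := pselect (exists i j, rel ty w i j); last first.
    rewrite -ev; apply: (variety_check char2 valid M BC uw pg nw cL _ hr) => k l rkl.
    by case: nr; exists k, l.
  have n1' : p1 != sym0.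
    by apply/eqP => e1; have := relevant_nonsym0 uw rij e1; rewrite leqNgt n1.
  apply: two; rewrite -ev (variety_eval char2 valid M BC uw pg rij cL _ hr).
    by rewrite van // scaler0.
  move=> k l rkl E1 E2; have [E|E] := relevant_unique valid n1' rij rkl;
    by rewrite E eqxx in E1 E2.
apply: (@swap_perm _ _ (fun v => wprod (map r v)) w _ _ _ (perm_refl w) ww').
move=> w1 x y w2 pw; set v1 := w1 ++ _; set v2 := w1 ++ _.
have pv : perm_eq v2 w.
  rewrite -(permPr pw) perm_cat2l.
  by rewrite -[y :: x :: _]/([:: y] ++ [:: x] ++ _) perm_catCA.
(* Commutation is tested on adjacent letters: in the difference of the two words only the pair $x$,
   $y$ contributes. *)
pose g : seq (F * seq nat) := [:: (1, v1); (-1, v2)].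
have pg z : z \in g -> perm_eq z.2 w by rewrite !inE => /orP [] /eqP ->.
have ev : geval r g = wprod (map r v1) - wprod (map r v2).
  by rewrite !geval_cons geval_nil scale1r scaleN1r addr0.
apply/eqP; rewrite -subr_eq0 -ev; apply/eqP.
have cL : condL p1 p2 eps ty w g by move=> _ _; rewrite !csum_cons csum_nil addr0 subrr.
have xy : x != y.
  move: uw; rewrite -(perm_uniq pw) cat_uniq => /and3P [_ _ /=].
  by rewrite inE negb_or -andbA => /andP [].
have same k l : (k, l) != (x, y) -> (k, l) != (y, x) -> bsum k l g = 0.
  move=> E1 E2; rewrite !bsum_cons bsum_nil addr0 /= /v1 before_swap //.
  by rewrite mul1r mulN1r subrr.
have sameP k l : (k, l) != (x, y) -> (k, l) != (y, x) -> pairsum eps k l g = 0.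
  move=> E1 E2; rewrite /pairsum !same ?mulr0 ?addr0 //;
  by rewrite xpair_eqE andbC -xpair_eqE.
case: (boolP (rel ty w x y)) => [rxy|nxy].
  apply: two; rewrite (variety_eval char2 valid M BC uw pg rxy cL _ hr).
    by rewrite van // scaler0.
  by move=> k l _; apply: sameP.
case: (boolP (rel ty w y x)) => [ryx|nyx].
  apply: two; rewrite (variety_eval char2 valid M BC uw pg ryx cL _ hr).
    by rewrite van // scaler0.
  by move=> k l _ E1 E2; apply: sameP.
apply: (variety_check char2 valid M BC uw pg nw cL _ hr) => k l rkl.
apply: sameP; first by apply: contraNneq nxy => -[<- <-].
by apply: contraNneq nyx => -[<- <-].
Qed.

End SubFlat.

(** * Algebras without atoms *)

Section Atomless.
Variables (F : fieldType) (A : starAlg F).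
Hypothesis comm : forall t t' (u v : A), t = sym0 \/ t' = sym0 ->
  typed t u -> typed t' v -> amul u v = amul v u.
Hypothesis nil : forall t t' (u v : A), t != sym0 -> t' != sym0 ->
  typed t u -> typed t' v -> amul u v = 0.

(** Any two letters commute, so two letters outside $A_0^+$ can be moved to the front, where their
    product is zero. *)
Lemma atomless_flat N : flat A N.
Proof.
move=> ty r w w' hr sw uw ww'.
have inv v v' : perm_eq v v' -> wprod (map r v) = wprod (map r v').
  move=> pv; apply: (@swap_perm _ _ (fun v => wprod (map r v)) v _ _ _ (perm_refl v) pv).
  move=> w1 x y w2 _; rewrite !map_cat /= -!wprod_split.
  have [t0|tx] := eqVneq (ty x) sym0.
    by rewrite (comm (or_introl t0) (hr x) (hr y)).
  have [t0|ty'] := eqVneq (ty y) sym0.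
    by rewrite (comm (or_intror t0) (hr x) (hr y)).
  by rewrite (nil tx ty' (hr x) (hr y)) (nil ty' tx (hr y) (hr x)).
split=> n1; last exact: inv.
have : exists i j, [/\ i \in w, j \in w, i != j, ty i != sym0 & ty j != sym0].
  move: n1; rewrite /nonsym0 -size_filter.
  case E : (seq.filter _ w) => [|i [|j s]] // _; exists i, j.
  have := mem_filter (fun j => ty j != sym0) i w.
  have := mem_filter (fun j => ty j != sym0) j w.
  have := filter_uniq (fun j => ty j != sym0) uw.
  rewrite E /= !inE !eqxx !orbT negb_or => /andP [/andP [-> _] _].
  by move=> /esym/andP [-> ->] /esym/andP [-> ->].
move=> [i [j [iw jw ij ti tj]]].
have := inv _ _ (perm_others uw iw jw ij) => <- /=.
by rewrite (nil ti tj (hr i) (hr j)) foldl_amul0.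
Qed.

End Atomless.

(** * Quadratic lower bound for the codimensions *)

Section LowerBound.
Variables (F : fieldType) (p1 p2 : vtype) (eps : bool).
Hypothesis char2 : 2%:R != 0 :> F.
Hypothesis valid : valid_atom p1 p2 eps.
Variables (B : starAlg F) (e u v : B).
Hypothesis eu : forall a : B, amul e a = a /\ amul a e = a.
Hypotheses (tu : typed p1 u) (tv : typed p2 v) (uv : pmul eps u v != 0).

Variable N : nat.

Definition ptype_ffun (i j : 'I_N) : {ffun 'I_N -> vtype} :=
  [ffun k => if k == i then p1 else if k == j then p2 else sym0].

Lemma relevant_ptype_ffun (i j : 'I_N) : i != j ->
  relevant p1 p2 (tyof (ptype_ffun i j)) (iota 0 N) i j.
Proof.
move=> ij; have ij' : (j == i) = false by rewrite eq_sym (negbTE ij).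
apply/and5P; split; rewrite ?mem_iota ?ltn_ord //.
  by rewrite tyofE ffunE eqxx.
rewrite tyofE ffunE ij' !eqxx /=; apply/allP => k; rewrite mem_iota => /= kN.
rewrite -[k]/(val (Ordinal kN)) tyofE ffunE -!val_eqE /=.
by case: (k == i); case: (k == j); rewrite ?orbT.
Qed.

Lemma permword_surj w : perm_eq w (iota 0 N) -> exists s : 'S_N, permword s = w.
Proof.
move=> pw; have sw : size w = N by rewrite (perm_size pw) size_iota.
have wN (i : 'I_N) : (nth 0 w i < N)%N.
  have : nth 0%N w i \in w by rewrite mem_nth // sw.
  by rewrite (perm_mem pw) mem_iota.
have inj : injective (fun i => Ordinal (wN i)).
  move=> i j /(congr1 val) /= /eqP; rewrite nth_uniq ?sw ?(perm_uniq pw) ?iota_uniq //.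
  by move=> /eqP /val_inj.
exists (perm inj); apply: (@eq_from_nth _ 0%N); rewrite size_map size_enum_ord // => i iN.
by rewrite (nth_map (Ordinal iN)) ?size_enum_ord // permE /= nth_enum_ord.
Qed.

Notation sg := ((-1) ^+ eps : F).
Notation I := {p : 'I_N * 'I_N | (p.1 < p.2)%N}.

Lemma card_pairs : #|{: I}| = 'C(N, 2).
Proof.
rewrite card_sig -sum1_card -bin2_sum big_mkord.
rewrite (eq_bigl (fun p : 'I_N * 'I_N => true && (p.1 < p.2)%N)) //.
rewrite (reindex_inj (h := fun p : 'I_N * 'I_N => (p.2, p.1))); last by move=> [? ?] [? ?] [-> ->].
rewrite /= -(pair_big_dep predT (fun j i : 'I_N => (i < j)%N) (fun _ _ => 1%N)) /=.
apply: eq_bigr => j _.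
by rewrite -(big_ord_widen N (fun=> 1%N) (ltnW (ltn_ord j))) sum1_card card_ord.
Qed.

(** For each pair $i<j$, consider the component with types [p1] at $i$, [p2] at $j$ and [sym0]
    elsewhere. Its pair sum at $i$, $j$ is a functional that vanishes on identities by
    [ident_condP], and these functionals are independent. *)
Lemma codim_lower : (0 < N)%N -> ('C(N, 2) <= codim B N)%N.
Proof.
move=> N0; rewrite -card_pairs.
pose pr (x : I) : 'I_N * 'I_N := val x.
pose f (c : {ffun mlmon N -> F^o}) : {ffun I -> F^o} :=
  [ffun x => pairsum eps (pr x).1 (pr x).2 (mlpart c (ptype_ffun (pr x).1 (pr x).2))].
have lt_neq (x : I) : (pr x).1 != (pr x).2 by rewrite -val_eqE ltn_eqF //; exact: (valP x).
pose word1 (x : I) := [:: val (pr x).1, val (pr x).2 & others (pr x).1 (pr x).2 (iota 0 N)].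
pose word2 (x : I) := [:: val (pr x).2, val (pr x).1 & others (pr x).1 (pr x).2 (iota 0 N)].
have pw1 x : perm_eq (word1 x) (iota 0 N).
  by apply: perm_others; rewrite ?iota_uniq ?mem_iota ?ltn_ord ?lt_neq.
have pw2 x : perm_eq (word2 x) (iota 0 N).
  rewrite -(permPr (pw1 x)).
  by rewrite -[word2 x]/([:: _] ++ [:: _] ++ _) perm_catCA.
pose s1 x := projT1 (cid (permword_surj (pw1 x))).
pose s2 x := projT1 (cid (permword_surj (pw2 x))).
have s1E x : permword (s1 x) = word1 x by apply: projT2 (cid (permword_surj (pw1 x))).
have s2E x : permword (s2 x) = word2 x by apply: projT2 (cid (permword_surj (pw2 x))).
have psE k l c t : pairsum eps k l (mlpart c t) = \sum_s c (s, t) *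
    ((before k l (permword s))%:R + sg * (before l k (permword s))%:R).
  rewrite /pairsum !bsum_mlpart mulr_sumr -big_split; apply: eq_bigr => s _ /=; ring.
have [|||le _] := @codim_rank F B N _ f; last exact: le.
- move=> k c d; apply/ffunP => x; rewrite !ffunE !psE scaler_sumr -big_split.
  by apply: eq_bigr => s _; rewrite !ffunE /= mulrDl scalerAl.
(* The dual vector for a pair is half the atom in its two letters followed by the other letters, the
   pair sum of that product being 2. *)
- move=> y; exists [ffun p : mlmon N => \sum_(x : I) y x / 2%:R *
    ((p.2 == ptype_ffun (pr x).1 (pr x).2)%:R * ((p.1 == s1 x)%:R + sg * (p.1 == s2 x)%:R))].
  apply/ffunP => x; rewrite ffunE psE.
  pose bf (z : I) (s : 'S_N) := (before (pr z).1 (pr z).2 (permword s))%:R +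
    sg * (before (pr z).2 (pr z).1 (permword s))%:R : F.
  pose eqt (z x : I) := (ptype_ffun (pr z).1 (pr z).2 == ptype_ffun (pr x).1 (pr x).2)%:R : F.
  transitivity (\sum_z y z / 2%:R * (eqt x z * (bf x (s1 z) + sg * bf x (s2 z)))).
    under eq_bigr => s _ do rewrite ffunE mulr_suml.
    rewrite exchange_big; apply: eq_bigr => z _ /=.
    under eq_bigr => s _ do rewrite -!mulrA.
    rewrite -!mulr_sumr -[RHS]mulrA; congr (_ * (_ * (_ * _))).
    under eq_bigr => s _ do rewrite mulrDl.
    rewrite big_split /=; congr (_ + _).
      rewrite (bigD1 (s1 z)) //= eqxx mul1r big1 ?addr0 // => s /negbTE ->.
      by rewrite mul0r.
    rewrite (bigD1 (s2 z)) //= eqxx mulr1 big1 ?addr0 // => s /negbTE ->.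
    by rewrite mulr0 mul0r.
  rewrite (bigD1 x) //= big1 ?addr0 => [|z zx].
    have ji : (val (pr x).2 == val (pr x).1) = false by rewrite val_eqE eq_sym (negbTE (lt_neq x)).
    have ij : (val (pr x).1 == val (pr x).2) = false by rewrite val_eqE (negbTE (lt_neq x)).
    have -> : bf x (s1 x) = 1.
      by rewrite /bf s1E /word1 !before_cons !eqxx ij mulr0 addr0.
    have -> : bf x (s2 x) = sg.
      by rewrite /bf s2E /word2 !before_cons !eqxx ji mulr1 add0r.
    rewrite /eqt eqxx mul1r sgK -mulrA (_ : 1 + 1 = 2%:R) ?mulVf ?mulr1 //.
  have E1 : (val (pr x).1, val (pr x).2) != (val (pr z).1, val (pr z).2).
    rewrite xpair_eqE !val_eqE -xpair_eqE -!surjective_pairing.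
    by apply: contraNneq zx => /val_inj ->.
  have E2 : (val (pr x).1, val (pr x).2) != (val (pr z).2, val (pr z).1).
    apply/eqP => -[h1 h2]; have := valP z; rewrite -h1 -h2 ltnNge.
    by rewrite (ltnW (valP x)).
  have lz : val (pr z).1 != val (pr z).2 by rewrite val_eqE lt_neq.
  have B1 : before (pr x).1 (pr x).2 (word1 z) = before (pr x).1 (pr x).2 (word2 z).
    exact: (@before_swap _ _ _ _ [::]).
  have B2 : before (pr x).2 (pr x).1 (word1 z) = before (pr x).2 (pr x).1 (word2 z).
    by apply: (@before_swap _ _ _ _ [::]) => //; rewrite xpair_eqE andbC -xpair_eqE.
  rewrite /bf s1E s2E B1 B2.
  (* The two words attached to [z] order the letters of [x] alike, so for the commutator they
     cancel. For the anticommutator neither type is [sym0], and distinct pairs have distinct type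
     assignments. *)
  case Ee : eps; first by rewrite expr1 !mulN1r subrr !mulr0.
  have n1 : p1 != sym0 by apply/eqP => /(valid_eps valid); rewrite Ee.
  have n2 : p2 != sym0 by apply/eqP => /(valid_sym0 valid) /(valid_eps valid); rewrite Ee.
  rewrite /eqt; case: eqP => [/ffunP tE|_]; last by rewrite mul0r mulr0.
  have := tE (pr x).1; have := tE (pr x).2; rewrite !ffunE eqxx.
  rewrite [_.2 == _.1]eq_sym (negbTE (lt_neq x)) eqxx => t2 t1.
  have in1 : (pr x).1 \in [:: (pr z).1; (pr z).2].
    move: t1; rewrite !inE; case: eqP => // _; case: eqP => // _ e1.
    by rewrite e1 eqxx in n1.
  have in2 : (pr x).2 \in [:: (pr z).1; (pr z).2].
    move: t2; rewrite !inE; case: eqP => // _; case: eqP => // _ e2.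
    by rewrite e2 eqxx in n2.
  move: in1 in2 E1 E2 (lt_neq x); rewrite !inE => /orP [] /eqP -> /orP [] /eqP ->;
    by rewrite ?eqxx.
- move=> c /(star_id_mlpoly B c N0) id; apply/ffunP => x; rewrite !ffunE.
  have nw : iota 0 N != [::] by rewrite -size_eq0 size_iota -lt0n.
  apply: (ident_condP eu tu tv uv (iota_uniq 0 N) (perm_mlpart (t := _)) nw (id _)).
  exact: relevant_ptype_ffun.
Qed.

End LowerBound.

(** * Linearization *)

Section CoefficientExtraction.
Variables (F : fieldType) (V : lmodType F).
Hypothesis charF : forall n : nat, (n%:R == 0 :> F) = (n == 0)%N.

Lemma natr_inj_char0 (m n : nat) : m%:R = n%:R :> F -> m = n.
Proof.
wlog le : m n / (m <= n)%N => [H|].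
  by have [|/ltnW le] := leqP m n; [exact: H|move=> /esym/(H _ _ le)/esym].
move=> /esym/eqP; rewrite -subr_eq0 -natrB // charF subn_eq0 => le'.
by apply/eqP; rewrite eqn_leq le.
Qed.

(** The nodes $0,\dots,n-1$ are distinct in characteristic zero, so their Vandermonde matrix is
    invertible and a combination of the values at them picks out one coefficient. *)
Lemma coef_extract d n : (d < n)%N -> exists mu : 'I_n -> F, forall k, (k < n)%N ->
  \sum_i mu i * (val i)%:R ^+ k = (k == d)%:R.
Proof.
move=> dn; pose a : 'rV[F]_n := \row_i (val i)%:R.
have Vu : Vandermonde n a \in unitmx.
  rewrite unitmxE det_Vandermonde unitfE.
  apply/prodf_neq0 => i _; apply/prodf_neq0 => j ij.
  rewrite !mxE subr_eq0; apply/eqP => /natr_inj_char0 E.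
  by rewrite E ltnn in ij.
pose m := invmx (Vandermonde n a) *m (\col_i (val i == d)%:R).
exists (fun i => m i 0) => k kn.
have /matrixP /(_ (Ordinal kn) 0) : Vandermonde n a *m m = \col_i (val i == d)%:R.
  by rewrite /m mulKVmx.
rewrite !mxE => <-; apply: eq_bigr => i _; by rewrite !mxE mulrC.
Qed.

Lemma extract_exponent (I : eqType) (s : seq I) (P : pred I) (ex : I -> nat)
    (v : I -> V) d :
  (forall t : F, \sum_(x <- s | P x) t ^+ ex x *: v x = 0) ->
  \sum_(x <- s | P x && (ex x == d)) v x = 0.
Proof.
move=> H; pose n := (maxn d (\max_(x <- s) ex x)).+1.
have [|mu mE] := @coef_extract d n; first by rewrite ltnS leq_maxl.
have : \sum_i mu i *: (\sum_(x <- s | P x) (val i)%:R ^+ ex x *: v x) = 0.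
  by rewrite big1 // => i _; rewrite H scaler0.
under eq_bigr => i _ do rewrite scaler_sumr.
rewrite exchange_big => E; rewrite -[RHS]E big_mkcondr.
rewrite big_seq_cond [RHS]big_seq_cond; apply: eq_bigr => x /andP [xs _].
under eq_bigr => i _ do rewrite scalerA.
rewrite -scaler_suml mE; last first.
  by rewrite ltnS leq_max; apply/orP; right; rewrite (big_rem x) //= leq_maxl.
by case: (ex x == d); rewrite ?scale1r ?scale0r.
Qed.

Lemma extract_multilinear (I : eqType) (s : seq I) n (ex : I -> 'I_n -> nat)
    (v : I -> V) :
  (forall t : 'I_n -> F, \sum_(x <- s) (\prod_j t j ^+ ex x j) *: v x = 0) ->
  \sum_(x <- s | [forall j, ex x j == 1%N]) v x = 0.
Proof.
move=> H.
(* One variable is treated at a time: [js] lists those whose exponent has already been restricted to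
   1. *)
have step (js : seq 'I_n) : uniq js -> forall t : 'I_n -> F,
    \sum_(x <- s | all (fun j => ex x j == 1%N) js)
      (\prod_(j | j \notin js) t j ^+ ex x j) *: v x = 0.
  elim: js => [_ t|j js IH /andP [jn ju] t] /=; first exact: H.
  rewrite (eq_bigl (fun x => all (fun j => ex x j == 1%N) js && (ex x j == 1%N))); last first.
    by move=> x; rewrite andbC.
  apply: (extract_exponent (ex := fun x => ex x j)) => a.
  rewrite -[RHS](IH ju (fun k => if k == j then a else t k)).
  apply: eq_bigr => x _; rewrite scalerA; congr (_ *: _).
  rewrite [RHS](bigD1 j) //= eqxx; congr (_ * _); apply: congr_big => // k.
    by rewrite inE negb_or andbC.
  by rewrite inE negb_or => /andP [/negbTE -> _].
have := step (enum 'I_n) (enum_uniq _) (fun _ => 1).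
move=> E; rewrite -[RHS]E; apply: congr_big => // x.
  apply/forallP/allP => [h j _|h j]; first exact: h.
  by apply: h; rewrite mem_enum.
by move=> _; rewrite big_pred0 ?scale1r // => j; rewrite mem_enum.
Qed.

End CoefficientExtraction.

Section Linearization.
Variable F : fieldType.
Hypothesis charF : forall n : nat, (n%:R == 0 :> F) = (n == 0)%N.

Section Expand.
Variables (A : starAlg F) (n : nat) (phi : 'I_n -> svar) (r : 'I_n -> A).

(** The index words lying over [w] under [phi]. They arise on expanding a product in which each
    variable has been replaced by a sum over its copies. *)
Fixpoint lifts (w : seq svar) : seq (seq 'I_n) :=
  if w is x :: w' then [seq j :: l | j <- [seq j <- enum 'I_n | phi j == x], l <- lifts w']
  else [:: [::]].

Lemma mem_lifts w l : (l \in lifts w) = (map phi l == w).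
Proof.
elim: w l => [|x w IH] l /=; first by rewrite inE; case: l.
apply/allpairsP/eqP => [[[j l'] /= [jx lw ->]]|].
  move: jx lw; rewrite mem_filter IH => /andP [/eqP <- _] /eqP <-.
  by [].
case: l => // j l [<- E]; exists (j, l); split=> //=.
  by rewrite mem_filter eqxx mem_enum.
by rewrite IH E.
Qed.

Lemma uniq_lifts w : uniq (lifts w).
Proof.
elim: w => //= x w IH; apply: allpairs_uniq => //.
  by apply: filter_uniq; apply: enum_uniq.
by move=> [j l] [j' l'] _ _ [-> ->].
Qed.

Definition scaled_subst (t : 'I_n -> F) (x : svar) : A :=
  \sum_(j | phi j == x) t j *: r j.

Lemma foldl_lifts t w (a : A) :
  foldl (@amul F A) a (map (scaled_subst t) w) =
  \sum_(l <- lifts w) (\prod_(j <- l) t j) *: foldl (@amul F A) a (map r l).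
Proof.
elim: w a => [|x w IH] a /=; first by rewrite big_seq1 big_nil scale1r.
rewrite IH big_allpairs_dep /= big_filter big_enum_cond /=.
rewrite exchange_big /=; apply: eq_bigr => l _.
rewrite /scaled_subst amul_sumr.
rewrite (big_morph (fun b => foldl (@amul F A) b (map r l)) (fun a b => foldl_amulD a b _) (foldl_amul0 _)).
rewrite scaler_sumr; apply: eq_bigr => j _ /=.
by rewrite amulZr foldl_amulZ scalerA big_cons mulrC.
Qed.

Lemma wprod_lifts t w : wprod (map (scaled_subst t) w) =
  \sum_(l <- lifts w) (\prod_(j <- l) t j) *: wprod (map r l).
Proof.
case: w => [|x w] /=; first by rewrite big_seq1 big_nil scale1r.
rewrite -/(foldl _ _ _) foldl_lifts big_allpairs_dep /= big_filter big_enum_cond /=.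
rewrite exchange_big /=; apply: eq_bigr => l _.
rewrite /scaled_subst.
rewrite (big_morph (fun b => foldl (@amul F A) b (map r l)) (fun a b => foldl_amulD a b _) (foldl_amul0 _)).
rewrite scaler_sumr; apply: eq_bigr => j _ /=.
by rewrite foldl_amulZ scalerA big_cons mulrC.
Qed.

End Expand.

Lemma prod_count (n : nat) (t : 'I_n -> F) (l : seq 'I_n) :
  \prod_(j <- l) t j = \prod_j t j ^+ count_mem j l.
Proof.
elim: l => [|i l IH]; first by rewrite big_nil big1.
rewrite big_cons IH [RHS](bigD1 i) //= eqxx exprS -mulrA; congr (_ * _).
rewrite (bigD1 i) //=; congr (_ * _); apply: eq_bigr => j ji.
by rewrite eq_sym (negbTE ji).
Qed.

Definition pword (n : nat) (s : 'S_n) : seq 'I_n := [seq s i | i <- enum 'I_n].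

Lemma pwordP n (l : seq 'I_n) :
  [forall j, count_mem j l == 1%N] -> exists s : 'S_n, pword s = l.
Proof.
move=> /forallP h.
have pl : perm_eq l (enum 'I_n).
  apply/allP => j _ /=; rewrite (eqP (h j)) count_uniq_mem ?enum_uniq //.
  by rewrite mem_enum.
have sl : size l = n by rewrite (perm_size pl) size_enum_ord.
case: n l h pl sl => [|n] l h pl sl.
  by exists 1%g; case: l sl {h pl} => // _; rewrite /pword (size0nil (size_enum_ord 0)).
have inj : injective (fun i : 'I_n.+1 => nth ord0 l i).
  move=> i j /eqP; rewrite nth_uniq ?sl ?(perm_uniq pl) ?enum_uniq //.
  by move=> /eqP/val_inj.
exists (perm inj); apply: (@eq_from_nth _ ord0); rewrite size_map size_enum_ord // => i iN.
by rewrite (nth_map ord0) ?size_enum_ord // permE /= nth_enum_ord.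
Qed.

Lemma count_pword n (s : 'S_n) j : count_mem j (pword s) = 1%N.
Proof.
have us : uniq (pword s).
  by rewrite map_inj_uniq ?enum_uniq //; apply: perm_inj.
rewrite count_uniq_mem //.
by rewrite (_ : j \in _) //; apply/mapP; exists ((s^-1)%g j); rewrite ?mem_enum ?permKV.
Qed.

Lemma pword_inj n : injective (@pword n).
Proof.
by move=> s s' /eq_in_map E; apply/permP => i; apply: E; rewrite mem_enum.
Qed.

(** The full linearization: each variable $x$ is polarized into the letters $j$ with [phi j = x],
    and the part of degree one in every letter is kept. *)
Definition linearize n (phi : 'I_n -> svar) (f : freeAlg F) : {ffun mlmon n -> F^o} :=
  [ffun p => if p.2 == [ffun j => (phi j).2] then mcoeff (FMonom (map phi (pword p.1))) f else 0].

Lemma star_id_linearize (A : starAlg F) (f : freeAlg F) n (phi : 'I_n -> svar) :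
  (0 < n)%N -> star_id A f -> star_id A (mlpoly (linearize phi f)).
Proof.
move=> n0 [_ idf]; apply/(star_id_mlpoly A _ n0) => t r hr.
rewrite geval_mlpart; have [tE|tE] := eqVneq t [ffun j => (phi j).2]; last first.
  by rewrite big1 // => s _; rewrite ffunE (negbTE tE) scale0r.
pose r' (j : 'I_n) := r (val j).
have tr j : typed (phi j).2 (r' j).
  by have := hr (val j); rewrite tyofE tE ffunE.
pose S := flatten [seq [seq (mcoeff w f, l) | l <- lifts phi w] | w <- msupp f].
have ev (g : F * seq 'I_n -> A) P : \sum_(x <- S | P x) g x =
    \sum_(w <- msupp f) \sum_(l <- lifts phi w | P (mcoeff w f, l)) g (mcoeff w f, l).
  rewrite /S big_flatten big_map; apply: eq_bigr => w _.
  by rewrite big_map.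
(* The value of [f] with each $x$ replaced by the sum of $t_jr_j$ over the letters $j$ above $x$ is
   zero for all scalars $t_j$. Its coefficient of $\prod_jt_j$ is the value of the linearization. *)
have := @extract_multilinear F A charF _ S n (fun x j => count_mem j x.2)
  (fun x => x.1 *: wprod (map r' x.2)).
rewrite ev => E; rewrite -[RHS]E; last first.
  move=> tau; rewrite ev -[RHS](idf (scaled_subst phi r' tau)).
    apply: eq_bigr => w _; rewrite wevalE wprod_lifts scaler_sumr.
    by apply: eq_bigr => l _; rewrite !scalerA prod_count mulrC.
  move=> x; rewrite /scaled_subst; apply: (big_ind (fun a => typed x.2 a)) => //.
  - exact: typed0.
  - by move=> a b; apply: typedD.
  - by move=> j /eqP <-; apply: typedZ.
transitivity (\sum_(w <- msupp f) \sum_(s : 'S_n | map phi (pword s) == w)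
    mcoeff w f *: wprod (map r' (pword s))); last first.
  apply: eq_bigr => w _ /=; rewrite -[in LHS]big_filter -[in RHS]big_filter.
  rewrite -(big_map (@pword n) predT (fun l => mcoeff w f *: wprod (map r' l))).
  apply: perm_big; apply: uniq_perm.
  - rewrite map_inj_uniq; last exact: pword_inj.
    by apply: filter_uniq; apply: index_enum_uniq.
  - by rewrite filter_uniq ?uniq_lifts.
  move=> l; rewrite mem_filter mem_lifts; apply/mapP/andP.
    move=> [s]; rewrite mem_filter => /andP [sw _] ->; split=> //.
    by apply/forallP => j; rewrite count_pword.
  by move=> [/pwordP [s <-] sw]; exists s => //; rewrite mem_filter sw mem_index_enum.
under [RHS]eq_bigr => w _ do rewrite big_mkcond /=.
rewrite exchange_big /=; apply: eq_bigr => s _.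
rewrite ffunE /= tE eqxx.
have -> : wprod (map r (permword s)) = wprod (map r' (pword s)).
  by rewrite /permword /pword -!map_comp.
have [ws|ws] := boolP (FMonom (map phi (pword s)) \in msupp f).
  rewrite (big_fsetD1 _ ws) /= eqxx big1_fset ?addr0 // => w.
  rewrite !inE => /andP [nw _] _; case: eqP => // E'.
  by case/eqP: nw; apply: val_inj; rewrite /= E'.
rewrite mcoeff_outdom // scale0r big1_seq // => w /andP [_ wf].
by case: eqP => // E'; case/negP: ws; rewrite E' (_ : FMonom w = w) //; case: (w).
Qed.

Section Variety.
Variables (C B : starAlg F).
Hypothesis CB : forall n (c : {ffun mlmon n -> F^o}), (0 < n)%N ->
  star_id C (mlpoly c) -> star_id B (mlpoly c).

Lemma linearize_eval n (phi : 'I_n -> svar) (f : freeAlg F) (s : svar -> B) :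
  (0 < n)%N -> star_id C f -> substitution s ->
  \sum_(u : 'S_n) mcoeff (FMonom (map phi (pword u))) f *:
    wprod (map s (map phi (pword u))) = 0.
Proof.
move=> n0 idf hs.
have /(star_id_mlpoly B _ n0) := CB n0 (star_id_linearize phi n0 idf).
pose t := [ffun j => (phi j).2].
pose r (j : nat) : B := if insub j is Some i then s (phi i) else 0.
have hr : assignment (tyof t) r.
  move=> j; rewrite /tyof /r; case: insubP => [i _ _|_]; last exact: typed0.
  by rewrite ffunE; apply: hs.
move=> /(_ t r hr); rewrite geval_mlpart => E; rewrite -[RHS]E.
apply: eq_bigr => u _; rewrite ffunE /= eqxx; congr (_ *: wprod _).
rewrite /permword /pword -!map_comp; apply: eq_map => i /=.
by rewrite /r valK.
Qed.

(** Identifying the letters again in all linearizations of degree $n$ and adding up returns $n!$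
    times the part of [f] of degree $n$, and $n!$ is invertible. *)
Lemma linear_variety : star_id C `<=` star_id B.
Proof.
move=> f idf; split; first by case: idf.
move=> s hs; pose x0 : svar := (0%N, sym0).
pose vs := undup (flatten [seq fmonom_val w | w <- msupp f]).
pose N := size vs.
(* Here [h] runs over all words of length [n] in the finitely many variables of [f]; words outside
   the support of [f] have coefficient 0. *)
pose phi n (h : {ffun 'I_n -> 'I_N}) (i : 'I_n) := nth x0 vs (h i).
pose H (w : fmonom svar) := mcoeff w f *: wprod (map s w).
pose word n (h : {ffun 'I_n -> 'I_N}) := FMonom (map (phi n h) (enum 'I_n)).
have S0 n : \sum_h H (word n h) = 0.
  have [->|n0] := posnP n.
    rewrite big1 // => h _; rewrite /H /= (size0nil (size_enum_ord 0)) /=.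
    exact: scaler0.
  have n1 : (n`!)%:R != 0 :> F by rewrite charF -lt0n fact_gt0.
  suff /eqP : (n`!)%:R *: (\sum_h H (word n h)) = 0.
    by rewrite scaler_eq0 (negbTE n1) => /eqP.
  (* The factor $n!$ is spread over the permutations of the positions, each of which permutes the
     words [h]. For a fixed [h] the sum over the permutations is a value of a linearization. *)
  rewrite scaler_nat -card_Sn -sumr_const.
  transitivity (\sum_(u : 'S_n) \sum_h H (FMonom (map (phi n h) (pword u)))).
    apply: eq_big => [u|u _]; first by rewrite inE.
    have inj : injective (fun h : {ffun 'I_n -> 'I_N} => [ffun i => h (u i)]).
      move=> h h' /ffunP E; apply/ffunP => i.
      by have := E ((u^-1)%g i); rewrite !ffunE permKV.
    rewrite (reindex_inj inj); apply: eq_bigr => h _; congr (H (FMonom _)).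
    by rewrite /pword -[RHS]map_comp; apply: eq_map => i; rewrite /phi /= ffunE.
  rewrite exchange_big big1 // => h _.
  exact: linearize_eval.
pose M := (\max_(w <- msupp f) size w).+1.
have sM w : w \in msupp f -> (size w < M)%N.
  by move=> wf; rewrite ltnS (big_rem w) //= leq_maxl.
transitivity (\sum_(n < M) \sum_(w <- msupp f | size w == n) H w).
  rewrite /peval; under eq_bigr => w _ do rewrite wevalE -/(H w).
  under [RHS]eq_bigr => n _ do rewrite big_mkcond.
  rewrite exchange_big /=; apply: eq_big_seq => w /sM wM.
  rewrite (bigD1 (Ordinal wM)) //= eqxx big1 ?addr0 // => i iw.
  by case: eqP => // E; case/eqP: iw; apply: val_inj.
rewrite big1 // => n _; rewrite -[RHS](S0 n) -big_filter.
rewrite -[RHS](big_map (@word n) predT H).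
rewrite [RHS](bigID (fun w => w \in msupp f)) /= [X in _ + X]big1 ?addr0; last first.
  by move=> w wf; rewrite /H mcoeff_outdom // scale0r.
rewrite -[RHS]big_filter; apply: perm_big; apply: uniq_perm.
- by rewrite filter_uniq // fset_uniq.
- apply: filter_uniq; rewrite map_inj_uniq ?index_enum_uniq //.
  move=> h h' [] /eq_in_map E; apply/ffunP => i; apply: val_inj.
  have := E i (mem_enum _ _) => /eqP; rewrite /phi nth_uniq ?undup_uniq ?ltn_ord //.
  by move/eqP.
move=> w; rewrite !mem_filter [LHS]andbC; case: (boolP (w \in msupp f)) => //= wf.
apply/eqP/mapP => [sw|[h _ ->]]; last by rewrite /= size_map size_enum_ord.
have wv (i : 'I_n) : (index (nth x0 w i) vs < N)%N.
  rewrite index_mem mem_undup; apply/flattenP; exists (fmonom_val w).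
    by apply/mapP; exists w.
  by rewrite mem_nth // sw.
exists [ffun i => Ordinal (wv i)]; first exact: mem_index_enum.
apply: val_inj => /=; apply: (@eq_from_nth _ x0).
  by rewrite size_map size_enum_ord.
rewrite sw => i ni; rewrite (nth_map (Ordinal ni)) ?size_enum_ord //.
rewrite /phi ffunE /= nth_enum_ord // nth_index //.
rewrite mem_undup; apply/flattenP; exists (fmonom_val w); first by apply/mapP; exists w.
by rewrite mem_nth // sw.
Qed.

End Variety.

End Linearization.

(** * The sixteen algebras *)

Notation skew0 := ((false, true) : vtype).
Notation sym1 := ((true, false) : vtype).
Notation skew1 := ((true, true) : vtype).

Section CoordModel.
Variables (F : fieldType) (B : starAlg F) (p1 p2 : vtype) (eps : bool).
Variables (e m1 m2 : B) (al be ga : B -> F).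

(** The coordinates [al], [be], [ga] are taken along the unit and along generators of types [p1] and
    [p2]; [m1] and [m2] stand for the products of these generators in the two orders. The radical is
    the kernel of [al]. *)
Lemma coord_model :
  (forall a : B, amul e a = a /\ amul a e = a) ->
  (forall k a b, al (k *: a + b) = k * al a + al b) -> al e = 1 ->
  (forall u v, al u = 0 -> al v = 0 ->
    amul u v = (be u * ga v) *: m1 + (ga u * be v) *: m2) ->
  (p1 != sym0 -> m1 = (-1) ^+ eps *: m2) ->
  (forall u v w, al u = 0 -> al v = 0 -> al w = 0 -> amul (amul u v) w = 0) ->
  (forall t (u : B), typed t u -> [/\ al u != 0 -> t = sym0, be u != 0 -> t = p1,
    ga u != 0 -> t = p2 & u != 0 -> t \in [:: sym0; p1; p2; ptype eps p1 p2]]) ->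
  (exists u v : B, [/\ typed p1 u, typed p2 v & pmul eps u v != 0]) ->
  model p1 p2 eps e (fun u => al u = 0).
Proof.
move=> eu alin ale mulE m12 J3 ty wit.
split=> //.
- move=> t b tb; have [ta _ _ _] := ty t b tb.
  have [a0|a0] := eqVneq (al b) 0.
    by exists 0, b; rewrite scale0r add0r.
  have t0 := ta a0; exists (al b), (- al b *: e + b); split.
  + by rewrite scaleNr addrA subrr add0r.
  + by apply: typedD => //; apply: typedZ; rewrite t0; apply: unit_typed.
  + by rewrite alin ale mulr1 addNr.
  + by rewrite t0 eqxx.
- move=> t t' u v tu Ju tv Jv; rewrite mulE // => nz.
  have [_ bu gu _] := ty t u tu; have [_ bv gv _] := ty t' v tv.
  have [h|h] := eqVneq (be u * ga v) 0; last first.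
    by move: h; rewrite mulf_eq0 negb_or => /andP [/bu -> /gv ->]; left.
  move: nz; rewrite h scale0r add0r scaler_eq0 negb_or mulf_eq0 negb_or.
  by move=> /andP [/andP [/gu -> /bv ->] _]; right.
- move=> n1 u v _ Ju _ Jv; rewrite !mulE // (m12 n1) scalerDr !scalerA.
  rewrite addrC ![_ * (-1) ^+ eps]mulrC !mulrA -signr_addb addbb mul1r.
  by rewrite -!mulrA [ga v * _]mulrC [ga u * _]mulrC.
- by move=> t u tu u0; have [_ _ _] := ty t u tu; apply.
Qed.

End CoordModel.

Section MxStarAlg.
Variables (F : fieldType) (n : nat) (U : {vspace 'M[F]_n}).
Variables (G : bool -> 'M[F]_n -> Prop) (st : 'M[F]_n -> 'M[F]_n).
Variable H : star_subalg U G st.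
Implicit Types x y : mxStarAlg H.

Lemma mxsZ k x : vsval (k *: x) = k *: vsval x.
Proof. by []. Qed.

Lemma mxsD x y : vsval (x + y) = vsval x + vsval y.
Proof. by []. Qed.

Lemma mxs0 : vsval (0 : mxStarAlg H) = 0.
Proof. by []. Qed.

Lemma mxsM x y : vsval (amul x y) = vsval x *m vsval y.
Proof. exact: (ss_mulE H). Qed.

Lemma mxsS x : vsval (star x) = st (vsval x).
Proof. exact: (ss_starE H). Qed.

Lemma mxs_inj x y : vsval x = vsval y -> x = y.
Proof. exact: val_inj. Qed.

End MxStarAlg.

Section MatrixModels.
Variable F : fieldType.
Hypothesis char2 : 2%:R != 0 :> F.

Lemma sign_eq (s s' : bool) (a : F) : (-1) ^+ s * a = (-1) ^+ s' * a -> a != 0 -> s = s'.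
Proof.
move=> E a0; have /(mulIf a0) := E; case: s s' {E} => [] [] //= /eqP;
  rewrite ?expr0 ?expr1 -?addr_eq0 ?[- 1 == 1]eq_sym -?addr_eq0.
- by rewrite -[1 + 1]/(2%:R) (negbTE char2).
- by rewrite -[1 + 1]/(2%:R) (negbTE char2).
Qed.

Section C3.
Variables (G : bool -> 'M[F]_3 -> Prop) (s d : bool).
Hypothesis H : star_subalg (C3 F) G (C3_invol s d).
Hypothesis HG : forall i a b c, G i (C3mx a b c) ->
  [/\ a != 0 -> i = false, b != 0 -> i = d & c != 0 -> i = false].
Hypothesis G1 : G d (C3mx 0 1 0).

Let T := mxStarAlg H.
Let inC a b c : C3mx a b c \in C3 F.
Proof. by apply/C3P; exists a, b, c. Qed.
Let el a b c : T := Subvs (inC a b c).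

Let elE (x : T) : exists a b c, x = el a b c.
Proof.
have /C3P [a [b [c E]]] := subvsP x.
by exists a, b, c; apply: val_inj.
Qed.

Let mulel a b c a' b' c' : amul (el a b c) (el a' b' c') =
  el (a * a') (a * b' + b * a') (a * c' + b * b' + c * a').
Proof. by apply: mxs_inj; rewrite mxsM C3mxM. Qed.

Let elZ k a b c : k *: el a b c = el (k * a) (k * b) (k * c).
Proof. by apply: mxs_inj; rewrite mxsZ /= /C3mx !scalerDr !scalerA. Qed.

Let elD a b c a' b' c' : el a b c + el a' b' c' = el (a + a') (b + b') (c + c').
Proof.
apply: mxs_inj; rewrite mxsD /= /C3mx !scalerDl.
by rewrite [LHS](AC (3*3) ((1*4)*(2*5)*(3*6))).
Qed.

Let starel a b c : star (el a b c) = el a ((-1) ^+ s * b) ((-1) ^+ d * c).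
Proof. by apply: mxs_inj; rewrite mxsS C3_involE. Qed.

Let el0 : 0 = el 0 0 0.
Proof. by apply: mxs_inj; rewrite mxs0 /= /C3mx !scale0r !addr0. Qed.

Let el_inj a b c a' b' c' : el a b c = el a' b' c' -> [/\ a = a', b = b' & c = c'].
Proof. by move=> /(congr1 val) /= /C3_inj. Qed.

(** The element $e_{12}+e_{23}$ of degree [d] has square $e_{13}$, on which the superinvolution must
    act by $(-1)^d$; hence one parameter for the grading and for this sign. *)
Lemma C3_model : exists (e : T) J, model (d, s) (d, s) false e J.
Proof.
pose co (k : 'I_3) (x : T) : F := vsval x 0 k.
have co0 a b c : co 0 (el a b c) = a by rewrite /co /= C3mxE !mxE.
have co1 a b c : co 1 (el a b c) = b by rewrite /co /= C3mxE !mxE.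
exists (el 1 0 0), (fun x => co 0 x = 0).
(* Both factors are the same generator, so $bb'e_{13}$ is written as a sum of two equal halves. *)
apply: (@coord_model _ T _ _ _ _ (el 0 0 2%:R^-1) (el 0 0 2%:R^-1) (co 0) (co 1) (co 1)).
- by move=> x; have [a [b [c ->]]] := elE x; rewrite !mulel; split; congr el; ring.
- move=> k x y; have [a [b [c ->]]] := elE x; have [a' [b' [c' ->]]] := elE y.
  by rewrite elZ elD !co0.
- exact: co0.
- move=> x y; have [a [b [c ->]]] := elE x; have [a' [b' [c' ->]]] := elE y.
  rewrite !co0 !co1 => -> ->.
  by rewrite mulel !elZ elD; congr el; field.
- by rewrite expr0 scale1r.
- move=> x y z; have [a [b [c ->]]] := elE x; have [a' [b' [c' ->]]] := elE y.
  have [a2 [b2 [c2 ->]]] := elE z.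
  by rewrite !co0 => -> -> ->; rewrite !mulel el0; congr el; ring.
- move=> [i sk] x [hx sx]; have [a [b [c E]]] := elE x; subst x.
  have [ha hb hc] := HG hx.
  move: sx; rewrite starel elZ => /el_inj [ea eb ec].
  rewrite /= in ha hb hc ea eb ec.
  rewrite co0 co1.
  have Ha : a != 0 -> (i, sk) = sym0.
    have E0 : (-1) ^+ false * a = (-1) ^+ sk * a by rewrite expr0 mul1r.
    by move=> a0; rewrite (ha a0) -(sign_eq E0 a0).
  have Hb : b != 0 -> (i, sk) = (d, s).
    by move=> b0; rewrite (hb b0) (sign_eq eb b0).
  have Hc : c != 0 -> (i, sk) = (false, d).
    by move=> c0; rewrite (hc c0) (sign_eq ec c0).
  split=> // x0; rewrite !inE.
  have [a0|/Ha ->] := eqVneq a 0; last by rewrite eqxx.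
  have [b0|/Hb ->] := eqVneq b 0; last by rewrite eqxx orbT.
  have [c0|/Hc ->] := eqVneq c 0; last first.
    by rewrite /ptype /swap_sign /= andbb addbb addbF -addbA addbb addbF eqxx !orbT.
  by case/eqP: x0; rewrite el0 a0 b0 c0.
- exists (el 0 1 0), (el 0 1 0); split.
  + by split; [exact: G1|rewrite starel elZ /=; congr el; ring].
  + by split; [exact: G1|rewrite starel elZ /=; congr el; ring].
  rewrite /pmul mulel expr0 scale1r elD el0; apply/eqP => /el_inj [_ _].
  rewrite !(mul0r, mulr0, mulr1, addr0, add0r) => /eqP.
  by rewrite -[1 + 1]/(2%:R) (negbTE char2).
Qed.

End C3.

Section NU3.
Variables (G : bool -> 'M[F]_6 -> Prop) (s d : bool).
Hypothesis H : star_subalg (NU3 F s) G (@reflection F 6).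
Hypothesis HG : forall i a b c x y, G i (NU3mx s a b c x y) ->
  [/\ (a != 0) || (b != 0) -> i = false, c != 0 -> i = d & (x != 0) || (y != 0) -> i = d].
Hypothesis G0 : G false (NU3mx s 0 1 0 0 0).
Hypothesis G1 : G d (NU3mx s 0 0 1 0 0).

Let T := mxStarAlg H.
Let inC a b c x y : NU3mx s a b c x y \in NU3 F s.
Proof. by apply/NU3P; exists a, b, c, x, y. Qed.
Let el a b c x y : T := Subvs (inC a b c x y).

Let elE (z : T) : exists a b c x y, z = el a b c x y.
Proof.
have /NU3P [a [b [c [x [y E]]]]] := subvsP z.
by exists a, b, c, x, y; apply: val_inj.
Qed.

Let mulel a b c x y a' b' c' x' y' : amul (el a b c x y) (el a' b' c' x' y') =
  el (a * a') (a * b' + b * a') (a * c' + c * a')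
    (a * x' + c * b' + x * a') (a * y' + (-1) ^+ s * (b * c') + y * a').
Proof. by apply: mxs_inj; rewrite mxsM NU3mxM. Qed.

Let elZ k a b c x y : k *: el a b c x y = el (k * a) (k * b) (k * c) (k * x) (k * y).
Proof. by apply: mxs_inj; rewrite mxsZ /= /NU3mx !scalerDr !scalerA. Qed.

Let elD a b c x y a' b' c' x' y' : el a b c x y + el a' b' c' x' y' =
  el (a + a') (b + b') (c + c') (x + x') (y + y').
Proof.
apply: mxs_inj; rewrite mxsD /= !NU3mxE.
apply/matrixP => -[[|[|[|[|[|[|//]]]]]] ?] [[|[|[|[|[|[|//]]]]]] ?];
  by rewrite !mxE /=; ring.
Qed.

Let starel a b c x y : star (el a b c x y) = el a b ((-1) ^+ s * c) y x.
Proof. by apply: mxs_inj; rewrite mxsS NU3_reflectionE. Qed.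

Let el0 : 0 = el 0 0 0 0 0.
Proof. by apply: mxs_inj; rewrite mxs0 /= /NU3mx !scale0r !addr0. Qed.

Let el_inj a b c x y a' b' c' x' y' : el a b c x y = el a' b' c' x' y' ->
  [/\ a = a', b = b', c = c', x = x' & y = y'].
Proof.
move=> /(congr1 val) /=; rewrite !NU3mxE => /matrixP E.
split; [have := E 0 0|have := E 1 2|have := E 0 1|have := E 0 2|have := E 3 5];
  by rewrite !mxE.
Qed.

Lemma NU3_model : exists (e : T) J, model sym0 (d, s) true e J.
Proof.
pose co (i j : 'I_6) (x : T) : F := vsval x i j.
have coa a b c x y : co 0 0 (el a b c x y) = a by rewrite /co /= NU3mxE !mxE.
have cob a b c x y : co 1 2 (el a b c x y) = b by rewrite /co /= NU3mxE !mxE.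
have coc a b c x y : co 0 1 (el a b c x y) = c by rewrite /co /= NU3mxE !mxE.
exists (el 1 0 0 0 0), (fun x => co 0 0 x = 0).
(* The products of $E$ and $e_{12}\pm e_{56}$ in the two orders, $\pm e_{46}$ and $e_{13}$, are
   independent; this is allowed as [p1] is [sym0]. *)
apply: (@coord_model _ T _ _ _ _ (el 0 0 0 0 ((-1) ^+ s)) (el 0 0 0 1 0)
  (co 0 0) (co 1 2) (co 0 1)).
- by move=> z; have [a [b [c [x [y ->]]]]] := elE z; rewrite !mulel; split; congr el; ring.
- move=> k z z'; have [a [b [c [x [y ->]]]]] := elE z.
  have [a' [b' [c' [x' [y' ->]]]]] := elE z'.
  by rewrite elZ elD !coa.
- exact: coa.
- move=> z z'; have [a [b [c [x [y ->]]]]] := elE z.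
  have [a' [b' [c' [x' [y' ->]]]]] := elE z'.
  by rewrite !coa !cob !coc => -> ->; rewrite mulel !elZ elD; congr el; ring.
- by rewrite eqxx.
- move=> z z' z2; have [a [b [c [x [y ->]]]]] := elE z.
  have [a' [b' [c' [x' [y' ->]]]]] := elE z'.
  have [a2 [b2 [c2 [x2 [y2 ->]]]]] := elE z2.
  by rewrite !coa => -> -> ->; rewrite !mulel el0; congr el; ring.
- move=> [i sk] z [hz sz]; have [a [b [c [x [y E]]]]] := elE z; subst z.
  have [hab hc hxy] := HG hz.
  move: sz; rewrite starel elZ => /el_inj [ea eb ec exy eyx].
  rewrite /= in hab hc hxy ea eb ec exy eyx.
  rewrite coa cob coc.
  have E0 : (-1) ^+ false * a = (-1) ^+ sk * a by rewrite expr0 mul1r.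
  have E1 : (-1) ^+ false * b = (-1) ^+ sk * b by rewrite expr0 mul1r.
  have Ha : a != 0 -> (i, sk) = sym0.
    by move=> a0; rewrite hab ?a0 // -(sign_eq E0 a0).
  have Hb : b != 0 -> (i, sk) = sym0.
    by move=> b0; rewrite hab ?b0 ?orbT // -(sign_eq E1 b0).
  have Hc : c != 0 -> (i, sk) = (d, s).
    by move=> c0; rewrite (hc c0) (sign_eq ec c0).
  split=> // z0; rewrite !inE.
  have [a0|/Ha ->] := eqVneq a 0; last by rewrite eqxx.
  have [b0|/Hb ->] := eqVneq b 0; last by rewrite eqxx.
  have [c0|/Hc ->] := eqVneq c 0; last by rewrite eqxx !orbT.
  have Hxy : (x != 0) || (y != 0).
    apply: contraNT z0; rewrite negb_or !negbK => /andP [/eqP x0 /eqP y0].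
    by rewrite el0 a0 b0 c0 x0 y0.
  rewrite (hxy Hxy) /ptype /swap_sign /= !xpair_eqE !eqxx /=.
  by case: (sk); case: (s); rewrite ?orbT.
- exists (el 0 1 0 0 0), (el 0 0 1 0 0); split.
  + by split; [exact: G0|rewrite starel elZ /=; congr el; ring].
  + by split; [exact: G1|rewrite starel elZ /=; congr el; ring].
  rewrite /pmul !mulel elZ elD el0; apply/eqP => /el_inj [_ _ _ /eqP].
  by rewrite expr1 !(mul0r, mulr0, mulr1, addr0, add0r) oppr_eq0 oner_eq0.
Qed.

End NU3.

Section W.
Variables (G : bool -> 'M[F]_4 -> Prop) (r s d1 d2 : bool).
Hypothesis H : star_subalg (W F) G (W_invol r s ((d1 && d2) (+) r (+) s)).
Hypothesis HG : forall i a b c x, G i (Wmx a b c x) ->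
  [/\ a != 0 -> i = false, b != 0 -> i = d1, c != 0 -> i = d2 & x != 0 -> i = d1 (+) d2].
Hypothesis G1 : G d1 (Wmx 0 1 0 0).
Hypothesis G2 : G d2 (Wmx 0 0 1 0).

Let T := mxStarAlg H.
Let inC a b c x : Wmx a b c x \in W F.
Proof. by apply/WP; exists a, b, c, x. Qed.
Let el a b c x : T := Subvs (inC a b c x).

Let elE (z : T) : exists a b c x, z = el a b c x.
Proof.
have /WP [a [b [c [x E]]]] := subvsP z.
by exists a, b, c, x; apply: val_inj.
Qed.

Let mulel a b c x a' b' c' x' : amul (el a b c x) (el a' b' c' x') =
  el (a * a') (a * b' + b * a') (a * c' + c * a')
    (a * x' + b * c' + c * b' + x * a').
Proof. by apply: mxs_inj; rewrite mxsM WmxM. Qed.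

Let elZ k a b c x : k *: el a b c x = el (k * a) (k * b) (k * c) (k * x).
Proof. by apply: mxs_inj; rewrite mxsZ /= WmxZ. Qed.

Let elD a b c x a' b' c' x' : el a b c x + el a' b' c' x' =
  el (a + a') (b + b') (c + c') (x + x').
Proof.
apply: mxs_inj; rewrite mxsD /= !WmxE.
apply/matrixP => -[[|[|[|[|//]]]] ?] [[|[|[|[|//]]]] ?]; by rewrite !mxE /=; ring.
Qed.

Let starel a b c x : star (el a b c x) =
  el a ((-1) ^+ r * b) ((-1) ^+ s * c) ((-1) ^+ ((d1 && d2) (+) r (+) s) * x).
Proof. by apply: mxs_inj; rewrite mxsS W_involE. Qed.

Let el0 : 0 = el 0 0 0 0.
Proof. by apply: mxs_inj; rewrite mxs0 /= /Wmx !scale0r !addr0. Qed.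

Let el_inj a b c x a' b' c' x' : el a b c x = el a' b' c' x' ->
  [/\ a = a', b = b', c = c' & x = x'].
Proof. by move=> /(congr1 val) /= /W_inj. Qed.

(** The two generators commute, so it is their anticommutator that survives; the sign of $e_{14}$
    under the superinvolution is forced by the degrees and signs of its factors. *)
Lemma W_model : exists (e : T) J, model (d1, r) (d2, s) false e J.
Proof.
pose co (j : 'I_4) (x : T) : F := vsval x 0 j.
have coa a b c x : co 0 (el a b c x) = a by rewrite /co /= WmxE !mxE.
have cob a b c x : co 1 (el a b c x) = b by rewrite /co /= WmxE !mxE.
have coc a b c x : co 2 (el a b c x) = c by rewrite /co /= WmxE !mxE.
exists (el 1 0 0 0), (fun x => co 0 x = 0).
apply: (@coord_model _ T _ _ _ _ (el 0 0 0 1) (el 0 0 0 1) (co 0) (co 1) (co 2)).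
- by move=> z; have [a [b [c [x ->]]]] := elE z; rewrite !mulel; split; congr el; ring.
- move=> k z z'; have [a [b [c [x ->]]]] := elE z.
  have [a' [b' [c' [x' ->]]]] := elE z'.
  by rewrite elZ elD !coa.
- exact: coa.
- move=> z z'; have [a [b [c [x ->]]]] := elE z.
  have [a' [b' [c' [x' ->]]]] := elE z'.
  by rewrite !coa !cob !coc => -> ->; rewrite mulel !elZ elD; congr el; ring.
- by rewrite expr0 scale1r.
- move=> z z' z2; have [a [b [c [x ->]]]] := elE z.
  have [a' [b' [c' [x' ->]]]] := elE z'.
  have [a2 [b2 [c2 [x2 ->]]]] := elE z2.
  by rewrite !coa => -> -> ->; rewrite !mulel el0; congr el; ring.
- move=> [i sk] z [hz sz]; have [a [b [c [x E]]]] := elE z; subst z.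
  have [ha hb hc hx] := HG hz.
  move: sz; rewrite starel elZ => /el_inj [ea eb ec ex].
  rewrite /= in ha hb hc hx ea eb ec ex.
  rewrite coa cob coc.
  have E0 : (-1) ^+ false * a = (-1) ^+ sk * a by rewrite expr0 mul1r.
  have Ha : a != 0 -> (i, sk) = sym0.
    by move=> a0; rewrite (ha a0) -(sign_eq E0 a0).
  have Hb : b != 0 -> (i, sk) = (d1, r).
    by move=> b0; rewrite (hb b0) (sign_eq eb b0).
  have Hc : c != 0 -> (i, sk) = (d2, s).
    by move=> c0; rewrite (hc c0) (sign_eq ec c0).
  split=> // z0; rewrite !inE.
  have [a0|/Ha ->] := eqVneq a 0; last by rewrite eqxx.
  have [b0|/Hb ->] := eqVneq b 0; last by rewrite eqxx orbT.
  have [c0|/Hc ->] := eqVneq c 0; last by rewrite eqxx !orbT.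
  have x0 : x != 0.
    by apply: contraNneq z0 => x0; rewrite el0 a0 b0 c0 x0.
  by rewrite (hx x0) -(sign_eq ex x0) /ptype /swap_sign /= addbF eqxx !orbT.
- exists (el 0 1 0 0), (el 0 0 1 0); split.
  + by split; [exact: G1|rewrite starel elZ /=; congr el; ring].
  + by split; [exact: G2|rewrite starel elZ /=; congr el; ring].
  rewrite /pmul !mulel elZ elD el0; apply/eqP => /el_inj [_ _ _].
  rewrite expr0 !(mul0r, mulr0, mulr1, addr0, add0r) => /eqP.
  by rewrite -[1 + 1]/(2%:R) (negbTE char2).
Qed.

End W.

Lemma G2_model d1 d2 s1 s2 : exists (e : G2 F d1 d2 s1 s2) J,
  model (d1, s1) (d2, s2) true e J.
Proof.
pose T := G2 F d1 d2 s1 s2; pose el a b c x : T := G2vec (F := F) a b c x.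
have elE (z : T) : exists a b c x, z = el a b c x.
  by exists (z 0 0), (z 0 1), (z 0 2), (z 0 3); apply: G2vecP.
have el_inj a b c x a' b' c' x' : el a b c x = el a' b' c' x' ->
    [/\ a = a', b = b', c = c' & x = x'].
  move=> /rowP E; split; [have := E 0|have := E 1|have := E 2|have := E 3];
    by rewrite !mxE.
have mulel a b c x a' b' c' x' : amul (el a b c x) (el a' b' c' x') =
    el (a * a') (a * b' + b * a') (a * c' + c * a')
      (a * x' + b * c' - c * b' + x * a').
  by apply/rowP => k; rewrite !mxE.
have elZ k a b c x : k *: el a b c x = el (k * a) (k * b) (k * c) (k * x).
  by apply/rowP => -[[|[|[|[|//]]]] ?]; rewrite !mxE.
have elD a b c x a' b' c' x' : el a b c x + el a' b' c' x' =
    el (a + a') (b + b') (c + c') (x + x').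
  by apply/rowP => -[[|[|[|[|//]]]] ?]; rewrite !mxE.
have el0 : 0 = el 0 0 0 0.
  by apply/rowP => -[[|[|[|[|//]]]] ?]; rewrite !mxE.
have starel a b c x : star (el a b c x) = el a ((-1) ^+ s1 * b) ((-1) ^+ s2 * c)
    ((-1) ^+ (~~ ((d1 && d2) (+) s1 (+) s2)) * x).
  by apply/rowP => -[[|[|[|[|//]]]] ?]; rewrite !mxE //= expr0 mul1r.
have HG i a b c x : homog i (el a b c x) -> [/\ a != 0 -> i = false, b != 0 -> i = d1,
    c != 0 -> i = d2 & x != 0 -> i = d1 (+) d2].
  move=> h; have := (h 0, h 1, h 2, h 3); rewrite !mxE /= => -[[[h0 h1] h2] h3].
  by split=> [/h0|/h1|/h2|/h3].
pose co (j : 'I_4) (x : T) : F := x 0 j.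
have coa a b c x : co 0 (el a b c x) = a by rewrite /co !mxE.
have cob a b c x : co 1 (el a b c x) = b by rewrite /co !mxE.
have coc a b c x : co 2 (el a b c x) = c by rewrite /co !mxE.
exists (el 1 0 0 0), (fun x => co 0 x = 0).
(* The products of the generators are $e_1e_2$ and $e_2e_1=-e_1e_2$. *)
apply: (@coord_model _ T _ _ _ _ (el 0 0 0 1) (el 0 0 0 (-1)) (co 0) (co 1) (co 2)).
- by move=> z; have [a [b [c [x ->]]]] := elE z; rewrite !mulel; split; congr el; ring.
- move=> k z z'; have [a [b [c [x ->]]]] := elE z.
  have [a' [b' [c' [x' ->]]]] := elE z'.
  by rewrite elZ elD !coa.
- exact: coa.
- move=> z z'; have [a [b [c [x ->]]]] := elE z.
  have [a' [b' [c' [x' ->]]]] := elE z'.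
  by rewrite !coa !cob !coc => -> ->; rewrite mulel !elZ elD; congr el; ring.
- by move=> _; rewrite elZ; congr el; rewrite ?expr1; ring.
- move=> z z' z2; have [a [b [c [x ->]]]] := elE z.
  have [a' [b' [c' [x' ->]]]] := elE z'.
  have [a2 [b2 [c2 [x2 ->]]]] := elE z2.
  by rewrite !coa => -> -> ->; rewrite !mulel el0; congr el; ring.
- move=> [i sk] z [hz sz]; have [a [b [c [x E]]]] := elE z; subst z.
  have [ha hb hc hx] := HG _ _ _ _ _ hz.
  move: sz; rewrite starel elZ => /el_inj [ea eb ec ex].
  rewrite /= in ha hb hc hx ea eb ec ex.
  rewrite coa cob coc.
  have E0 : (-1) ^+ false * a = (-1) ^+ sk * a by rewrite expr0 mul1r.
  have Ha : a != 0 -> (i, sk) = sym0.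
    by move=> a0; rewrite (ha a0) -(sign_eq E0 a0).
  have Hb : b != 0 -> (i, sk) = (d1, s1).
    by move=> b0; rewrite (hb b0) (sign_eq eb b0).
  have Hc : c != 0 -> (i, sk) = (d2, s2).
    by move=> c0; rewrite (hc c0) (sign_eq ec c0).
  split=> // z0; rewrite !inE.
  have [a0|/Ha ->] := eqVneq a 0; last by rewrite eqxx.
  have [b0|/Hb ->] := eqVneq b 0; last by rewrite eqxx orbT.
  have [c0|/Hc ->] := eqVneq c 0; last by rewrite eqxx !orbT.
  have x0 : x != 0.
    by apply: contraNneq z0 => x0; rewrite el0 a0 b0 c0 x0.
  by rewrite (hx x0) -(sign_eq ex x0) /ptype /swap_sign /= addbT eqxx !orbT.
- exists (el 0 1 0 0), (el 0 0 1 0); split.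
  + split; last by rewrite starel elZ /=; congr el; ring.
    by move=> -[[|[|[|[|//]]]] ?]; rewrite !mxE /= ?eqxx.
  + split; last by rewrite starel elZ /=; congr el; ring.
    by move=> -[[|[|[|[|//]]]] ?]; rewrite !mxE /= ?eqxx.
  rewrite /pmul !mulel elZ elD el0; apply/eqP => /el_inj [_ _ _ E].
  by case/eqP: char2; rewrite -E expr1; ring.
Qed.

End MatrixModels.

(** * Polynomial growth *)

Section Growth.
Variable R : realType.
Implicit Types (c : nat -> nat) (al : R).

(** From some point on the ratio lies between 1/2 and 3/2. As the codimensions are natural numbers,
    this already forces the constant to be positive. *)
Lemma asymptotic_bounds c al k : asymptotic c al k -> exists a b : R,
  0 < a /\ exists N, forall n, (N <= n)%N ->
    a * n%:R ^+ k <= (c n)%:R /\ (c n)%:R <= b * n%:R ^+ k.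
Proof.
move=> /cvgrPdist_lt /(_ 2^-1) H.
have [|N _ {}H] := H; first by rewrite invr_gt0.
have bnd n : (N <= n)%N -> (0 < n)%N -> 0 < al /\
    (al / 2 * n%:R ^+ k <= (c n)%:R /\ (c n)%:R <= 3 / 2 * al * n%:R ^+ k).
  move=> Nn n0; have := H n Nn; rewrite /= ltr_distlC => /andP [h1 h2].
  have nk : 0 < n%:R ^+ k :> R by rewrite exprn_gt0 // ltr0n.
  have a0 : 0 < al.
    rewrite ltNge; apply/negP => al0.
    have : (c n)%:R / (al * n%:R ^+ k) <= 0 :> R.
      by rewrite mulr_ge0_le0 // invr_le0 mulr_le0_ge0 // ltW.
    by move: h1; lra.
  split=> //; have d0 : 0 < al * n%:R ^+ k by rewrite mulr_gt0.
  move: h1 h2; rewrite ltr_pdivlMr // ltr_pdivrMr //.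
  have -> : al / 2 * n%:R ^+ k = (al * n%:R ^+ k) / 2 by rewrite mulrAC.
  have -> : 3 / 2 * al * n%:R ^+ k = 3 / 2 * (al * n%:R ^+ k) by rewrite mulrA.
  by move: d0; move: (al * _) => x d0 h1 h2; split; lra.
have [a0 _] := bnd _ (leqnSn N) isT.
exists (al / 2), (3 / 2 * al); split; first by rewrite divr_gt0.
by exists N.+1 => n Nn; have [|_ //] := bnd n (ltnW Nn); apply: leq_ltn_trans Nn.
Qed.

Lemma natr_gt (x : R) : exists N : nat, forall n, (N <= n)%N -> x < n%:R.
Proof.
exists (Num.bound `|x|) => n le; apply: le_lt_trans (ler_norm x) _.
apply: lt_le_trans (archi_boundP (normr_ge0 x)) _.
by rewrite ler_nat.
Qed.

Lemma growth_compare (a b : R) N k t : 0 < a -> (forall n, (N <= n)%N ->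
  a * n%:R ^+ k <= b * n%:R ^+ t) -> (k <= t)%N.
Proof.
move=> a0 H; rewrite leqNgt; apply/negP => tk.
have [M hM] := natr_gt (b / a).
pose n := maxn N (maxn 1 M).
have n1 : (1 <= n)%N by rewrite !leq_max leqnn orbT.
have n0 : 0 < n%:R :> R by rewrite ltr0n.
have := hM n; rewrite !leq_max leqnn !orbT => /(_ isT).
rewrite ltr_pdivrMr // => bn.
have := H n (leq_maxl _ _); apply/negP; rewrite -ltNge.
apply: (@lt_le_trans _ _ (a * n%:R ^+ t.+1)).
  by rewrite exprS mulrA ltr_pM2r ?exprn_gt0 // mulrC.
by rewrite ler_pM2l // ler_weXn2l // ler1n.
Qed.

Lemma poly_growth_leq F (A B : starAlg F) k t :
  (exists N, forall n, (N <= n)%N -> (codim A n <= codim B n)%N) ->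
  poly_growth R A k -> poly_growth R B t -> (k <= t)%N.
Proof.
move=> [N0 H0] [al _ /asymptotic_bounds [a [b0 [a0 [N H]]]]].
move=> [al' _ /asymptotic_bounds [a1 [b [_ [N' H']]]]].
apply: (@growth_compare a b (maxn N0 (maxn N N'))) => // n.
rewrite !geq_max => /and3P [n0 n1 n2].
apply: le_trans (H n n1).1 _; apply: le_trans (H' n n2).2.
by rewrite ler_nat; apply: H0.
Qed.

Lemma quadratic_not_linear F (A : starAlg F) (m : nat) :
  poly_growth R A 2 -> (forall n, (0 < n)%N -> (codim A n <= 1 + n * m)%N) -> False.
Proof.
move=> [al _ /asymptotic_bounds [a [b0 [a0 [N H]]]]] le.
suff : (2 <= 1)%N by [].
apply: (@growth_compare a m.+1%:R (maxn 1 N)) => // n.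
rewrite geq_max => /andP [n0 n1]; apply: le_trans (H n n1).1 _.
rewrite expr1 -natrM ler_nat; apply: leq_trans (le n n0) _.
by rewrite mulSn mulnC leq_add2r.
Qed.

Lemma binomial_growth F (B : starAlg F) :
  (forall n, (0 < n)%N -> ('C(n, 2) <= codim B n)%N) ->
  (\forall n \near \oo, codim B n = 0%N) \/ (exists2 t, (t < 2)%N & poly_growth R B t) ->
  False.
Proof.
move=> H [[N _ h]|[t t2 [al _ /asymptotic_bounds [a1 [b [_ [N h]]]]]]].
  have n1 : (0 < N + 2)%N by rewrite addn2.
  have := H _ n1; rewrite (h (N + 2)%N) /= ?leq_addr // leqn0.
  by rewrite -leqn0 leqNgt bin_gt0 leq_addl.
have : (2 <= t)%N; last by rewrite leqNgt t2.
(* For $n\ge2$ the binomial coefficient $n(n-1)/2$ is at least $n^2/4$. *)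
apply: (@growth_compare 4^-1 b (maxn 2 N)); first by rewrite invr_gt0.
move=> n; rewrite geq_max => /andP [n2 n1].
apply: le_trans (h n n1).2; apply: (@le_trans _ _ ('C(n, 2)%:R)); last first.
  by rewrite ler_nat; apply: H; apply: ltnW.
have -> : ('C(n, 2)%:R : R) = n%:R * (n%:R - 1) / 2.
  have : (2 * 'C(n, 2))%N%:R = (n * n.-1)%N%:R :> R by rewrite -mul_bin_diag bin1.
  rewrite !natrM -subn1 natrB ?(ltnW n2) // => <-.
  by rewrite mulrC mulKf ?pnatr_eq0.
have : 2 <= n%:R :> R by rewrite ler_nat.
by move: (n%:R) => x x2; nra.
Qed.

Lemma linear_growth F (C : starAlg F) (b : bool) (m N : nat) :
  (forall n, (N <= n)%N -> codim C n = (b + n * m)%N) ->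
  (\forall n \near \oo, codim C n = 0%N) \/ (exists2 t, (t < 2)%N & poly_growth R C t).
Proof.
(* With slope 0 the codimensions are eventually 0, the nilpotent case, or eventually 1, of growth
   $n^0$; with positive slope the growth is linear. *)
move=> H; case: m H => [|m] H.
  case: b H => H; last by left; exists N => // n /= /H; rewrite muln0.
  right; exists 0%N => //; exists 1; first exact: oner_neq0.
  apply/cvgrPdist_lt => e e0; exists N => // n /= /H ->.
  by rewrite muln0 addn0 expr0 mulr1 divr1 (_ : true%:R = 1) // subrr normr0.
right; exists 1%N => //; exists m.+1%:R; first by rewrite pnatr_eq0.
apply/cvgrPdist_lt => e e0; have [M hM] := natr_gt e^-1.
exists (maxn 1 (maxn N M)) => // n /=; rewrite !geq_max => /and3P [n0 n1 n2].
rewrite (H n n1) expr1.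
have n0' : 0 < n%:R :> R by rewrite ltr0n.
have m0 : 0 < m.+1%:R :> R by rewrite ltr0n.
have -> : 1 - (b + n * m.+1)%N%:R / (m.+1%:R * n%:R) = - (b%:R / (m.+1%:R * n%:R)) :> R.
  rewrite natrD natrM [n%:R * _]mulrC mulrDl divff ?mulf_neq0 ?gt_eqF //.
  by rewrite opprD addrCA subrr addr0.
rewrite normrN ger0_norm; last by rewrite divr_ge0 // mulr_ge0 // ltW.
rewrite ltr_pdivrMr ?mulr_gt0 //.
have en : 1 < e * n%:R by have := hM n n2; rewrite -ltr_pdivrMl // mulr1.
have m1 : 1 <= m.+1%:R :> R by rewrite ler1n.
apply: (@le_lt_trans _ _ 1); first by case: b {H}.
rewrite mulrCA; apply: lt_le_trans en _.
by rewrite ler_peMl // mulr_ge0 // ltW.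
Qed.

End Growth.

(** * The sixteen atoms and their models *)

Section Atoms.
Variable F : fieldType.
Hypothesis char2 : 2%:R != 0 :> F.

Definition atom : Type := vtype * vtype * bool.

Definition is_model (p : atom) (B : starAlg F) : Prop :=
  valid_atom p.1.1 p.1.2 p.2 /\ exists (e : B) J, model p.1.1 p.1.2 p.2 e J.

Definition atoms : seq (atom * starAlg F) :=
  [:: (sym1, sym1, false, C3_i1_gr F); (skew0, skew0, false, C3_i2 F);
      (skew1, skew1, false, C3_i3_gr F);
      (sym0, sym0, true, U3_star F); (sym0, sym1, true, U3_star_gri F);
      (sym0, skew0, true, N3_star F); (sym0, skew1, true, N3_star_gri F);
      (sym1, sym1, true, G2_psi_gr F); (skew0, skew0, true, G2_tau F);
      (skew1, skew1, true, G2_tau_gr F); (skew0, skew1, true, G2_tau_gri F);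
      (skew1, sym1, true, G2_gamma_gr F); (skew0, sym1, true, G2_gamma_gri F);
      (skew0, sym1, false, W_eta1_gri F); (skew1, sym1, false, W_eta2_gr F);
      (skew0, skew1, false, W_eta3_gri F)].

Lemma C3_gr_model s : is_model ((true, s), (true, s), false) (mxStarAlg (C3_gr_subalg F s)).
Proof.
split=> //; apply: (C3_model char2); last by apply/C3_gr1P; exists 1.
move=> [] a b c.
  by move=> /C3_gr1P [b' /C3_inj [-> _ ->]]; rewrite eqxx; split.
by move=> /C3_gr0P [a' [c' /C3_inj [_ -> _]]]; rewrite eqxx; split.
Qed.

Lemma C3_trivial_model : is_model (skew0, skew0, false) (C3_i2 F).
Proof.
split=> //; apply: (C3_model char2); last by apply/C3P; exists 0, 1, 0.
move=> [] a b c //; rewrite /trivial_grading /split_grading memv0 => /eqP.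
rewrite (_ : 0 = C3mx 0 0 0); last by rewrite /C3mx !scale0r !addr0.
by move=> /C3_inj [-> -> ->]; rewrite eqxx.
Qed.

Lemma NU3_trivial_model s :
  is_model (sym0, (false, s), true) (mxStarAlg (NU3_trivial_subalg F s)).
Proof.
split; first by case: s.
apply: (@NU3_model F char2 _ s false (NU3_trivial_subalg F s)).
- move=> [] a b c x y //; rewrite /trivial_grading /split_grading memv0 => /eqP.
  rewrite (NU3mxE s a) => /matrixP E.
  have := (E 0 0, E 1 2, E 0 1, (E 0 2, E 3 5)); rewrite !mxE /=.
  by move=> [[[-> ->] ->] [-> ->]]; rewrite eqxx.
- by apply/NU3P; exists 0, 1, 0, 0, 0.
- by apply/NU3P; exists 0, 0, 1, 0, 0.
Qed.

Lemma NU3_gri_model s :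
  is_model (sym0, (true, s), true) (mxStarAlg (NU3_gri_subalg F s)).
Proof.
split; first by case: s.
apply: (@NU3_model F char2 _ s true (NU3_gri_subalg F s)).
- move=> i a b c x y h.
  have := (h 0 0, h 1 2, h 0 1, (h 0 2, h 3 5)); rewrite NU3mxE !mxE /=.
  move=> [[[ha hb] hc] [hx hy]]; split.
  + by case/orP => [/ha|/hb] <-.
  + by move/hc => <-.
  + by case/orP => [/hx|/hy] <-.
- exact: NU3_gri0.
- exact: NU3_gri1.
Qed.

Lemma W_gr_model r s : is_model ((true, r), (true, s), false) (mxStarAlg (W_gr_subalg F r s)).
Proof.
have E : (true && true) (+) r (+) s = ~~ (r (+) s) by case: r; case: s.
move: (W_gr_subalg F r s); rewrite -E => H.
split=> //; apply: (@W_model F char2 _ r s true true H).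
- move=> [] a b c x.
    by move=> /W_gr1P [b' [c' /W_inj [-> _ _ ->]]]; rewrite eqxx; split.
  by move=> /W_gr0P [a' [d' /W_inj [_ -> -> _]]]; rewrite eqxx; split.
- by apply/W_gr1P; exists 1, 0.
- by apply/W_gr1P; exists 0, 1.
Qed.

Lemma W_gri_model s : is_model (skew0, (true, s), false) (mxStarAlg (W_gri_subalg F true s)).
Proof.
split=> //; apply: (@W_model F char2 _ true s false true (W_gri_subalg F true s)).
- move=> [] a b c x.
    by move=> /W_gri1P [b' [c' /W_inj [-> -> _ _]]]; rewrite eqxx; split.
  by move=> /W_gri0P [a' [d' /W_inj [_ _ -> ->]]]; rewrite eqxx; split.
- by apply/W_gri0P; exists 0, 1.
- by apply/W_gri1P; exists 1, 0.
Qed.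

Lemma atoms_model x : List.In x atoms -> is_model x.1 x.2.
Proof.
have g2 d1 d2 s1 s2 : valid_atom (d1, s1) (d2, s2) true ->
    is_model ((d1, s1), (d2, s2), true) (G2 F d1 d2 s1 s2).
  by move=> v; split=> //; apply: G2_model.
rewrite /atoms /=.
do 16?[case=> [<-|]]; last by [].
- exact: C3_gr_model.
- exact: C3_trivial_model.
- exact: C3_gr_model.
- exact: NU3_trivial_model.
- exact: NU3_gri_model.
- exact: NU3_trivial_model.
- exact: NU3_gri_model.
- exact: g2.
- exact: g2.
- exact: g2.
- exact: g2.
- exact: g2.
- exact: g2.
- exact: W_gri_model.
- exact: W_gr_model.
- exact: W_gri_model.
Qed.

Lemma Itilde_atoms B : Itilde B <-> exists x, x.2 = B /\ List.In x atoms.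
Proof. exact: (List.in_map_iff snd atoms B). Qed.

Definition has_atom (A : starAlg F) (p : atom) : Prop :=
  exists u v : A, [/\ typed p.1.1 u, typed p.1.2 v & pmul p.2 u v != 0].

(** Only unordered pairs of types are listed, because exchanging its factors changes [pmul] at most
    by a sign. *)
Lemma atoms_cover (t t' : vtype) (eps : bool) :
  (t == sym0) || (t' == sym0) ==> eps -> exists p B, List.In (p, B) atoms /\
    (p = (t, t', eps) \/ p = (t', t, eps)).
Proof.
have H (p : atom) : has (fun x => x.1 == p) atoms -> exists B, List.In (p, B) atoms.
{ rewrite /atoms /=; do 16?[case/orP => [/eqP <-|]] => //.
  all: by eexists; repeat (first [left; reflexivity | right]). }
move=> v; suff : has (fun x => x.1 == (t, t', eps)) atoms ||
    has (fun x => x.1 == (t', t, eps)) atoms.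
  by case/orP => /H [B hB]; eexists; exists B; split; [exact: hB|left|exact: hB|right].
by case: t t' eps v => [[] []] [[] []] [].
Qed.

Lemma no_atom_pmul (A : starAlg F) : (forall x, List.In x atoms -> ~ has_atom A x.1) ->
  forall t t' (eps : bool) (u v : A), (t == sym0) || (t' == sym0) ==> eps ->
  typed t u -> typed t' v -> pmul eps u v = 0.
Proof.
move=> na t t' eps u v ht tu tv.
have [p [B [pB [E|E]]]] := atoms_cover ht; apply/eqP; apply: contrapT => /negP nz.
  by apply: (na _ pB); rewrite /= E; exists u, v.
apply: (na _ pB); rewrite /= E; exists v, u; split=> //=.
apply: contra nz => /eqP h; have : (-1) ^+ eps *: pmul eps v u = 0 by rewrite h scaler0.
rewrite /pmul scalerDr scalerA -signr_addb addbb scale1r addrC => ->.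
by rewrite eqxx.
Qed.

(** The vanishing commutators make $A_0^+$ commute with everything. For two factors outside $A_0^+$
    the anticommutator vanishes too, and then $2uv=0$. *)
Lemma no_atom_flat (A : starAlg F) : (forall x, List.In x atoms -> ~ has_atom A x.1) ->
  forall N, flat A N.
Proof.
move=> na N; have pm := no_atom_pmul na; apply: atomless_flat.
- move=> t t' u v t0 tu tv; apply/eqP; rewrite -subr_eq0; apply/eqP.
  have ht : (t == sym0) || (t' == sym0) ==> true by rewrite implybT.
  by have := pm t t' true u v ht tu tv; rewrite /pmul expr1 scaleN1r.
- move=> t t' u v n1 n2 tu tv.
  have ht eps : (t == sym0) || (t' == sym0) ==> eps by rewrite (negbTE n1) (negbTE n2).
  have := pm t t' false u v (ht _) tu tv; have := pm t t' true u v (ht _) tu tv.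
  rewrite /pmul expr0 expr1 scale1r scaleN1r => /eqP; rewrite subr_eq0 => /eqP <-.
  rewrite -mulr2n -scaler_nat => /eqP.
  by rewrite scaler_eq0 (negbTE char2) => /eqP.
Qed.

End Atoms.

(** * Classification of the minimal varieties *)

Section Main.
Variable F : fieldType.
Hypothesis charF : forall n : nat, (n%:R == 0 :> F) = (n == 0)%N.

Lemma char0_2 : 2%:R != 0 :> F. Proof. by rewrite charF. Qed.

(** The unit and a nonvanishing atom of [A] force [condL] and [condP] on its multilinear identities,
    and these two conditions suffice in the model. *)
Lemma atom_variety (A B : starAlg F) (p : atom) : unitary A -> is_model p B ->
  has_atom A p -> variety A B.
Proof.
move=> [e eu] [v [e' [J M]]] [a [b [ta tb nz]]].
apply: (linear_variety charF) => n c n0 /(star_id_mlpoly A c n0) id.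
apply/(star_id_mlpoly B c n0) => t.
have nw : iota 0 n != [::] by rewrite -size_eq0 size_iota -lt0n.
have pg := @perm_mlpart F n c t.
apply: (check_model char0_2 v M (iota_uniq 0 n) pg nw).
  exact: (ident_condL eu ta tb nz (iota_uniq 0 n) pg nw (id t)).
exact: (ident_condP eu ta tb nz (iota_uniq 0 n) pg nw (id t)).
Qed.

Variable R : realType.

Lemma sub_growth (B C : starAlg F) (p : atom) : is_model p B -> variety B C ->
  ~ variety C B ->
  (\forall n \near \oo, codim C n = 0%N) \/ (exists2 t, (t < 2)%N & poly_growth R C t).
Proof.
move=> [v [e [J M]]] BC nCB.
have [n [c [n0 cC cB]]] : exists n (c : {ffun mlmon n -> F^o}),
    [/\ (0 < n)%N, star_id C (mlpoly c) & ~ star_id B (mlpoly c)].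
  apply: contrapT => h; apply: nCB; apply: (linear_variety charF) => n c n0 cC.
  by apply: contrapT => cB; apply: h; exists n, c.
have [t nt] : exists t, ~ gident B (tyof t) (mlpart c t).
  apply: contrapT => h; apply: cB; apply/(star_id_mlpoly B c n0) => t.
  by apply: contrapT => ht; apply: h; exists t.
have nw : iota 0 n != [::] by rewrite -size_eq0 size_iota -lt0n.
have [m vm] := sub_vanishes char0_2 v M BC (iota_uniq 0 n) nw
  (@perm_mlpart F n c t) ((star_id_mlpoly C c n0).1 cC t) nt.
(* By [reached_leq], being reached can only be lost as the degree grows, so it is eventually
   constant. *)
have stable u : exists b N, forall k, (N <= k)%N -> `[< reached C k u >] = b.
  have [h|h] := pselect (forall k, reached C k u).
    by exists true, 0%N => k _; apply/asboolP.
  have [N nN] : exists N, ~ reached C N u.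
    by apply: contrapT => h'; apply: h => k; apply: contrapT => hk; apply: h'; exists k.
  by exists false, N => k Nk; apply/asboolP => /(reached_leq Nk).
have [b0 [N0 H0]] := stable sym0; have [b1 [N1 H1]] := stable skew0.
have [b2 [N2 H2]] := stable sym1; have [b3 [N3 H3]] := stable skew1.
pose N := maxn m.+2 (maxn (maxn N0 N1) (maxn N2 N3)).
apply: (@linear_growth R F C b0 (b1 + b2 + b3)%N N) => k.
rewrite !geq_max => /and3P [mk /andP [k0 k1] /andP [k2 k3]].
have k_gt0 : (0 < k)%N by apply: leq_trans mk.
rewrite (codim_flat k_gt0 (sub_flat char0_2 v M BC vm mk)) H0 //.
congr (_ + _ * _)%N; rewrite -sum1_card big_mkcond /=.
rewrite -(pair_big predT predT (fun i s => if (i, s) \in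
  [pred t | (t != sym0) && `[< reached C k t >]] then 1 else 0)%N) /=.
rewrite !big_bool /= !inE /= H1 // H2 // H3 // addn0.
by case: b1 {H1}; case: b2 {H2}; case: b3 {H3}.
Qed.

End Main.

Theorem corollary4p8 (R : realType) (F : fieldType)
    (charF : [pchar F] =i pred0) (A : starAlg F)
    (unitA : unitary A) (quadA : quadratic_growth R A) :
  generates_minimal R A <-> exists B : starAlg F, Itilde B /\ T_equiv A B.
Proof.
have ch : forall n : nat, (n%:R == 0 :> F) = (n == 0)%N by apply/pcharf0P.
have c2 := char0_2 ch.
split=> [[k [grA minA]]|[B [/Itilde_atoms [x [<- xB]] AB]]]; last first.
  exists 2; split=> // C [CA [D [AD nCD]]].
  apply: (sub_growth ch R (atoms_model c2 xB)).
    by rewrite /variety -AB; apply: CA.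
  (* If all identities of [C] held in [A], they would hold in [D] as well, against the choice of
     [D]. *)
  by rewrite /variety -AB => CA'; apply: nCD => f /CA' /AD.
(* Minimality comes with an exponent of its own; comparison with the quadratic growth of [A] bounds
   it. *)
have k2 : (k <= 2)%N by apply: poly_growth_leq grA quadA; exists 0%N.
have [na|] := pselect (forall x, List.In x (atoms F) -> ~ has_atom A x.1).
  (* Without atoms the codimensions are at most $1+4n$. *)
  exfalso; apply: (@quadratic_not_linear R F A #|{: vtype}| quadA) => n n0.
  rewrite (codim_flat n0 (no_atom_flat c2 na (N := n))) leq_add ?leq_b1 //.
  by rewrite leq_mul2l max_card orbT.
move=> /existsNP [x /not_implyP [xB /contrapT hx]].
have mB := atoms_model c2 xB; exists x.2; split; first by apply/Itilde_atoms; exists x.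
have AB := atom_variety ch unitA mB hx.
(* Otherwise the model would generate a proper subvariety, to which minimality assigns growth below
   $n^2$, against [codim_lower]. *)
apply/seteqP; split=> //; apply: contrapT => nBA; case: (mB) => v [e [J M]].
have [u [w [tu tw nz]]] := mod_wit M.
apply: (@binomial_growth R F x.2).
  by move=> n; apply: (codim_lower c2 v (mod_unit M) tu tw nz).
have [|h|[t tk gt]] := minA x.2.
- split; first by move=> D BD f /AB /BD.
  by exists A; split.
- by left.
- by right; exists t => //; apply: leq_trans tk k2.
Qed.
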